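(* Let $\gamma_0 > 0$ and $0 \le r < 1$, and put $\gamma_1 = \tfrac12(1+\sqrt{3})$ and $\gamma_2 = \gamma_0\gamma_1$. For each integer $d \ge 2$ let $\Sigma = \Sigma_d$ be a real symmetric $d\times d$ matrix such that $\|\Sigma\| \le \gamma_0 d^{r/2}$, and let $X$ be a random vector having the Bingham distribution on the unit sphere $\mathcal{S}^{d-1}\subset\mathbb{R}^d$ with parameter $\Sigma$. Then for all integers $l, m \ge 2$ and all $d > (6\gamma_2^2)^{1/(1-r)}$, $$\mathrm{Cov}(X) = \bigg(1 - \sum_{j=1}^{l-1} \frac{(1/2)_j}{(d/2)_j}\,\frac{C_{(j)}(\Sigma)}{j!}\bigg)\bigg(\sum_{k=1}^{m-1} \frac{(1/2)_k}{(d/2)_k}\,\frac{\nabla C_{(k)}(\Sigma)}{k!}\bigg) + O(d^{-\alpha}),$$ where $$\alpha = \tfrac12\min\{3-2r,\ 1+(m-1)(1-r)\} = \begin{cases}\tfrac12(2-r), & m=2,\\ \tfrac12(3-2r), & m\ge 3.\end{cases}$$ Here $O(d^{-\alpha})$ denotes a matrix remainder whose Frobenius norm is at most $\gamma\, d^{-\alpha}$ for all $d > (6\gamma_2^2)^{1/(1-r)}$, for some constant $\gamma>0$ not depending on $d$.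
   Context: $\mathrm{d}x$ denotes the normalized (total mass $1$) surface measure on $\mathcal{S}^{d-1}$, the unit sphere in $\mathbb{R}^d$ centered at the origin. The Bingham distribution with real symmetric $d \times d$ parameter matrix $\Sigma$ has density $\phi(x;\Sigma)=[\Psi_d(\Sigma)]^{-1}\exp(x'\Sigma x)$, $x\in\mathcal{S}^{d-1}$, with respect to $\mathrm{d}x$, where $\Psi_d(\Sigma)=\int_{\mathcal{S}^{d-1}}\exp(x'\Sigma x)\,\mathrm{d}x$. $\mathrm{Cov}(X)$ is the $d\times d$ covariance matrix of $X$. $\|A\| = [\mathrm{tr}(A^2)]^{1/2}$ is the Frobenius norm of a real symmetric matrix $A$. For $a\in\mathbb{R}$, $(a)_k = a(a+1)\cdots(a+k-1)$ is the rising factorial, with $(a)_0=1$. The zonal polynomial of the one-part partition $(k)$, evaluated at a real symmetric $d \times d$ matrix $\Sigma$, is $$C_{(k)}(\Sigma) = \frac{k!}{(1/2)_k}\sum_{i_1+2i_2+\cdots+ki_k=k}\ \prod_{j=1}^k \frac{[\mathrm{tr}(\Sigma^j)]^{i_j}}{i_j!\,(2j)^{i_j}},$$ where the sum is over all nonnegative integers $i_1,\ldots,i_k$ with $i_1+2i_2+\cdots+ki_k=k$. For a continuously differentiable real-valued function $f$ on the space of real symmetric $d\times d$ matrices $\Sigma=(\sigma_{i,j})$ (regarded as a function of the entries $\sigma_{i,j}$, $i\le j$, with $\sigma_{j,i}=\sigma_{i,j}$), the gradient $\nabla f(\Sigma)$ is the symmetric $d\times d$ matrix with $(i,j)$ entry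 $\tfrac12(1+\delta_{i,j})\,\partial f(\Sigma)/\partial\sigma_{i,j}$, where $\delta_{i,j}$ is Kronecker's delta. Equivalently, it is the gradient with respect to the inner product $\langle H_1,H_2\rangle=\mathrm{tr}(H_1H_2)$. *)

(* Defs.v *)
From HB Require Import structures.
From mathcomp Require Import all_boot all_order all_algebra.
From mathcomp Require Import all_classical all_reals all_analysis.
From mathcomp Require Import measurable_realfun.

Set Implicit Arguments.
Unset Strict Implicit.
Unset Printing Implicit Defensive.

Import Order.TTheory GRing.Theory Num.Theory.
Import numFieldNormedType.Exports.

Local Open Scope classical_set_scope.
Local Open Scope ring_scope.

(* A point of R^d is a [d.-tuple R], which carries the product of the Borel
   sigma-algebras of the coordinates; [tcol] is the associated column. *)
Definition tcol (R : realType) (d : nat) (x : d.-tuple R) : 'cV[R]_d :=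
  \col_i tnth x i.

Definition quad_form (R : realType) (d : nat) (S : 'M[R]_d) (x : d.-tuple R)
  : R := ((tcol x)^T *m S *m tcol x) ord0 ord0.

Definition enorm (R : realType) (d : nat) (x : d.-tuple R) : R :=
  Num.sqrt (\sum_(i < d) tnth x i ^+ 2).

Definition sphere (R : realType) (d : nat) : set (d.-tuple R) :=
  [set x | enorm x = 1].

Definition direction (R : realType) (d : nat) (x : d.-tuple R) : d.-tuple R :=
  [tuple tnth x i / enorm x | i < d].

(* d-dimensional Lebesgue measure, as an iterated product measure. *)
Fixpoint lebesgue_tuple (R : realType) (d : nat) :
    set (d.-tuple R) -> \bar R :=
  match d return set (d.-tuple R) -> \bar R with
  | 0%N => dirac [tuple]
  | n.+1 => pushforward (lebesgue_measure \x @lebesgue_tuple R n)%E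
              (fun z : R * n.-tuple R => [tuple of z.1 :: z.2])
  end.

Section lebesgue_tuple_measure.
Local Open Scope ereal_scope.
Context (R : realType).

Let pushforward_sfm d1 d2 d3 (T1 : measurableType d1) (T2 : measurableType d2)
    (T3 : measurableType d3) (m1 : {sigma_finite_measure set T1 -> \bar R})
    (m2 : {sigma_finite_measure set T2 -> \bar R}) (f : T1 * T2 -> T3)
    (g : T3 -> T1 * T2) :
  measurable_fun [set: T1 * T2] f -> measurable_fun [set: T3] g ->
  cancel f g ->
  exists M : {sigma_finite_measure set T3 -> \bar R},
    (M : set T3 -> \bar R) = pushforward (m1 \x m2) f.
Proof.
move=> mf mg fK.
have [N0 N0E] : exists N0 : {measure set T3 -> \bar R},
    (N0 : set T3 -> \bar R) = pushforward (m1 \x m2) f.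
  by exists (measure_function_pushforward__canonical__measure_function_Measure
    (m1 \x m2) mf).
have sN : sigma_finite setT N0.
  have /sigma_finiteP[F [TF ndF Foo]] := sigma_finiteT m1.
  have /sigma_finiteP[G [TG ndG Goo]] := sigma_finiteT m2.
  exists (fun k => g @^-1` (F k `*` G k)) => [|k].
    rewrite -preimage_bigcup -[LHS](preimage_setT g); congr preimage.
    rewrite -setXTT TF TG predeqE => -[x y]; split; last first.
      by move=> [n _ []/= ? ?]; split; exists n.
    move=> [/= [n _ Fnx] [k _ Gky]]; exists (maxn n k) => //; split.
    - by move: x Fnx; exact/subsetPset/ndF/leq_maxl.
    - by move: y Gky; exact/subsetPset/ndG/leq_maxr.
  have [? ?] := Foo k; have [? ?] := Goo k; split.
    by rewrite -[X in measurable X]setTI; apply: mg => //; exact: measurableX.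
  rewrite N0E /pushforward -comp_preimage (_ : _ \o _ = id).
    by rewrite preimage_id product_measure1E// lte_mul_pinfty// ge0_fin_numE.
  by apply/funext => z; exact: fK.
pose H1 := isSFinite.Build _ _ _ _ (sfinite_measure_sigma_finite sN).
pose H2 := isSigmaFinite.Build _ _ _ _ sN.
pose N := HB.pack_for (SigmaFiniteMeasure.type T3 R) (Measure.sort N0) H1 H2.
by exists N.
Qed.

Let lebesgue_tuple_sfm (d : nat) :
  exists M : {sigma_finite_measure set (d.-tuple R) -> \bar R},
    forall A, M A = @lebesgue_tuple R d A.
Proof.
elim: d => [|n [M ME]].
  by exists (dirac [tuple]).
pose g (x : n.+1.-tuple R) : measurableTypeR R * n.-tuple R :=
  (tnth x ord0, [tuple of behead x]).
pose f (z : measurableTypeR R * n.-tuple R) : n.+1.-tuple R :=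
  [tuple of z.1 :: z.2].
have mf : measurable_fun setT f by exact: measurable_cons.
have mg : measurable_fun setT g.
  apply/measurable_fun_pairP; split; first exact: measurable_tnth.
  exact: measurable_behead.
have fK : cancel f g by move=> [a t]; congr (_, _); exact/val_inj.
have [N NE] := pushforward_sfm (@lebesgue_measure R) M mf mg fK.
exists N => A; rewrite NE /= /pushforward /product_measure1.
by apply: eq_integral => x _ /=; rewrite ME.
Qed.


Let lebesgue_tuple0 d : @lebesgue_tuple R d set0 = 0.
Proof. by have [M <-] := lebesgue_tuple_sfm d. Qed.

Let lebesgue_tuple_ge0 d A : 0 <= @lebesgue_tuple R d A.
Proof. by have [M <-] := lebesgue_tuple_sfm d. Qed.

Let lebesgue_tuple_sigma_additive d :
  semi_sigma_additive (@lebesgue_tuple R d).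
Proof.
have [M ME] := lebesgue_tuple_sfm d; rewrite -(funext ME).
exact: measure_semi_sigma_additive.
Qed.

HB.instance Definition _ (d : nat) := isMeasure.Build _ _ _
  (@lebesgue_tuple R d) (lebesgue_tuple0 d) (@lebesgue_tuple_ge0 d)
  (@lebesgue_tuple_sigma_additive d).

Let lebesgue_tuple_sigma_finite d : sigma_finite setT (@lebesgue_tuple R d).
Proof.
have [M ME] := lebesgue_tuple_sfm d; rewrite -(funext ME).
exact: sigma_finiteT.
Qed.

HB.instance Definition _ (d : nat) := Measure_isSigmaFinite.Build _ _ _
  (@lebesgue_tuple R d) (lebesgue_tuple_sigma_finite d).

End lebesgue_tuple_measure.

(* The normalized surface measure of the unit sphere, as a measure on R^d that
   is concentrated on the sphere: the surface measure of a Borel part A of the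
   sphere is d times the volume of the cone {t a | a in A, 0 < t <= 1}, so the
   normalized one is the ratio of this volume to that of the punctured ball,
   which is the cone over the whole sphere. *)
Definition cone (R : realType) (d : nat) (A : set (d.-tuple R)) :
    set (d.-tuple R) :=
  [set x | 0 < enorm x <= 1 /\ A (direction x)].

Definition sphere_measure (R : realType) (d : nat) (A : set (d.-tuple R)) :
    \bar R :=
  (((fine (lebesgue_tuple (cone (@sphere R d))))^-1)%:E
     * lebesgue_tuple (cone A))%E.

Section sphere_measure_measure.
Local Open Scope ereal_scope.
Context (R : realType) (d : nat).

Let measurable_enorm : measurable_fun setT (@enorm R d).
Proof.
rewrite (_ : @enorm R d =
    fun x : d.-tuple R => ((\sum_(i < d) tnth x i ^+ 2) `^ (2^-1))%R); last first.
  by apply/funext => x; rewrite powR12_sqrt// sumr_ge0// => i _; exact: sqr_ge0.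
apply: (@measurableT_comp _ _ _ _ _ _ (fun y : R => y `^ (2^-1))%R) => /=.
  exact: measurable_powR.
apply: measurable_sum => i; apply: measurable_funX; exact: measurable_tnth.
Qed.

Let measurable_direction : measurable_fun setT (@direction R d).
Proof.
apply/measurable_fun_tnthP => i; rewrite (_ : _ \o _ =
    fun x : d.-tuple R => (tnth x i * enorm x `^ (-1))%R); last first.
  by apply/funext => x /=; rewrite tnth_mktuple powR_inv1// sqrtr_ge0.
apply: measurable_funM; first exact: measurable_tnth.
exact: (@measurableT_comp _ _ _ _ _ _ (fun y : R => y `^ (-1))%R).
Qed.

Let measurable_cone (A : set (d.-tuple R)) :
  measurable A -> measurable (cone A).
Proof.
move=> mA; apply: measurableI.
  have mb : measurable_fun setT
      (fun x : d.-tuple R => (0 < enorm x)%R && (enorm x <= 1)%R).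
    apply: measurable_and; first exact: measurable_fun_ltr.
    exact: measurable_fun_ler.
  by have := mb measurableT [set true] I; rewrite setTI.
by rewrite -[X in measurable X]setTI; exact: measurable_direction.
Qed.

Let sphere_measure0 : @sphere_measure R d set0 = 0.
Proof.
rewrite /sphere_measure (_ : cone set0 = set0) ?measure0 ?mule0//.
by apply/seteqP; split=> x // -[].
Qed.

Let sphere_measure_ge0 A : 0 <= @sphere_measure R d A.
Proof. by rewrite mule_ge0// lee_fin invr_ge0 fine_ge0. Qed.

Let sphere_measure_sigma_additive : semi_sigma_additive (@sphere_measure R d).
Proof.
move=> F mF tF mUF; rewrite /sphere_measure.
rewrite (_ : cone (\bigcup_n F n) = \bigcup_n cone (F n)); last first.
  apply/seteqP; split=> x; first by move=> [x1 [n _ Fn]]; exists n.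
  by move=> [n _ [x1 Fn]]; split=> //; exists n.
under eq_fun do rewrite -ge0_sume_distrr//.
apply: cvgeZl => //; apply: measure_semi_sigma_additive.
- by move=> n; exact: measurable_cone.
- move=> i j _ _ [x [[_ Fi] [_ Fj]]]; apply: tF => //.
  by exists (direction x).
- by apply: bigcup_measurable => n _; exact: measurable_cone.
Qed.

HB.instance Definition _ := isMeasure.Build _ _ _ (@sphere_measure R d)
  sphere_measure0 sphere_measure_ge0 sphere_measure_sigma_additive.

End sphere_measure_measure.

Definition bingham_const (R : realType) (d : nat) (S : 'M[R]_d) : R :=
  \int[@sphere_measure R d]_(x in @sphere R d) expR (quad_form S x).

Definition bingham_density (R : realType) (d : nat) (S : 'M[R]_d)
    (x : d.-tuple R) : R :=
  (bingham_const S)^-1 * expR (quad_form S x).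

Definition has_bingham (R : realType) (disp : measure_display)
    (T : measurableType disp) (P : probability T R) (d : nat)
    (X : {RV P >-> d.-tuple R}) (S : 'M[R]_d) : Prop :=
  forall A : set (d.-tuple R), measurable A ->
    (distribution P X A =
     \int[@sphere_measure R d]_(x in A `&` @sphere R d)
       (bingham_density S x)%:E)%E.

Definition cov_matrix (R : realType) (disp : measure_display)
    (T : measurableType disp) (P : probability T R) (d : nat)
    (X : T -> d.-tuple R) : 'M[R]_d :=
  \matrix_(i, j) fine (covariance P (fun t => tnth (X t) i)
                                    (fun t => tnth (X t) j)).

Definition frobenius (R : realType) (d : nat) (A : 'M[R]_d) : R :=
  Num.sqrt (\tr (A ^+ 2)).

Definition rising (R : realType) (a : R) (k : nat) : R :=
  \prod_(i < k) (a + i%:R).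

(* The multiplicity of the part j + 1 is [i j]; it is at most k. *)
Definition zonal (R : realType) (d k : nat) (S : 'M[R]_d) : R :=
  k`!%:R / rising (2^-1) k *
  \sum_(i : {ffun 'I_k -> 'I_k.+1} | (\sum_(j < k) j.+1 * i j == k)%N)
    \prod_(j < k) ((\tr (S ^+ j.+1)) ^+ i j
                     / ((i j)`!%:R * (2 * j.+1%:R) ^+ i j)).

(* The direction in which a symmetric matrix moves when its (i, j) entry, and
   with it its (j, i) entry, varies. *)
Definition sym_unit (R : realType) (d : nat) (i j : 'I_d) : 'M[R]_d :=
  if i == j then delta_mx i i else delta_mx i j + delta_mx j i.

Definition gradient (R : realType) (d : nat) (f : 'M[R]_d -> R)
    (S : 'M[R]_d) : 'M[R]_d :=
  \matrix_(i, j) (2^-1 * (1 + (i == j)%:R) * 'D_(sym_unit R i j) f S).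

(* Main.v *)
From HB Require Import structures.
Require Import Defs.
From mathcomp Require Import all_boot all_order all_algebra.
From mathcomp Require Import all_classical all_reals all_analysis.
From mathcomp Require Import measurable_realfun ring lra zify.

Set Implicit Arguments.
Unset Strict Implicit.
Unset Printing Implicit Defensive.

Import Order.TTheory GRing.Theory Num.Theory.
Import numFieldNormedType.Exports.

Local Open Scope classical_set_scope.
Local Open Scope ring_scope.

(** The covariance of a Bingham vector is [B / (1 + A)], where
    [1 + A = E exp(x^T S x)] and [B = E (exp(x^T S x) x x^T)] are means over the
    uniform distribution of the sphere: the mean of [x exp(x^T S x)] vanishes
    because the sphere is symmetric. Put [eta = fnorm S / sqrt d]; the hypothesis
    on [S] makes [eta] of order [d ^ (- (1 - r) / 2)], which tends to [0].

    On the sphere [q = x^T S x] behaves as a random variable of size [eta]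
    with exponential tails: [|E q^k| <= k! (2 eta)^k]. Hence the second order
    Taylor remainder [f = exp q - 1 - q] has [L^2] norm [O(eta^2)]. By
    Cauchy-Schwarz and [E (x^T M x)^2 <= fnorm M ^ 2 / d], every mean
    [E (g x x^T)] has Frobenius norm at most [sqrt (E g^2 / d)]. So
      [A = tr S / d + O(eta^2)]   and
      [B = E (x x^T) + E (q x x^T) + O(eta^2 / sqrt d)],
    with [fnorm B = O(1 / sqrt d)].

    The two sums of the theorem have the same expansions. Their terms of index
    1, and of index 2 for the matrix sum, are exactly [tr S / d], [E (x x^T)] and
    [E (q x x^T)]; all the others are small for a crude reason: [C_(k)] is
    a polynomial in traces of powers of [S], of weight [k], so that it is
    [O(t^k)] with a gradient of norm [O(sqrt d t^(k-1))], where
    [t = sqrt d fnorm S = d eta]. Since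
    [B / (1 + A) - (1 - A') B' = A^2 / (1 + A) B + (A' - A) B + (1 - A') (B - B')],
    the error is [O(eta^2 / sqrt d)], or [O(eta / sqrt d)] when [m = 2] and
    [E (q x x^T)] is missing from [B']. The finitely many dimensions in which
    [eta] is not small are absorbed by the constant.

    The moments on the sphere come from Gaussian ones. The Gaussian weight
    [exp(- |x|^2)] is a product, so that one variable integration by parts gives
    [2 E (x_i f) = E (df / dx_i)] for polynomials ([gauss_stein]); it is also
    radial, so that polar coordinates ([ge0_integral_polar]) turn this identity
    into the recursion [sphere_stein] for the moments on the sphere. *)

(** * Gaussian moments in one variable *)
Section gaussian_moments.
Context {R : realType}.
Local Notation mu := (@lebesgue_measure R).

Lemma normr_expn_le (n : nat) (y : R) : `|y| ^+ n <= 1 + y ^+ (2 * n).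
Proof.
rewrite mulnC exprM -[y ^+ n ^+ 2]real_normK ?num_real// normrX.
set a := `|y| ^+ n; nra.
Qed.

(** One half of the exponent absorbs the power: [y ^ (2 n)] is a term of the
    series of [exp (y ^ 2 / 2)], up to a factor. *)
Lemma expr_expR_le (n : nat) (y : R) :
  `|y ^+ n * expR (- y ^+ 2)| <= (1 + 2 ^+ n * n`!%:R) * expR (- (y ^+ 2 / 2)).
Proof.
have e2 : expR (- y ^+ 2) = expR (- (y ^+ 2 / 2)) * expR (- (y ^+ 2 / 2)).
  by rewrite -expRD; congr expR; lra.
rewrite normrM normrX [`|expR _|]ger0_norm ?expR_ge0// e2 mulrA.
rewrite ler_pM2r ?expR_gt0//.
have h1 := normr_expn_le n y.
have y0 : 0 <= y ^+ 2 / 2 by rewrite divr_ge0// sqr_ge0.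
have h2 : y ^+ (2 * n) <= 2 ^+ n * n`!%:R * expR (y ^+ 2 / 2).
  have := expR_ge1Dxn n.-1 y0.
  case: n {h1} => [|n] /=.
    by rewrite muln0 !expr0 fact0 !mul1r => _; have := expR_ge1Dx (y ^+ 2 / 2); lra.
  move=> h; rewrite exprM.
  have -> : (y ^+ 2) ^+ n.+1 = 2 ^+ n.+1 * n.+1`!%:R * ((y ^+ 2 / 2) ^+ n.+1 / n.+1`!%:R).
    rewrite expr_div_n; field.
    by rewrite expf_neq0//= pnatr_eq0 -lt0n fact_gt0.
  rewrite ler_wpM2l ?mulr_ge0 ?exprn_ge0//.
  by apply: le_trans h; lra.
have eE : expR (- (y ^+ 2 / 2)) <= 1.
  by rewrite -[leRHS]expR0 ler_expR oppr_le0.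
have e0 := expR_gt0 (- (y ^+ 2 / 2)).
have em : expR (y ^+ 2 / 2) * expR (- (y ^+ 2 / 2)) = 1.
  by rewrite -expRD subrr expR0.
apply: (@le_trans _ _ ((1 + 2 ^+ n * n`!%:R * expR (y ^+ 2 / 2)) * expR (- (y ^+ 2 / 2)))).
  by rewrite ler_pM2r//; lra.
rewrite mulrDl mul1r -mulrA em mulr1; lra.
Qed.

Lemma integrable_expR_half :
  mu.-integrable setT (fun y : R => (expR (- (y ^+ 2 / 2)))%:E).
Proof.
have := @integrable_normal_pdf R 0 1.
move/(integrableZl measurableT (normal_peak (1 : R))^-1).
apply: eq_integrable => // y _.
rewrite /normal_pdf oner_eq0 -EFinM; congr (_%:E).
rewrite mulKf ?gt_eqF ?normal_peak_gt0 ?oner_neq0//.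
by rewrite /normal_fun subr0 expr1n mulNr.
Qed.

Lemma measurable_expr_expR (n : nat) :
  measurable_fun setT (fun y : R => y ^+ n * expR (- y ^+ 2)).
Proof.
apply: measurable_funM; first exact: exprn_measurable.
apply: measurableT_comp => //; apply: measurableT_comp => //.
Qed.

Lemma integrable_expr_expR (n : nat) :
  mu.-integrable setT (fun y : R => (y ^+ n * expR (- y ^+ 2))%:E).
Proof.
apply: (le_integrable measurableT _ _
  (integrableZl measurableT (1 + 2 ^+ n * n`!%:R) integrable_expR_half)) => //.
  by apply/measurable_EFinP; exact: measurable_expr_expR.
move=> y _; rewrite -EFinM !abse_EFin lee_fin.
by rewrite (le_trans (expr_expR_le n y))// ler_norm.
Qed.

Definition gauss_moment (n : nat) : R := \int[mu]_y (y ^+ n * expR (- y ^+ 2)).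

Lemma integral_derivative_eq0 (F f : R -> R) :
  (forall y : R, is_derive y 1 F (f y)) -> continuous f ->
  mu.-integrable setT (EFin \o f) ->
  F k%:R @[k --> \oo] --> (0 : R) -> F (- k%:R) @[k --> \oo] --> (0 : R) ->
  \int[mu]_y f y = 0.
Proof.
move=> dF cf intf F0 FN0.
have mf : measurable_fun setT f by exact: continuous_measurable_fun.
have cF : continuous F.
  by move=> y; apply: differentiable_continuous; apply/derivable1_diffP; case: (dF y).
pose g k : R -> \bar R := (EFin \o f) \_ `[- k%:R, k%:R].
have gE k : (\int[mu]_y g k.+1 y = (F k.+1%:R)%:E - (F (- k.+1%:R))%:E)%E.
  rewrite /g -integral_mkcond; apply: continuous_FTC2.
  - by apply: (@lt_trans _ _ 0); rewrite ?oppr_lt0 ltr0n.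
  - exact: continuous_subspaceT.
  - split=> [y _| |]; first by case: (dF y).
      by apply: cvg_at_right_filter; exact: cF.
    by apply: cvg_at_left_filter; exact: cF.
  - by move=> y _; rewrite derive1E; case: (dF y).
have gcvg (y : R) : g k y @[k --> \oo] --> (f y)%:E.
  apply: cvg_near_cst; exists (Num.truncn `|y|).+1 => // k /= ky.
  rewrite /g patchE mem_set //= in_itv /= -ler_norml.
  apply: (le_trans (ltW (truncnS_gt `|y|))); by rewrite ler_nat.
have mg k : measurable_fun setT (g k.+1).
  apply/(measurable_restrictT (EFin \o f)) => //.
  by apply: measurable_funTS; exact/measurable_EFinP.
have gf k y : (`|g k.+1 y| <= `|(f y)%:E|)%E.
  by rewrite /g patchE; case: ifP => _ //=; rewrite normr0 lee_fin.
have gcvgS y : g k.+1 y @[k --> \oo] --> (EFin \o f) y.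
  by rewrite (cvg_shiftS (g^~ y)); exact: gcvg.
have [||||| _ _ cvint] := @dominated_convergence _ _ _ mu setT measurableT
  (fun k => g k.+1) (EFin \o f) (abse \o (EFin \o f)).
- exact: mg.
- exact: measurable_int intf.
- by apply: aeW => y _; exact: gcvgS.
- exact: integrable_abse.
- by apply: aeW => y k _; exact: gf.
have cv0 : (\int[mu]_y g k.+1 y)%E @[k --> \oo] --> (0 : \bar R).
  under eq_fun do rewrite gE -EFinB.
  apply: cvg_EFin; first by near=> k.
  rewrite /comp /= -[0 in X in _ --> X](subr0 0).
  by apply: cvgB; [rewrite (cvg_shiftS (fun k => F k%:R))|
    rewrite (cvg_shiftS (fun k => F (- k%:R)))].
by rewrite /Rintegral (cvg_unique _ cvint cv0).
Unshelve. all: by end_near. Qed.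

Lemma expr_expR_cvg0 (n : nat) (u : nat -> R) :
  (forall k, `|u k| = k%:R) -> u k ^+ n * expR (- u k ^+ 2) @[k --> \oo] --> 0.
Proof.
move=> uk; pose C : R := 1 + 2 ^+ n.+1 * n.+1`!%:R.
have cinv : C * k%:R^-1 @[k --> \oo] --> (0 : R).
  rewrite -[0](mulr0 C); apply: cvgM; first exact: cvg_cst.
  apply/gtr0_cvgV0; last exact: cvgr_idn.
  by exists 1%N => // k /=; rewrite ltr0n.
have cNinv : - (C * k%:R^-1) @[k --> \oo] --> (0 : R).
  by rewrite -[0]oppr0; apply: cvgN.
apply: (squeeze_cvgr _ cNinv cinv).
exists 1%N => // k /= k1.
have k0 : 0 < k%:R :> R by rewrite ltr0n.
rewrite -ler_norml ler_pdivlMr// -(uk k) mulrC -normrM mulrA -exprS.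
apply: (le_trans (expr_expR_le n.+1 (u k))).
rewrite ler_piMr//.
  by rewrite -[leRHS]expR0 ler_expR oppr_le0 divr_ge0// sqr_ge0.
Qed.

(** Integration by parts: [n y ^ (n - 1) e - 2 y ^ (n + 1) e] is the derivative of
    [y ^ n e], where [e = exp (- y ^ 2)]. *)
Lemma gauss_moment_rec (n : nat) :
  2 * gauss_moment n.+1 = n%:R * gauss_moment n.-1.
Proof.
pose f (y : R) := n%:R * (y ^+ n.-1 * expR (- y ^+ 2)) - 2 * (y ^+ n.+1 * expR (- y ^+ 2)).
have := @integral_derivative_eq0 (fun y => y ^+ n * expR (- y ^+ 2)) f _ _ _ _ _.
have i1 := integrableZl measurableT n%:R (integrable_expr_expR n.-1).
have i2 := integrableZl measurableT 2 (integrable_expr_expR n.+1).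
rewrite /f RintegralB// !RintegralZl//; try exact: integrable_expr_expR.
move=> H; apply/esym/eqP; rewrite -subr_eq0; apply/eqP; apply: H.
- move=> y.
  have d1 : is_derive y 1 (fun z : R => z ^+ n) (n%:R * y ^+ n.-1).
    rewrite (_ : (fun z : R => z ^+ n) = id ^+ n); last by apply/funext => z; rewrite fctE.
    have := is_deriveX n (is_derive_id y (1 : R)).
    move=> H; refine (is_derive_eq H _); by rewrite /GRing.scale /= mulr1.
  have d2 : is_derive y 1 (fun z : R => - z ^+ 2) (- (2 * y)).
    rewrite (_ : (fun z : R => - z ^+ 2) = - (id ^+ 2)); last by apply/funext => z; rewrite !fctE.
    have := is_deriveN (is_deriveX 2 (is_derive_id y (1 : R))).
    move=> H; refine (is_derive_eq H _); by rewrite /GRing.scale /= mulr1 expr1.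
  have d3 := @is_derive1_comp _ expR (fun z : R => - z ^+ 2) _ _ _
    (is_derive_expR (- y ^+ 2)) d2.
  rewrite (_ : (fun z : R => _ * _) =
    (fun z : R => z ^+ n) * (expR \o (fun z : R => - z ^+ 2))); last first.
    by apply/funext => z; rewrite fctE.
  have := is_deriveM d1 d3.
  move=> H; refine (is_derive_eq H _).
  by rewrite /GRing.scale /= (exprS y n); ring.
- have cX k : continuous (fun y : R => y ^+ k * expR (- y ^+ 2)).
    move=> y; apply: cvgM; first exact: exprn_continuous.
    apply: (@continuous_comp _ _ _ (fun y : R => - y ^+ 2) expR); last exact: continuous_expR.
    by apply: cvgN; exact: exprn_continuous.
  by move=> y; apply: cvgB; apply: cvgM; [exact: cvg_cst|exact: cX|exact: cvg_cst|exact: cX].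
- exact: eq_integrable (integrableB measurableT i1 i2).
- by apply: expr_expR_cvg0 => k; rewrite normr_nat.
- by apply: expr_expR_cvg0 => k; rewrite normrN normr_nat.
Qed.

Lemma gauss_moment0_gt0 : 0 < gauss_moment 0.
Proof.
rewrite /gauss_moment; under eq_Rintegral do rewrite expr0 mul1r.
by rewrite /Rintegral (@integralT_gauss R) /= sqrtr_gt0 pi_gt0.
Qed.

End gaussian_moments.

(** * Integration on tuples: Fubini and scaling *)
Section lebesgue_tuple_integration.
Context {R : realType}.
Local Open Scope ereal_scope.
Local Notation mu := (@lebesgue_measure R).

Lemma measurable_tcons n : measurable_fun setT
  (fun z : measurableTypeR R * n.-tuple R => [tuple of z.1 :: z.2] : n.+1.-tuple R).
Proof. exact: measurable_cons. Qed.

Lemma ge0_integral_lebesgue_tupleS n (f : n.+1.-tuple R -> \bar R) :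
  measurable_fun setT f -> (forall x, 0 <= f x) ->
  \int[@lebesgue_tuple R n.+1]_x f x =
  \int[mu]_y \int[@lebesgue_tuple R n]_z f [tuple of y :: z].
Proof.
move=> mf f0.
have := @ge0_integral_pushforward _ _ _ _ R _ (@measurable_tcons n)
  (mu \x @lebesgue_tuple R n) setT f measurableT mf (fun y _ => f0 y).
rewrite (@eq_measure_integral _ _ _ _ (@lebesgue_tuple R n.+1));
  [move=> ->|exact: measurable_tcons|by []].
rewrite preimage_setT fubini_tonelli1 => [||z]; [by []| |exact: f0].
apply: measurableT_comp mf _; exact: measurable_tcons.
Qed.

Lemma integrable_lebesgue_tupleS n (f : n.+1.-tuple R -> \bar R) :
  measurable_fun setT f ->
  \int[mu]_y \int[@lebesgue_tuple R n]_z `|f [tuple of y :: z]| < +oo ->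
  (@lebesgue_tuple R n.+1).-integrable setT f.
Proof.
move=> mf foo; apply/integrableP; split => //.
by rewrite ge0_integral_lebesgue_tupleS//; exact: measurableT_comp.
Qed.

Lemma integral_lebesgue_tupleS n (f : n.+1.-tuple R -> \bar R) :
  (@lebesgue_tuple R n.+1).-integrable setT f ->
  \int[@lebesgue_tuple R n.+1]_x f x =
  \int[mu]_y \int[@lebesgue_tuple R n]_z f [tuple of y :: z].
Proof.
move=> intf; have mf := measurable_int _ intf.
have mfc : measurable_fun setT (fun z : measurableTypeR R * n.-tuple R => f [tuple of z.1 :: z.2]).
  apply: measurableT_comp mf _; exact: measurable_tcons.
have intfc : (mu \x @lebesgue_tuple R n).-integrable setT
   (fun z : measurableTypeR R * n.-tuple R => f [tuple of z.1 :: z.2]).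
  apply/integrable12ltyP => //.
  rewrite -(@ge0_integral_lebesgue_tupleS _ (abse \o f)) => [||z].
  - by case/integrableP: intf.
  - exact: measurableT_comp.
  - exact: abse_ge0.
have := @integral_pushforward _ _ _ _ R _ (@measurable_tcons n)
  (mu \x @lebesgue_tuple R n) setT f mf intfc measurableT.
rewrite (@eq_measure_integral _ _ _ _ (@lebesgue_tuple R n.+1));
  [move=> ->|exact: measurable_tcons|by []].
by rewrite preimage_setT -integral12_prod_meas1.
Qed.

Lemma measurable_tnth_comp n i (h : R -> R) : measurable_fun setT h ->
  measurable_fun setT (fun x : n.-tuple R => h (tnth x i)).
Proof. by move=> mh; apply: measurableT_comp mh _; exact: measurable_tnth. Qed.

Lemma integral_lebesgue_tuple_prod n (h : 'I_n -> R -> R) :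
  (forall i, measurable_fun setT (h i)) ->
  (forall i, mu.-integrable setT (EFin \o h i)) ->
  (@lebesgue_tuple R n).-integrable setT (fun x => (\prod_i h i (tnth x i))%:E) /\
  \int[@lebesgue_tuple R n]_x (\prod_i h i (tnth x i))%:E =
  (\prod_i (\int[mu]_y h i y)%R)%:E.
Proof.
elim: n h => [|n IH] h mh ih.
  have fE : (fun x : 0.-tuple R => (\prod_(i < 0) h i (tnth x i))%:E) = cst 1.
    by apply/funext => x; rewrite big_ord0.
  rewrite fE big_ord0 integral_cst//=; split.
    apply/integrableP; split => //.
    under eq_integral do rewrite /= normr1.
    by rewrite integral_cst//= mul1e diracT ltry.
  by rewrite mul1e diracT.
have mprod m (g : 'I_m -> R -> R) : (forall i, measurable_fun setT (g i)) ->
    measurable_fun setT (fun x : m.-tuple R => (\prod_i g i (tnth x i))%:E).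
  move=> mg; apply/measurable_EFinP.
  by apply: measurable_prod => i _; exact: measurable_tnth_comp.
have prodE (y : R) (z : n.-tuple R) : (\prod_(i < n.+1) h i (tnth [tuple of y :: z] i) =
    h ord0 y * \prod_i h (lift ord0 i) (tnth z i))%R.
  by rewrite big_ord_recl tnth0; congr (_ * _)%R; apply: eq_bigr => i _; rewrite tnthS.
have [int1 eq1] := IH (fun i => h (lift ord0 i)) (fun i => mh _) (fun i => ih _).
have [_ eq2] := IH (fun i y => `|h (lift ord0 i) y|%R)
  (fun i => measurableT_comp (@normr_measurable _ _) (mh _))
  (fun i => integrable_norm (ih _)).
have int0 : (@lebesgue_tuple R n.+1).-integrable setT
    (fun x => (\prod_i h i (tnth x i))%:E).
  apply: integrable_lebesgue_tupleS; first exact: mprod.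
  under eq_integral do under eq_integral do rewrite prodE EFinM abseM.
  have E y : \int[@lebesgue_tuple R n]_z (`|(h ord0 y)%:E| *
      `|(\prod_i h (lift ord0 i) (tnth z i))%:E|) =
      `|(h ord0 y)%:E| * (\prod_i (\int[mu]_y `|h (lift ord0 i) y|)%R)%:E.
    rewrite ge0_integralZl//.
      by under eq_integral do rewrite /= normr_prod; rewrite eq2.
    by apply: measurableT_comp => //; exact: (mprod _ (fun i => h (lift ord0 i))).
  under eq_integral do rewrite E.
  rewrite ge0_integralZr//.
  - case/integrableP: (ih ord0) => _ oo; rewrite muleC lte_mul_pinfty//.
    by rewrite lee_fin prodr_ge0// => i _; rewrite Rintegral_ge0.
  - exact: measurableT_comp (measurable_int _ (ih ord0)).
  - by rewrite lee_fin prodr_ge0// => i _; rewrite Rintegral_ge0.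
split=> //; rewrite integral_lebesgue_tupleS//.
under eq_integral do under eq_integral do rewrite prodE EFinM.
under eq_integral do rewrite integralZl// eq1.
rewrite integralZr//; last exact: (ih ord0).
rewrite big_ord_recl EFinM; congr (_ * _).
by rewrite /Rintegral fineK//; exact: integrable_fin_num (ih ord0).
Qed.


(** Both sides are measures of [A], and they agree on intervals; the two signs
    of [c] differ by which end of the preimage is closed. *)
Lemma lebesgue_measure_scale (c : R) (A : set R) : c != 0%R ->
  measurable A ->
  mu A = `|c|%:E * mu ((fun y : R => (c * y)%R) @^-1` A).
Proof.
move=> c0 mA.
have mphi : measurable_fun setT ((fun y : R => (c * y)%R) : _ -> measurableTypeR R).
  exact: measurable_funM.
pose m := mscale (NngNum (normr_ge0 c))
  (measure_function_pushforward__canonical__measure_function_Measure mu mphi).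
rewrite (@lebesgue_measure_unique R m) //.
move=> _ [[a b]] _ <-.
change (mu `]a, b] = `|c|%:E * mu ((fun y : R => (c * y)%R) @^-1` `]a, b])).
have [c_lt|c_gt|/eqP] := ltgtP c 0%R; last by rewrite (negbTE c0).
- rewrite (_ : _ @^-1` _ = `[(b / c)%R, (a / c)%R[%classic); last first.
    apply/seteqP; split=> y /=; rewrite !in_itv /= ler_ndivrMr// ltr_ndivlMr// mulrC.
      by move=> /andP[-> ->].
    by move=> /andP[-> ->].
  rewrite !lebesgue_measure_itv /= !lte_fin ltr_ndivrMr// divfK// ltr0_norm//.
  case: ifP => _; last by rewrite mule0.
  by rewrite -EFinM; congr (_%:E); field.
- rewrite (_ : _ @^-1` _ = `](a / c)%R, (b / c)%R]%classic); last first.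
    apply/seteqP; split=> y /=; rewrite !in_itv /= ler_pdivlMr// ltr_pdivrMr// mulrC.
      by move=> /andP[-> ->].
    by move=> /andP[-> ->].
  rewrite !lebesgue_measure_itv /= !lte_fin ltr_pdivlMr// divfK// gtr0_norm//.
  case: ifP => _; last by rewrite mule0.
  by rewrite -EFinM; congr (_%:E); field.
Qed.

Lemma ge0_integral_scale1 (c : R) (f : R -> \bar R) : c != 0%R ->
  measurable_fun setT f -> (forall y, 0 <= f y) ->
  \int[mu]_y f y = `|c|%:E * \int[mu]_y f (c * y)%R.
Proof.
move=> c0 mf f0.
have mphi : measurable_fun setT ((fun y : R => (c * y)%R) : _ -> measurableTypeR R).
  exact: measurable_funM.
have := @ge0_integral_pushforward _ _ (measurableTypeR R) (measurableTypeR R) R _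
  mphi mu setT f measurableT mf (fun y _ => f0 y).
rewrite preimage_setT => <-.
rewrite -(@ge0_integral_mscale _ _ _ _ _ measurableT (NngNum (normr_ge0 c)))//.
by apply: eq_measure_integral => A mA _; exact: lebesgue_measure_scale.
Qed.

Definition tscale n (c : R) (x : n.-tuple R) : n.-tuple R :=
  [tuple (c * tnth x i)%R | i < n].

Lemma tscale_cons n (c y : R) (z : n.-tuple R) :
  tscale c [tuple of y :: z] = [tuple of (c * y)%R :: tscale c z].
Proof.
apply: eq_from_tnth => i; rewrite tnth_mktuple.
by have [j ->|->] := unliftP ord0 i; rewrite ?tnthS ?tnth_mktuple ?tnth0.
Qed.

Lemma measurable_tscale n (c : R) : measurable_fun setT (@tscale n c).
Proof.
apply/measurable_fun_tnthP => i.
rewrite (_ : _ \o _ = (fun x : n.-tuple R => c * tnth x i)%R); last first.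
  by apply/funext => x /=; rewrite tnth_mktuple.
by apply: measurable_funM => //; exact: measurable_tnth.
Qed.

(** This is all that is needed of the change of variables formula: [c > 0]
    gives polar coordinates, [c = -1] the symmetry of the sphere. *)
Lemma ge0_integral_tscale n (c : R) (f : n.-tuple R -> \bar R) : c != 0%R ->
  measurable_fun setT f -> (forall x, 0 <= f x) ->
  \int[@lebesgue_tuple R n]_x f x =
  (`|c| ^+ n)%:E * \int[@lebesgue_tuple R n]_x f (tscale c x).
Proof.
move=> c0; elim: n f => [|n IH] f mf f0.
  by rewrite expr0 mul1e; apply: eq_integral => x _; rewrite (tuple0 x) [tscale _ _]tuple0.
have mfs : measurable_fun setT (fun x => f (tscale c x)).
  by apply: measurableT_comp mf _; exact: measurable_tscale.
rewrite !ge0_integral_lebesgue_tupleS//.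
under [in RHS]eq_integral do under eq_integral do rewrite tscale_cons.
have mfz y : measurable_fun setT (fun z : n.-tuple R => f [tuple of y :: z]).
  apply: measurableT_comp mf _.
  exact: (@measurable_cons _ _ _ _ (fun=> y) _ id).
have mF : measurable_fun setT (fun y : measurableTypeR R =>
    \int[@lebesgue_tuple R n]_z f [tuple of y :: tscale c z]).
  apply: (@measurable_fun_fubini_tonelli_F _ _ (measurableTypeR R) _ R
    (@lebesgue_tuple R n)
    (fun z : measurableTypeR R * n.-tuple R => f [tuple of z.1 :: tscale c z.2])).
    apply: measurableT_comp mf _.
    apply: measurable_cons; first exact: measurable_fst.
    by apply: measurableT_comp => //; exact: measurable_tscale.
  by move=> z; exact: f0.
have E y := IH _ (mfz y) (fun z => f0 _).
transitivity (\int[mu]_y ((`|c| ^+ n)%:E *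
    \int[@lebesgue_tuple R n]_z f [tuple of y :: tscale c z])).
  by apply: eq_integral => y _; exact: E.
rewrite ge0_integralZl => [||//|y _|].
- rewrite (ge0_integral_scale1 c0) => [|//|y].
    by rewrite muleA -EFinM -exprSr.
  exact: integral_ge0.
- exact: measurableT.
- exact: integral_ge0.
- by rewrite lee_fin exprn_ge0.
Qed.

End lebesgue_tuple_integration.

(** * The sphere and the cones over its subsets *)
Section sphere_geometry.
Context {R : realType}.
Implicit Types (c : R).

Definition sqnorm n (x : n.-tuple R) : R := \sum_(i < n) tnth x i ^+ 2.

Lemma sqnorm_ge0 n (x : n.-tuple R) : 0 <= sqnorm x.
Proof. by rewrite sumr_ge0// => i _; exact: sqr_ge0. Qed.

Lemma enormE n (x : n.-tuple R) : enorm x = Num.sqrt (sqnorm x).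
Proof. by []. Qed.

Lemma sqr_enorm n (x : n.-tuple R) : enorm x ^+ 2 = sqnorm x.
Proof. by rewrite sqr_sqrtr// sqnorm_ge0. Qed.

Lemma enorm_ge0 n (x : n.-tuple R) : 0 <= enorm x.
Proof. exact: sqrtr_ge0. Qed.

Lemma measurable_sqnorm n : measurable_fun setT (@sqnorm n).
Proof.
apply: measurable_sum => i; apply: measurable_funX; exact: measurable_tnth.
Qed.

Lemma measurable_enorm n : measurable_fun setT (@enorm R n).
Proof.
apply: (@measurableT_comp _ _ _ _ _ _ (@Num.sqrt R)); last exact: measurable_sqnorm.
by apply: continuous_measurable_fun; exact: sqrt_continuous.
Qed.

Lemma directionE n (x : n.-tuple R) : direction x = tscale (enorm x)^-1 x.
Proof.
by apply: eq_from_tnth => i; rewrite !tnth_mktuple mulrC.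
Qed.

Lemma measurable_direction n : measurable_fun setT (@direction R n).
Proof.
apply/measurable_fun_tnthP => i; rewrite (_ : _ \o _ =
    fun x : n.-tuple R => tnth x i * enorm x `^ (-1)); last first.
  by apply/funext => x /=; rewrite tnth_mktuple powR_inv1// enorm_ge0.
apply: measurable_funM; first exact: measurable_tnth.
apply: (@measurableT_comp _ _ _ _ _ _ (fun y : R => y `^ (-1))) => //.
exact: measurable_enorm.
Qed.

Lemma sqnorm_tscale n c (x : n.-tuple R) : sqnorm (tscale c x) = c ^+ 2 * sqnorm x.
Proof.
by rewrite /sqnorm mulr_sumr; apply: eq_bigr => i _; rewrite tnth_mktuple exprMn.
Qed.

Lemma enorm_tscale n c (x : n.-tuple R) : enorm (tscale c x) = `|c| * enorm x.
Proof. by rewrite !enormE sqnorm_tscale sqrtrM ?sqr_ge0// sqrtr_sqr. Qed.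

Lemma tscaleA n b c (x : n.-tuple R) : tscale b (tscale c x) = tscale (b * c) x.
Proof. by apply: eq_from_tnth => i; rewrite !tnth_mktuple mulrA. Qed.

Lemma direction_tscale n c (x : n.-tuple R) : 0 < c ->
  direction (tscale c x) = direction x.
Proof.
move=> c0; rewrite !directionE tscaleA enorm_tscale gtr0_norm//.
by rewrite invfM mulrAC mulVf ?gt_eqF// mul1r.
Qed.

Lemma tscale_direction n (x : n.-tuple R) : 0 < enorm x ->
  tscale (enorm x) (direction x) = x.
Proof.
move=> x0; rewrite directionE tscaleA divff ?gt_eqF//.
by apply: eq_from_tnth => i; rewrite tnth_mktuple mul1r.
Qed.

Lemma enorm_direction n (x : n.-tuple R) : 0 < enorm x -> enorm (direction x) = 1.
Proof.
move=> x0; rewrite directionE enorm_tscale gtr0_norm ?invr_gt0//.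
by rewrite mulVf// gt_eqF.
Qed.

Lemma cone_setT n : cone setT = cone (@sphere R n).
Proof.
apply/seteqP; split => x [/andP[x0 x1] _]; split; rewrite ?x0//.
by rewrite /sphere /= enorm_direction.
Qed.

Lemma measurable_sphere n : measurable (@sphere R n).
Proof.
rewrite -[X in measurable X]setTI.
exact: (measurable_enorm measurableT (measurable_set1 1)).
Qed.

(** The preimage of [B `*` A] under polar coordinates; the origin is left out
    because it has no direction. *)
Definition shell n (B : set R) (A : set (n.-tuple R)) : set (n.-tuple R) :=
  [set x | [/\ 0 < enorm x, B (enorm x) & A (direction x)]].

Lemma measurable_shell n (B : set R) (A : set (n.-tuple R)) :
  measurable B -> measurable A -> measurable (shell B A).
Proof.
move=> mB mA; rewrite (_ : shell B A = (@enorm R n @^-1` `]0, +oo[) `&`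
    ((@enorm R n @^-1` B) `&` (@direction R n @^-1` A))); last first.
  apply/seteqP; split=> x /=; rewrite in_itv/= andbT.
    by case.
  by case=> ? [].
apply: measurableI; last apply: measurableI.
- by rewrite -[X in measurable X]setTI; exact: measurable_enorm.
- by rewrite -[X in measurable X]setTI; apply: measurable_enorm.
- by rewrite -[X in measurable X]setTI; apply: measurable_direction.
Qed.

Lemma coneE n (A : set (n.-tuple R)) : cone A = shell `]-oo, 1] A.
Proof.
apply/seteqP; split=> x; rewrite /cone /shell /= in_itv /=.
  by move=> [/andP[]].
by move=> [-> ->].
Qed.

Lemma lebesgue_shell n (A : set (n.+1.-tuple R)) (s : R) : measurable A ->
  lebesgue_tuple (shell `]-oo, s] A) =
  ((Num.max s 0 ^+ n.+1)%:E * lebesgue_tuple (cone A))%E.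
Proof.
move=> mA; have [s0|s0] := leP s 0.
  rewrite expr0n mul0e (_ : shell _ _ = set0) ?measure0//.
  apply/seteqP; split=> x //; rewrite /shell /= in_itv /= => -[x0 xs _].
  by move: (lt_le_trans x0 (le_trans xs s0)); rewrite ltxx.
have mB : measurable (`]-oo, s] : set R) by [].
have mS := measurable_shell mB mA.
have mC : measurable (cone A) by rewrite coneE; exact: measurable_shell.
have iE (E : set (n.+1.-tuple R)) : measurable E ->
    lebesgue_tuple E = (\int[@lebesgue_tuple R n.+1]_x (\1_E x)%:E)%E.
  by move=> mE; rewrite integral_indic// setIT.
rewrite !iE// (@ge0_integral_tscale _ _ s) ?gt_eqF//.
- rewrite gtr0_norm//; congr (_ * _)%E; apply: eq_integral => x _; congr (_%:E).
  rewrite !indicE; congr ((nat_of_bool _)%:R); apply/idP/idP; rewrite !inE coneE.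
    rewrite /shell /= !in_itv /= enorm_tscale direction_tscale// gtr0_norm//.
    by rewrite pmulr_rgt0// ger_pMr.
  rewrite /shell /= !in_itv /= enorm_tscale direction_tscale// gtr0_norm//.
  by rewrite pmulr_rgt0// ger_pMr.
- by apply/measurable_EFinP; exact: measurable_indic.
Qed.

End sphere_geometry.

(** * The Gaussian weight and the volume of the ball *)
Section gaussian_weight.
Context {R : realType}.
Local Notation lambda n := (@lebesgue_tuple R n).

Definition gweight n (x : n.-tuple R) : R := expR (- sqnorm x).

Definition monomial n (a : 'I_n -> nat) (x : n.-tuple R) : R :=
  \prod_i tnth x i ^+ a i.

Lemma monomial_gweightE n (a : 'I_n -> nat) (x : n.-tuple R) :
  monomial a x * gweight x = \prod_i (tnth x i ^+ a i * expR (- tnth x i ^+ 2)).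
Proof.
rewrite big_split /=; congr (_ * _).
by rewrite /gweight /sqnorm -sumrN expR_sum.
Qed.

Lemma integrable_monomial n (a : 'I_n -> nat) :
  (lambda n).-integrable setT (fun x => (monomial a x * gweight x)%:E).
Proof.
under eq_fun do rewrite monomial_gweightE.
have [] // := integral_lebesgue_tuple_prod (fun i => @measurable_expr_expR R (a i))
  (fun i => integrable_expr_expR (a i)).
Qed.

Lemma integral_monomial n (a : 'I_n -> nat) :
  \int[lambda n]_x (monomial a x * gweight x) = \prod_i gauss_moment (a i).
Proof.
under eq_Rintegral do rewrite monomial_gweightE.
have [_] := integral_lebesgue_tuple_prod (fun i => @measurable_expr_expR R (a i))
  (fun i => integrable_expr_expR (a i)).
by rewrite /Rintegral => ->.
Qed.

Lemma monomial0 n (x : n.-tuple R) : monomial (fun=> 0%N) x = 1.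
Proof. by rewrite /monomial big1. Qed.

(** The Gaussian weight is integrable and bounded below on the unit ball. *)
Lemma lebesgue_cone_lty n (A : set (n.-tuple R)) : measurable A ->
  (lambda n (cone A) < +oo)%E.
Proof.
move=> mA; have mC : measurable (cone A) by rewrite coneE; exact: measurable_shell.
have ig := integrableZl measurableT (expR 1) (integrable_monomial (fun _ : 'I_n => 0%N)).
have /integrableP[_] := ig; apply: le_lt_trans.
rewrite -[cone A]setIT -integral_indic//; apply: ge0_le_integral => //.
- by apply/measurable_EFinP; exact: measurable_indic.
- exact: measurable_int (integrable_abse ig).
- move=> x _; rewrite monomial0 mul1r -EFinM abse_EFin lee_fin indicE.
  case: (boolP (x \in _)) => [|_]; last exact: normr_ge0.
  rewrite inE => -[/andP[x0 x1] _].
  rewrite ger0_norm ?mulr_ge0 ?expR_ge0// -expRD -[leLHS]expR0 ler_expR.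
  by rewrite subr_ge0 -sqr_enorm expr_le1// enorm_ge0.
Qed.

(** If the ball were null, then so would be all its dilates, hence the complement
    of the origin, and every Gaussian moment of a monomial that vanishes at the
    origin would be zero. *)
Lemma lebesgue_cone_sphere_gt0 n : (0 < lambda n.+1 (cone (@sphere R n.+1)))%E.
Proof.
rewrite lt0e measure_ge0 andbT; apply/eqP => V0.
have mS : measurable (shell setT setT : set (n.+1.-tuple R)).
  exact: measurable_shell.
have S0 : lambda n.+1 (shell setT setT) = 0.
  have -> : shell setT setT =
      \bigcup_k (shell `]-oo, k%:R] setT : set (n.+1.-tuple R)).
    apply/seteqP; split=> x /=.
      move=> [x0 _ _]; exists (Num.truncn (enorm x)).+1 => //.
      by split; rewrite //= in_itv/= ltW// truncnS_gt.
    by move=> [k _ [x0 _ _]].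
  apply: measure_negligible; first by apply: bigcup_measurable => k _; exact: measurable_shell.
  apply: negligible_bigcup => k; apply/negligibleP; first exact: measurable_shell.
  have := @lebesgue_shell R n setT k%:R measurableT.
  by rewrite cone_setT V0 mule0.
(* The monomial [x_0 ^ 2], whose Gaussian moment is positive. *)
pose a (i : 'I_n.+1) : nat := if i == ord0 then 2 else 0%N.
have : \int[lambda n.+1]_x (monomial a x * gweight x) = 0.
  rewrite /Rintegral (@ae_eq_integral _ _ _ _ setT (cst 0%E))//.
  - by rewrite integral0.
  - exact: measurable_int (integrable_monomial a).
  - exists (shell setT setT); split => // x /= H; split => //.
    rewrite lt_neqAle enorm_ge0 andbT; apply/eqP => x0; apply: H => _.
    have : sqnorm x = 0 by rewrite -sqr_enorm -x0 expr0n.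
    rewrite /sqnorm => /eqP; rewrite psumr_eq0 => [/allP/(_ ord0)|i _]; last exact: sqr_ge0.
    rewrite mem_index_enum sqrf_eq0 => /(_ isT)/eqP t0.
    by rewrite /monomial big_ord_recl t0 expr0n /= !mul0r.
rewrite integral_monomial big_ord_recl /= => /eqP; rewrite mulf_eq0 => /orP[/eqP|].
  have := @gauss_moment_rec R 1; rewrite /= mul1r => h g2.
  by have := @gauss_moment0_gt0 R; rewrite -h g2 mulr0 ltxx.
by rewrite prodf_seq_eq0 => /hasP[i _ /=]; rewrite gt_eqF ?gauss_moment0_gt0.
Qed.

End gaussian_weight.

(** * Polar coordinates *)
Lemma eq_measure_integral_support d (T : measurableType d) (R : realType)
    (m1 m2 : {measure set T -> \bar R}) (D : set T) (h : T -> \bar R) :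
  (forall E, measurable E -> E `<=` D -> m1 E = m2 E) ->
  (forall z, ~ D z -> h z = 0%E) ->
  (\int[m1]_z h z = \int[m2]_z h z)%E.
Proof.
move=> m12 h0; have hD : h \_ D = h.
  by apply/funext => z; rewrite patchE; case: ifPn => // /negP; rewrite inE => /h0.
by rewrite -hD -!integral_mkcond; exact: eq_measure_integral.
Qed.

Section polar_coordinates.
Context {R : realType} (n : nat).
Local Notation lambda := (@lebesgue_tuple R n.+1).
Local Notation sigma := (@sphere_measure R n.+1).
Implicit Type A : set (n.+1.-tuple R).

Let V : R := fine (lambda (cone (@sphere R n.+1))).

Let VE : V%:E = lambda (cone (@sphere R n.+1)).
Proof.
rewrite fineK// ge0_fin_numE// lebesgue_cone_lty//; exact: measurable_sphere.
Qed.

Let V_gt0 : 0 < V.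
Proof. by rewrite -lte_fin VE lebesgue_cone_sphere_gt0. Qed.

Lemma sphere_measureE A : (V%:E * sigma A = lambda (cone A))%E.
Proof. by rewrite /sphere_measure muleA -EFinM divff ?gt_eqF// mul1e. Qed.

Let sphere_measure_setT : sigma setT = 1%E.
Proof. by rewrite /sphere_measure cone_setT -VE -EFinM mulVf// gt_eqF. Qed.

HB.instance Definition _ := Measure_isProbability.Build _ _ _
  (@sphere_measure R n.+1) sphere_measure_setT.

(** The volume of the ball of radius [s], so that [radial_measure] is the
    radial factor [d V s ^ (d - 1) ds] of Lebesgue measure. *)
Definition radial_cdf (s : R) : R := V * Num.max s 0 ^+ n.+1.

Let radial_cdf_nd : nondecreasing radial_cdf.
Proof.
move=> s t st; rewrite ler_pM2l//; apply: lerXn2r; rewrite ?nnegrE.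
- by rewrite le_max lexx orbT.
- by rewrite le_max lexx orbT.
- by rewrite ge_max !le_max st lexx !orbT.
Qed.

Let radial_cdf_rc : right_continuous radial_cdf.
Proof.
move=> s; apply: cvg_at_right_filter; apply: cvgM; first exact: cvg_cst.
apply: (@continuous_comp _ _ _ (fun s : R => Num.max s 0) (fun y => y ^+ n.+1)).
  apply: continuous_max; [exact: cvg_id|exact: cvg_cst].
exact: exprn_continuous.
Qed.

HB.instance Definition _ := isCumulative.Build R _ R radial_cdf
  radial_cdf_nd radial_cdf_rc.

Definition radial_measure := lebesgue_stieltjes_measure radial_cdf.

HB.instance Definition _ := SigmaFiniteMeasure.on radial_measure.

Lemma radial_measure_itv (a b : R) : a <= b ->
  radial_measure `]a, b] = (radial_cdf b - radial_cdf a)%:E.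
Proof.
move=> ab; rewrite /radial_measure /lebesgue_stieltjes_measure.
rewrite /measure_extension measurable_mu_extE/=; last exact: is_ocitv.
by rewrite wlength_itv_bnd.
Qed.

Lemma lebesgue_shell_itv A (a b : R) : measurable A -> a <= b ->
  lambda (shell `]a, b] A) = ((radial_cdf b - radial_cdf a)%:E * sigma A)%E.
Proof.
move=> mA ab.
have -> : shell `]a, b] A = shell `]-oo, b] A `\` shell `]-oo, a] A.
  apply/seteqP; split=> x; rewrite /shell /= !in_itv /=.
    move=> [x0 /andP[ax xb] Ax]; split=> // -[_ + _].
    by rewrite leNgt ax.
  move=> [[x0 xb Ax] H]; split=> //; rewrite xb andbT ltNge; apply/negP => xa.
  exact: H.
have mb : measurable (shell `]-oo, b] A) by exact: measurable_shell.
have ma : measurable (shell `]-oo, a] A) by exact: measurable_shell.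
have fin s : lambda (shell `]-oo, s] A) = ((radial_cdf s)%:E * sigma A)%E.
  rewrite lebesgue_shell// /radial_cdf mulrC EFinM -muleA sphere_measureE//.
have sfin : sigma A \is a fin_num by exact: fin_num_measure.
have lty : (lambda (shell `]-oo, b] A) < +oo)%E.
  by rewrite fin ltey_eq fin_numM.
have := measureD mb ma lty; rewrite setIidr => [->|].
  transitivity ((radial_cdf b)%:E * sigma A - (radial_cdf a)%:E * sigma A)%E.
    by congr (_ - _)%E; exact: fin.
  by rewrite EFinB muleBl.
by move=> x; rewrite /shell /= !in_itv /= => -[? xa ?]; split=> //; exact: le_trans ab.
Qed.

Lemma measurable_polar : measurable_fun setT
  (fun x : n.+1.-tuple R => (enorm x : measurableTypeR R, direction x)).
Proof.
apply/measurable_fun_pairP; split; first exact: measurable_enorm.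
exact: measurable_direction.
Qed.

Lemma measurable_punctured : measurable (shell setT setT : set (n.+1.-tuple R)).
Proof. exact: measurable_shell. Qed.

(** For fixed [A] both sides are measures of [B]; on the half-open intervals
    they agree by scaling. *)
Lemma lebesgue_shellE (B : set (measurableTypeR R)) A :
  measurable B -> measurable A ->
  lambda (shell B A) = (radial_measure B * sigma A)%E.
Proof.
move=> mB mA.
have mS : measurable (shell setT A) by exact: measurable_shell.
pose m1 := measure_function_pushforward__canonical__measure_function_Measure
  (mrestr lambda mS)
  (@measurable_enorm R n.+1 : measurable_fun setT (@enorm R n.+1 : _ -> measurableTypeR R)).
have sA : sigma A \is a fin_num by exact: fin_num_measure.
pose m2 : {measure set (measurableTypeR R) -> \bar R} :=
  mscale (NngNum (fine_ge0 (measure_ge0 sigma A))) radial_measure.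
have E1 (B' : set (measurableTypeR R)) : m1 B' = lambda (shell B' A).
  rewrite /m1 /pushforward /= /mrestr; congr (lambda _).
  apply/seteqP; split=> x; rewrite /shell /=.
    by move=> [? []].
  by move=> [].
have E2 (B' : set (measurableTypeR R)) : m2 B' = (radial_measure B' * sigma A)%E.
  rewrite muleC -[in RHS](fineK sA).
  by [].
rewrite -E1 -E2.
apply: (@measure_unique _ _ (measurableTypeR R) (@ocitv R)
   (fun k => `]- k%:R, k%:R]%classic)) => //.
- exact: ocitvI.
- by move=> k; exact: is_ocitv.
- apply/seteqP; split=> // x _; exists (Num.truncn `|x|).+1 => //=.
  have := truncnS_gt `|x|; rewrite ltr_norml in_itv/= => /andP[-> /ltW].
  by [].
- move=> _ [[a b]] _ <- /=; rewrite E1 E2; have [ab|ba] := leP a b.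
    by rewrite lebesgue_shell_itv// radial_measure_itv.
  have -> : `]a, b]%classic = set0 :> set R.
    by apply/seteqP; split=> x //=; rewrite in_itv/= => /andP[ax xb];
      move: (lt_le_trans (lt_trans ba ax) xb); rewrite ltxx.
  rewrite measure0 mul0e (_ : shell _ _ = set0) ?measure0//.
  by apply/seteqP; split=> x // -[].
- move=> k; rewrite E1 lebesgue_shell_itv//.
    by rewrite ltey_eq fin_numM.
  by rewrite (@le_trans _ _ 0)// oppr_le0.
Qed.

(** Polar coordinates map the punctured space to the product of the radial
    measure and the normalized surface measure, because they do so on rectangles.
    The last hypothesis on [h] stands for the absence of the origin. *)
Lemma ge0_integral_polar (h : measurableTypeR R * n.+1.-tuple R -> \bar R) :
  measurable_fun setT h ->
  (forall z, 0 <= h z)%E -> (forall s x, s <= 0 -> h (s, x) = 0%E) ->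
  (\int[lambda]_x h (enorm x, direction x) =
  \int[radial_measure]_s \int[sigma]_x h (s, x))%E.
Proof.
move=> mh h0 hneg.
pose D : set (measurableTypeR R * n.+1.-tuple R) := `]0, +oo[%classic `*` setT.
have mD : measurable D by apply: measurableX => //; exact: measurable_itv.
pose m1 := measure_function_pushforward__canonical__measure_function_Measure
  lambda measurable_polar.
pose m2 := measure_function_pushforward__canonical__measure_function_Measure
  (mrestr lambda measurable_punctured) measurable_polar.
have hD z : ~ D z -> h z = 0%E.
  case: z => s x zD; rewrite hneg// leNgt; apply/negP => s0; apply: zD.
  by split => //=; rewrite in_itv/= s0.
have E1 : (\int[lambda]_x h (enorm x, direction x) = \int[m1]_z h z)%E.
  have := @ge0_integral_pushforward _ _ _ _ R _ measurable_polar lambda setT h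
    measurableT mh (fun z _ => h0 z).
  by rewrite preimage_setT => <-.
have := @fubini_tonelli1 _ _ (measurableTypeR R) _ R radial_measure sigma h mh h0.
rewrite E1 => <-.
apply: (@eq_measure_integral_support _ _ _ _ _ D) hD => E mE ED.
transitivity (m2 E); last apply/esym/product_measure_unique => // B A mB mA.
  rewrite /m1 /m2 /pushforward /mrestr /=; congr (lambda _).
  apply/seteqP; split=> x /= => [xE|[]//]; split => //.
  by have [/=] := ED _ xE; rewrite in_itv/= andbT.
rewrite /m2 -lebesgue_shellE// /pushforward /mrestr; congr (lambda _).
by apply/seteqP; split=> x /=; rewrite /shell /=; [case=> -[? ?] []|case].
Qed.

End polar_coordinates.

(** * Means over the sphere *)
Section sphere_mean.
Context {R : realType} (n : nat).
Local Notation lambda := (@lebesgue_tuple R n.+1).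
Local Notation sigma := (@sphere_measure R n.+1).
Implicit Type f : n.+1.-tuple R -> R.

Definition sphere_mean f : R := \int[sigma]_(x in @sphere R n.+1) f x.

Definition gauss_mean f : R := \int[lambda]_x (f x * gweight x).

Definition homogeneous p f := forall c x, 0 < c -> f (tscale c x) = c ^+ p * f x.

Lemma sphere_measure_setC : sigma (~` @sphere R n.+1) = 0%E.
Proof.
rewrite /sphere_measure (_ : cone (~` _) = set0) ?measure0 ?mule0//.
apply/seteqP; split=> x // -[/andP[x0 _] /=]; apply.
exact: enorm_direction.
Qed.

Lemma homogeneous_direction p f x : homogeneous p f -> 0 < enorm x ->
  f x = enorm x ^+ p * f (direction x).
Proof. by move=> fp x0; rewrite -fp// tscale_direction. Qed.

Lemma enorm0_tscale c (x : n.+1.-tuple R) : enorm x = 0 -> tscale c x = x.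
Proof.
move=> x0; have : sqnorm x = 0 by rewrite -sqr_enorm x0 expr0n.
move=> /eqP; rewrite psumr_eq0 => [/allP xi|i _]; last exact: sqr_ge0.
apply: eq_from_tnth => i; rewrite tnth_mktuple.
have := xi i; rewrite mem_index_enum sqrf_eq0 => /(_ isT)/eqP ->.
by rewrite mulr0.
Qed.

Lemma homogeneous0 p f x : homogeneous p.+1 f -> enorm x = 0 -> f x = 0.
Proof.
move=> fp x0; have := fp 2 x (ltr0n _ _).
rewrite enorm0_tscale// => /eqP; rewrite -subr_eq0 -{1}[f x]mul1r -mulrBl mulf_eq0.
case/orP=> [|/eqP//]; rewrite subr_eq0 => /eqP h.
have : 1 < (2 : R) ^+ p.+1 by rewrite exprn_egt1// ltr1n.
by rewrite -h ltxx.
Qed.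

Definition radial_moment p : \bar R :=
  (\int[@radial_measure R n]_s (Num.max s 0 ^+ p * expR (- s ^+ 2))%:E)%E.

(** The radial factor of the integral depends on the degree of [f] only. *)
Lemma ge0_integral_homogeneous p f : measurable_fun setT f ->
  (forall x, 0 <= f x) -> homogeneous p.+1 f ->
  (\int[lambda]_x (f x * gweight x)%:E =
   radial_moment p.+1 * \int[sigma]_x (f x)%:E)%E.
Proof.
move=> mf f0 fp.
pose a (s : R) : R := Num.max s 0 ^+ p.+1 * expR (- s ^+ 2).
have a0 s : 0 <= a s by rewrite mulr_ge0 ?expR_ge0// exprn_ge0// le_max lexx orbT.
have ma : measurable_fun setT a.
  apply: measurable_funM.
    apply: measurable_funX; exact: measurable_maxr.
  by apply: measurableT_comp => //; apply: measurableT_comp.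
pose h (z : measurableTypeR R * n.+1.-tuple R) : \bar R := (a z.1 * f z.2)%:E.
transitivity (\int[lambda]_x h (enorm x, direction x))%E.
  apply: eq_integral => x _; congr (_%:E); rewrite /a /=.
  rewrite max_l ?enorm_ge0//; have [x0|x0] := eqVneq (enorm x) 0.
    by rewrite (homogeneous0 fp x0) x0 expr0n !mul0r.
  rewrite (homogeneous_direction fp) ?lt0r ?x0 ?enorm_ge0//.
  by rewrite sqr_enorm /gweight mulrAC.
rewrite ge0_integral_polar.
- transitivity (\int[@radial_measure R n]_s ((a s)%:E * \int[sigma]_x (f x)%:E))%E.
    apply: eq_integral => s _; rewrite /h /=.
    under eq_integral do rewrite EFinM.
    rewrite ge0_integralZl//; first exact/measurable_EFinP.
    by move=> x _; rewrite lee_fin.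
    by rewrite lee_fin.
  rewrite ge0_integralZr//.
  - exact/measurable_EFinP.
  - by move=> s _; rewrite lee_fin.
  - by apply: integral_ge0 => x _; rewrite lee_fin.
- apply/measurable_EFinP/measurable_funM; first exact: measurableT_comp ma _.
  exact: measurableT_comp mf _.
- by move=> z; rewrite lee_fin mulr_ge0.
- by move=> s x s0; rewrite /h /a /= max_r// expr0n !mul0r.
Qed.


(** Functions that are Borel and bounded on the sphere: the class on which
    [sphere_mean] is linear and monotone. *)
Definition sphere_bounded f :=
  measurable_fun setT f /\ exists M, forall x, sphere x -> `|f x| <= M.

Lemma sphere_bounded_integrable f : sphere_bounded f ->
  sigma.-integrable (@sphere R n.+1) (EFin \o f).
Proof.
move=> [mf [M fM]]; apply: measurable_bounded_integrable => //.
- exact: measurable_sphere.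
- by rewrite ltey_eq fin_num_measure//; exact: measurable_sphere.
- exact: measurable_funTS.
- exists `|M|; split; first exact: num_real.
  by move=> N MN x /fM h; exact: le_trans h (le_trans (ler_norm M) (ltW MN)).
Qed.

Lemma sphere_bounded_cst c : sphere_bounded (fun=> c).
Proof. by split=> //; exists `|c|. Qed.

Lemma sphere_boundedD f g :
  sphere_bounded f -> sphere_bounded g -> sphere_bounded (fun x => f x + g x).
Proof.
move=> [mf [M fM]] [mg [N gN]]; split; first exact: measurable_funD.
exists (M + N) => x Sx; rewrite (le_trans (ler_normD _ _))// lerD//; [exact: fM|exact: gN].
Qed.

Lemma sphere_boundedM f g :
  sphere_bounded f -> sphere_bounded g -> sphere_bounded (fun x => f x * g x).
Proof.
move=> [mf [M fM]] [mg [N gN]]; split; first exact: measurable_funM.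
exists (M * N) => x Sx; rewrite normrM ler_pM//; [exact: fM|exact: gN].
Qed.

Lemma sphere_boundedZ c f : sphere_bounded f -> sphere_bounded (fun x => c * f x).
Proof. exact: sphere_boundedM (sphere_bounded_cst c). Qed.

Lemma sphere_boundedB f g :
  sphere_bounded f -> sphere_bounded g -> sphere_bounded (fun x => f x - g x).
Proof.
move=> [mf [M fM]] [mg [N gN]]; split; first exact: measurable_funB.
exists (M + N) => x Sx; rewrite (le_trans (ler_normB _ _))// lerD//; [exact: fM|exact: gN].
Qed.

Lemma sphere_boundedX f k : sphere_bounded f -> sphere_bounded (fun x => f x ^+ k).
Proof.
move=> bf; elim: k => [|k IH].
  under eq_fun do rewrite expr0; exact: sphere_bounded_cst.
under eq_fun do rewrite exprS; exact: sphere_boundedM.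
Qed.

Lemma sphere_bounded_sum I (r : seq I) (F : I -> n.+1.-tuple R -> R) :
  (forall i, sphere_bounded (F i)) -> sphere_bounded (fun x => \sum_(i <- r) F i x).
Proof.
move=> bF; elim: r => [|i r IH].
  under eq_fun do rewrite big_nil; exact: sphere_bounded_cst.
under eq_fun do rewrite big_cons; exact: sphere_boundedD.
Qed.

Lemma sphere_bounded_expR f : sphere_bounded f -> sphere_bounded (fun x => expR (f x)).
Proof.
move=> [mf [M fM]]; split; first exact: measurableT_comp.
exists (expR M) => x Sx; rewrite ger0_norm ?expR_ge0// ler_expR.
exact: le_trans (ler_norm _) (fM _ Sx).
Qed.

Lemma sphere_bounded_tnth i : sphere_bounded (fun x => tnth x i).
Proof.
split; first exact: measurable_tnth.
exists 1 => x; rewrite /sphere /= => x1.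
rewrite -(@expr_le1 _ 2)// real_normK ?num_real//.
have -> : 1 = sqnorm x by rewrite -sqr_enorm x1 expr1n.
by rewrite /sqnorm (bigD1 i)//= lerDl sumr_ge0// => j _; exact: sqr_ge0.
Qed.

Lemma eq_sphere_mean f g : (forall x, sphere x -> f x = g x) ->
  sphere_mean f = sphere_mean g.
Proof. by move=> fg; apply: eq_Rintegral => x /set_mem; exact: fg. Qed.

Lemma sphere_meanD f g : sphere_bounded f -> sphere_bounded g ->
  sphere_mean (fun x => f x + g x) = sphere_mean f + sphere_mean g.
Proof.
move=> bf bg; apply: RintegralD; first exact: measurable_sphere.
- exact: sphere_bounded_integrable.
- exact: sphere_bounded_integrable.
Qed.

Lemma sphere_meanB f g : sphere_bounded f -> sphere_bounded g ->
  sphere_mean (fun x => f x - g x) = sphere_mean f - sphere_mean g.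
Proof.
move=> bf bg; apply: RintegralB; first exact: measurable_sphere.
- exact: sphere_bounded_integrable.
- exact: sphere_bounded_integrable.
Qed.

Lemma sphere_meanZ c f : sphere_bounded f ->
  sphere_mean (fun x => c * f x) = c * sphere_mean f.
Proof.
move=> bf; apply: RintegralZl; first exact: measurable_sphere.
exact: sphere_bounded_integrable.
Qed.

Lemma sphere_mean_cst c : sphere_mean (fun=> c) = c.
Proof.
rewrite /sphere_mean Rintegral_cst; last exact: measurable_sphere.
have S1 : sigma (@sphere R n.+1) = 1%E.
  have E : (0 = 1 - sigma (@sphere R n.+1))%E :=
    etrans (esym sphere_measure_setC) (probability_setC sigma (@measurable_sphere R n.+1)).
  have sf := fin_num_measure sigma _ (@measurable_sphere R n.+1).
  have := subeK 1%E sf; rewrite -[X in (X + _)%E]E add0e; exact.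
transitivity (c * fine 1%E); [congr (_ * fine _); exact: S1|by rewrite mulr1].
Qed.

Lemma sphere_mean_sum I (r : seq I) (F : I -> n.+1.-tuple R -> R) :
  (forall i, sphere_bounded (F i)) ->
  sphere_mean (fun x => \sum_(i <- r) F i x) = \sum_(i <- r) sphere_mean (F i).
Proof.
move=> bF; elim: r => [|i r IH].
  by rewrite big_nil -[RHS](sphere_mean_cst 0); apply: eq_sphere_mean => x _; rewrite big_nil.
rewrite big_cons -IH -sphere_meanD//; last exact: sphere_bounded_sum.
by apply: eq_sphere_mean => x _; rewrite big_cons.
Qed.

Lemma le_sphere_mean f g : sphere_bounded f -> sphere_bounded g ->
  (forall x, sphere x -> f x <= g x) -> sphere_mean f <= sphere_mean g.
Proof.
move=> bf bg fg; apply: le_Rintegral; first exact: measurable_sphere.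
- exact: sphere_bounded_integrable.
- exact: sphere_bounded_integrable.
- by move=> x; exact: fg.
Qed.

Lemma sphere_mean_ge0 f : (forall x, sphere x -> 0 <= f x) -> 0 <= sphere_mean f.
Proof. exact: Rintegral_ge0. Qed.

Lemma ge0_integral_sphere f : measurable_fun setT f -> (forall x, 0 <= f x) ->
  (\int[sigma]_x (f x)%:E = \int[sigma]_(x in @sphere R n.+1) (f x)%:E)%E.
Proof.
move=> mf f0; rewrite (@ge0_negligible_integral _ _ _ sigma setT (~` @sphere R n.+1)).
- by rewrite setTD setCK.
- exact: measurableC (@measurable_sphere R n.+1).
- exact: measurableT.
- exact/measurable_EFinP.
- by move=> x _; rewrite lee_fin.
- exact: sphere_measure_setC.
Qed.

Lemma homogeneous_bound k f M : homogeneous (2 * k.+1) f ->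
  (forall x, sphere x -> `|f x| <= M) -> forall x, `|f x| <= M * sqnorm x ^+ k.+1.
Proof.
move=> fp fM x; have [x0|x0] := eqVneq (enorm x) 0.
  rewrite (homogeneous0 fp x0) normr0 -sqr_enorm x0 expr0n expr0n.
  by rewrite mulr0.
have x_gt0 : 0 < enorm x by rewrite lt0r x0 enorm_ge0.
rewrite (homogeneous_direction fp x_gt0) normrM mulrC exprM sqr_enorm.
rewrite [X in _ * X]ger0_norm ?exprn_ge0 ?sqnorm_ge0// ler_wpM2r ?exprn_ge0 ?sqnorm_ge0//.
by apply: fM; exact: enorm_direction.
Qed.

(** The radial factor is found by taking for [f] the power of [sqnorm] of the
    same degree, which is [1] on the sphere. A multiple of this power is added
    to [f] to make it nonnegative. *)
Lemma gauss_mean_homogeneous k f : sphere_bounded f -> homogeneous (2 * k.+1) f ->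
  lambda.-integrable setT (fun x => (f x * gweight x)%:E) ->
  lambda.-integrable setT (fun x => (sqnorm x ^+ k.+1 * gweight x)%:E) ->
  gauss_mean f = gauss_mean (fun x => sqnorm x ^+ k.+1) * sphere_mean f.
Proof.
move=> bf fp intf intN; have [mf [M fM]] := bf.
pose N (x : n.+1.-tuple R) := sqnorm x ^+ k.+1.
have N0 x : 0 <= N x by rewrite exprn_ge0// sqnorm_ge0.
have Np : homogeneous (2 * k.+1) N.
  by move=> c x c0; rewrite /N sqnorm_tscale exprMn exprM.
have N1 x : sphere x -> N x = 1.
  by rewrite /sphere /N -sqr_enorm => ->; rewrite !expr1n.
have bN : sphere_bounded N.
  split; first by apply: measurable_funX; exact: measurable_sqnorm.
  by exists 1 => x Sx; rewrite N1// normr1.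
pose g x := f x + M * N x.
have g0 x : 0 <= g x.
  have := homogeneous_bound fp fM x; rewrite -/(N x) ler_norml => /andP[h _].
  by rewrite /g -lerBlDr sub0r.
have gp : homogeneous (2 * k.+1) g.
  by move=> c x c0; rewrite /g fp// Np// mulrDr mulrCA.
have bg : sphere_bounded g by apply: sphere_boundedD => //; exact: sphere_boundedZ.
pose K := radial_moment (2 * k.+1).
have KE h : sphere_bounded h -> (forall x, 0 <= h x) -> homogeneous (2 * k.+1) h ->
    (\int[lambda]_x (h x * gweight x)%:E = K * (sphere_mean h)%:E)%E.
  move=> bh h0 hp; have [mh _] := bh.
  (* [2 * k.+1] is the successor of [k + (k.+1 + 0)] by definition of the product. *)
  have -> := @ge0_integral_homogeneous (k + (k.+1 + 0))%N h mh h0 hp.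
  rewrite ge0_integral_sphere//; congr (_ * _)%E.
  rewrite /sphere_mean /Rintegral fineK//.
  apply: integrable_fin_num; first exact: measurable_sphere.
  exact: sphere_bounded_integrable.
have KN : K = (gauss_mean N)%:E.
  rewrite /gauss_mean /Rintegral fineK; last exact: integrable_fin_num.
  rewrite KE// (_ : sphere_mean N = 1) ?mule1//.
  by rewrite -[RHS](sphere_mean_cst 1); apply: eq_sphere_mean.
have : gauss_mean g = gauss_mean N * sphere_mean g.
  by rewrite {1}/gauss_mean /Rintegral KE// KN.
rewrite [sphere_mean g]sphere_meanD//; last exact: sphere_boundedZ.
rewrite sphere_meanZ// (_ : sphere_mean N = 1); last first.
  by rewrite -[RHS](sphere_mean_cst 1); apply: eq_sphere_mean.
have -> : gauss_mean g = gauss_mean f + M * gauss_mean N.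
  rewrite /gauss_mean -RintegralZl// -RintegralD//.
    by apply: eq_Rintegral => x _; rewrite /g mulrDl mulrA.
  exact: (integrableZl measurableT M intN).
by rewrite mulrDr mulr1 [M * _]mulrC => /addIr.
Qed.

End sphere_mean.

(** * Gaussian integration by parts *)
Section gaussian_stein.
Context {R : realType} (n : nat).
Local Notation lambda := (@lebesgue_tuple R n.+1).
Local Notation pt := (n.+1.-tuple R).
Implicit Types (f g : pt -> R) (a : 'I_n.+1 -> nat).

Definition gauss_integrable f :=
  lambda.-integrable setT (fun x => (f x * gweight x)%:E).

Lemma gauss_integrableD f g : gauss_integrable f -> gauss_integrable g ->
  gauss_integrable (fun x => f x + g x).
Proof.
move=> intf intg; apply: eq_integrable (integrableD measurableT intf intg) => // x _.
by rewrite /= -EFinD mulrDl.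
Qed.

Lemma gauss_integrableZ c f : gauss_integrable f ->
  gauss_integrable (fun x => c * f x).
Proof.
move=> intf; apply: eq_integrable (integrableZl measurableT c intf) => // x _.
by rewrite /= -EFinM mulrA.
Qed.

Lemma gauss_meanD f g : gauss_integrable f -> gauss_integrable g ->
  gauss_mean (fun x => f x + g x) = gauss_mean f + gauss_mean g.
Proof.
move=> intf intg; rewrite /gauss_mean -RintegralD//.
by apply: eq_Rintegral => x _; rewrite mulrDl.
Qed.

Lemma gauss_meanZ c f : gauss_integrable f ->
  gauss_mean (fun x => c * f x) = c * gauss_mean f.
Proof.
move=> intf; rewrite /gauss_mean -RintegralZl//.
by apply: eq_Rintegral => x _; rewrite mulrA.
Qed.

Definition incr_at a j : 'I_n.+1 -> nat := fun i => (a i + (i == j))%N.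
Definition decr_at a j : 'I_n.+1 -> nat := fun i => (a i - (i == j))%N.

Lemma monomial_incr a j (x : pt) :
  monomial (incr_at a j) x = tnth x j * monomial a x.
Proof.
rewrite /monomial (bigD1 j)//= [in RHS](bigD1 j)//= /incr_at eqxx addn1 exprS mulrA.
congr (_ * _); apply: eq_bigr => i /negbTE ij; by rewrite ij addn0.
Qed.

(** The partial derivative of a monomial; the truncated subtraction in
    [decr_at] is harmless since the coefficient is then zero. *)
Definition dmonomial a i (x : pt) : R := (a i)%:R * monomial (decr_at a i) x.

Lemma dmonomial_incr a i j (x : pt) :
  dmonomial (incr_at a j) i x = (i == j)%:R * monomial a x + tnth x j * dmonomial a i x.
Proof.
rewrite /dmonomial; have [<-|ij] := eqVneq i j.
  have -> : decr_at (incr_at a i) i = a.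
    by apply/funext => k; rewrite /decr_at /incr_at addnK.
  rewrite /incr_at eqxx addn1 mul1r; case ai : (a i) => [|m].
    by rewrite !mul0r mulr0 addr0 mul1r.
  have -> : monomial a x = tnth x i * monomial (decr_at a i) x.
    rewrite -monomial_incr; congr (monomial _ x); apply/funext => k.
    rewrite /incr_at /decr_at; have [->|ki] := eqVneq k i; last by rewrite subn0 addn0.
    by rewrite ai subn1 addn1.
  by rewrite -[m.+2%:R]natr1; ring.
have -> : decr_at (incr_at a j) i = incr_at (decr_at a i) j.
  apply/funext => k; rewrite /incr_at /decr_at.
  have [->|] := eqVneq k i; last by rewrite !subn0.
  by rewrite (negbTE ij) !addn0.
by rewrite monomial_incr /incr_at (negbTE ij) /= addn0 mul0r add0r; ring.
Qed.

Lemma gauss_mean_monomial_stein a i :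
  2 * gauss_mean (fun x => tnth x i * monomial a x) = gauss_mean (dmonomial a i).
Proof.
rewrite gauss_meanZ; last exact: integrable_monomial.
have -> : (fun x : pt => tnth x i * monomial a x) = monomial (incr_at a i).
  by apply/funext => x; rewrite monomial_incr.
rewrite /gauss_mean !integral_monomial (bigD1 i)//= [in RHS](bigD1 i)//= !mulrA.
rewrite /incr_at /decr_at eqxx addn1 subn1 gauss_moment_rec; congr (_ * _).
by apply: eq_bigr => k /negbTE ki; rewrite ki addn0 subn0.
Qed.

(** [stein f df]: the Gaussian integration by parts identity holds for the
    products of [f] with all monomials, [df i] being the partial derivative of
    [f] in the direction [i]. The monomial factor is what makes the identity
    stable under multiplication of [f] by a coordinate. *)
Definition stein f (df : 'I_n.+1 -> pt -> R) := forall a,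
  gauss_integrable (fun x => monomial a x * f x) /\
  forall i, gauss_integrable (fun x => monomial a x * df i x) /\
    2 * gauss_mean (fun x => tnth x i * (monomial a x * f x)) =
    gauss_mean (fun x => dmonomial a i x * f x + monomial a x * df i x).

Lemma eq_stein f df g dg : f =1 g -> (forall i, df i =1 dg i) ->
  stein f df -> stein g dg.
Proof.
move=> /funext <- dfg; rewrite (_ : dg = df)//.
by apply/funext => i; apply/funext => x; rewrite dfg.
Qed.

Lemma stein_dmonomial f df a i : stein f df ->
  gauss_integrable (fun x => dmonomial a i x * f x).
Proof.
move=> sf; have [int_f _] := sf (decr_at a i).
have := gauss_integrableZ (a i)%:R int_f.
by under eq_fun do rewrite mulrA.
Qed.

Lemma stein_tnth f df a i : stein f df ->
  gauss_integrable (fun x => tnth x i * (monomial a x * f x)).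
Proof.
move=> sf; have [int_f _] := sf (incr_at a i).
by under eq_fun do rewrite mulrA -monomial_incr.
Qed.

Lemma stein_cst c : stein (fun=> c) (fun _ _ => 0).
Proof.
have intm a : gauss_integrable (fun x => monomial a x * c).
  under eq_fun do rewrite mulrC; apply: gauss_integrableZ; exact: integrable_monomial.
move=> a; split => // i; split.
  have -> : (fun x : pt => monomial a x * 0) = (fun x => 0 * monomial a x).
    by apply/funext => x; rewrite mulr0 mul0r.
  by apply: gauss_integrableZ; exact: integrable_monomial.
have -> : (fun x : pt => tnth x i * (monomial a x * c)) =
    (fun x => c * (tnth x i * monomial a x)) by apply/funext => x; ring.
rewrite gauss_meanZ; last first.
  by under eq_fun do rewrite -monomial_incr; exact: integrable_monomial.
rewrite mulrCA gauss_mean_monomial_stein -gauss_meanZ.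
  by congr gauss_mean; apply/funext => x; ring.
by apply: gauss_integrableZ; exact: integrable_monomial.
Qed.

Lemma steinD f df g dg : stein f df -> stein g dg ->
  stein (fun x => f x + g x) (fun i x => df i x + dg i x).
Proof.
move=> sf sg a; have [intf Hf] := sf a; have [intg Hg] := sg a.
split.
  under eq_fun do rewrite mulrDr; exact: gauss_integrableD.
move=> i; have [intdf Ef] := Hf i; have [intdg Eg] := Hg i; split.
  under eq_fun do rewrite mulrDr; exact: gauss_integrableD.
under eq_fun do rewrite !mulrDr.
rewrite gauss_meanD ?mulrDr ?Ef ?Eg; try exact: (stein_tnth _ _ sf); try exact: (stein_tnth _ _ sg).
rewrite -gauss_meanD; try by apply: gauss_integrableD => //;
  [exact: (stein_dmonomial _ _ sf)|exact: (stein_dmonomial _ _ sg)].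
- by congr gauss_mean; apply/funext => x; ring.
- by apply: gauss_integrableD => //; exact: (stein_dmonomial _ _ sf).
- by apply: gauss_integrableD => //; exact: (stein_dmonomial _ _ sg).
Qed.

Lemma steinX f df j : stein f df ->
  stein (fun x => tnth x j * f x) (fun i x => (i == j)%:R * f x + tnth x j * df i x).
Proof.
move=> sf a; have [intf Hf] := sf (incr_at a j); have [intfa _] := sf a.
have mE f' : (fun x => monomial a x * (tnth x j * f' x)) =
    (fun x => monomial (incr_at a j) x * f' x).
  by apply/funext => x; rewrite monomial_incr; ring.
rewrite mE; split => // i; have [intdf Ef] := Hf i; split.
  have -> : (fun x => monomial a x * ((i == j)%:R * f x + tnth x j * df i x)) =
    (fun x => (i == j)%:R * (monomial a x * f x) + monomial (incr_at a j) x * df i x).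
    by apply/funext => x; rewrite monomial_incr; ring.
  by apply: gauss_integrableD => //; exact: gauss_integrableZ.
rewrite (_ : (fun x => tnth x i * (monomial a x * (tnth x j * f x))) =
  (fun x => tnth x i * (monomial (incr_at a j) x * f x))); last first.
  by apply/funext => x; rewrite monomial_incr; ring.
rewrite Ef; congr gauss_mean; apply/funext => x.
by rewrite dmonomial_incr monomial_incr; ring.
Qed.

Lemma steinZ c f df : stein f df -> stein (fun x => c * f x) (fun i x => c * df i x).
Proof.
move=> sf a; have [intf Hf] := sf a.
have mE f' b : (fun x => monomial b x * (c * f' x)) = (fun x => c * (monomial b x * f' x)).
  by apply/funext => x; ring.
rewrite mE; split; first exact: gauss_integrableZ.
move=> i; have [intdf Ef] := Hf i; rewrite mE; split; first exact: gauss_integrableZ.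
rewrite (_ : (fun x => tnth x i * (monomial a x * (c * f x))) =
   (fun x => c * (tnth x i * (monomial a x * f x)))); last by apply/funext => x; ring.
rewrite gauss_meanZ; last exact: stein_tnth sf.
rewrite mulrCA Ef -gauss_meanZ; last first.
  by apply: gauss_integrableD => //; exact: stein_dmonomial sf.
by congr gauss_mean; apply/funext => x; ring.
Qed.

Lemma stein_sum I (r : seq I) (F : I -> pt -> R) (dF : I -> 'I_n.+1 -> pt -> R) :
  (forall k, stein (F k) (dF k)) ->
  stein (fun x => \sum_(k <- r) F k x) (fun i x => \sum_(k <- r) dF k i x).
Proof.
move=> sF; elim: r => [|k r IH].
  by apply: eq_stein (stein_cst 0) => [x|i x]; rewrite big_nil.
by apply: eq_stein (steinD (sF k) IH) => [x|i x]; rewrite big_cons.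
Qed.


Lemma quad_formE (A : 'M[R]_n.+1) (x : pt) :
  quad_form A x = \sum_i \sum_j tnth x i * (A i j * tnth x j).
Proof.
rewrite /quad_form mxE exchange_big /=; apply: eq_bigr => i _.
rewrite mxE big_distrl /=; apply: eq_bigr => j _.
by rewrite !mxE mulrA.
Qed.

Definition mxapp (A : 'M[R]_n.+1) i (x : pt) : R := \sum_j A i j * tnth x j.

Lemma quad_form_mxapp (A : 'M[R]_n.+1) (x : pt) :
  quad_form A x = \sum_i tnth x i * mxapp A i x.
Proof. by rewrite quad_formE; apply: eq_bigr => i _; rewrite mulr_sumr. Qed.

Lemma sum_mxapp2 (A B : 'M[R]_n.+1) (x : pt) :
  \sum_i mxapp A i x * mxapp B i x = quad_form (A^T *m B) x.
Proof.
rewrite quad_formE /mxapp; under eq_bigr do rewrite big_distrlr /=.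
rewrite exchange_big /=; apply: eq_bigr => j _.
rewrite exchange_big /=; apply: eq_bigr => k _.
by rewrite mxE big_distrl mulr_sumr; apply: eq_bigr => i _; rewrite mxE /=; ring.
Qed.

Lemma stein_mxapp (A : 'M[R]_n.+1) i f df : stein f df ->
  stein (fun x => mxapp A i x * f x) (fun k x => A i k * f x + mxapp A i x * df k x).
Proof.
move=> sf; have := stein_sum (index_enum 'I_n.+1) (fun j => steinZ (A i j) (steinX j sf)).
apply: eq_stein => [x|k x]; rewrite /mxapp mulr_suml.
  by apply: eq_bigr => j _; rewrite mulrA.
under eq_bigr do rewrite mulrDr mulrA.
rewrite big_split /=; congr (_ + _).
  rewrite (bigD1 k)//= eqxx mulr1 big1 ?addr0// => j /negbTE jk.
  by rewrite eq_sym jk mulr0 mul0r.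
by apply: eq_bigr => j _; rewrite mulrA.
Qed.

Lemma stein_quad_form (A : 'M[R]_n.+1) f df : A^T = A -> stein f df ->
  stein (fun x => quad_form A x * f x)
    (fun k x => 2 * mxapp A k x * f x + quad_form A x * df k x).
Proof.
move=> symA sf.
have := stein_sum (index_enum 'I_n.+1) (fun i => steinX i (stein_mxapp A i sf)).
apply: eq_stein => [x|k x]; rewrite quad_form_mxapp.
  by rewrite mulr_suml; apply: eq_bigr => i _; rewrite mulrA.
rewrite mulr_suml big_split /=.
rewrite (bigD1 k)//= eqxx mul1r big1 ?addr0 => [|i /negbTE ik]; last first.
  by rewrite eq_sym ik mul0r.
rewrite mulrDl !mul1r mulrDl -addrA; congr (_ + _).
under eq_bigr do rewrite mulrDr.
rewrite big_split /=; congr (_ + _).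
  rewrite /mxapp mulr_suml; apply: eq_bigr => i _.
  by rewrite -[in RHS]symA mxE; ring.
by apply: eq_bigr => i _; rewrite mulrA.
Qed.

Lemma stein_quad_formX (A : 'M[R]_n.+1) k : A^T = A ->
  stein (fun x => quad_form A x ^+ k)
    (fun i x => k%:R * (2 * mxapp A i x * quad_form A x ^+ k.-1)).
Proof.
move=> symA; elim: k => [|k IH].
  by apply: eq_stein (stein_cst 1) => [x|i x]; rewrite ?expr0// mul0r.
apply: eq_stein (stein_quad_form symA IH) => [x|i x]; first by rewrite exprS.
case: k {IH} => [|k] /=; first by rewrite expr0; ring.
by rewrite -[k.+2%:R]natr1 exprS; ring.
Qed.

Lemma stein0 f df : stein f df ->
  gauss_integrable f /\ forall i, gauss_integrable (df i) /\
    gauss_integrable (fun x => tnth x i * f x) /\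
    2 * gauss_mean (fun x => tnth x i * f x) = gauss_mean (df i).
Proof.
move=> sf; have [intf H] := sf (fun=> 0%N).
have m1 h : (fun x : pt => monomial (fun=> 0%N) x * h x) = h.
  by apply/funext => x; rewrite monomial0 mul1r.
rewrite m1 in intf; split => // i; have [intdf E] := H i; rewrite m1 in intdf.
split => //; split.
  have := stein_tnth (fun=> 0%N) i sf.
  by under eq_fun do rewrite monomial0 mul1r.
move: E; under eq_fun do rewrite monomial0 mul1r.
move=> ->; congr gauss_mean; apply/funext => x.
by rewrite /dmonomial monomial0 mul0r mul0r add0r mul1r.
Qed.

Lemma gauss_integrable_sum I (r : seq I) (F : I -> pt -> R) :
  (forall i, gauss_integrable (F i)) -> gauss_integrable (fun x => \sum_(i <- r) F i x).
Proof.
move=> intF; elim: r => [|i r IH].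
  rewrite (_ : (fun x => _) = (fun x => 0 * monomial (fun=> 0%N) x)); last first.
    by apply/funext => x; rewrite big_nil mul0r.
  exact: gauss_integrableZ (integrable_monomial _).
under eq_fun do rewrite big_cons; exact: gauss_integrableD.
Qed.

Lemma gauss_mean_sum I (r : seq I) (F : I -> pt -> R) :
  (forall i, gauss_integrable (F i)) ->
  gauss_mean (fun x => \sum_(i <- r) F i x) = \sum_(i <- r) gauss_mean (F i).
Proof.
move=> intF; elim: r => [|i r IH].
  rewrite big_nil /gauss_mean; under eq_Rintegral do rewrite big_nil mul0r.
  by rewrite /Rintegral integral0.
rewrite big_cons -IH -gauss_meanD//; last exact: gauss_integrable_sum.
by congr gauss_mean; apply/funext => x; rewrite big_cons.
Qed.

Lemma gauss_integrable_quad_form (A H : 'M[R]_n.+1) k : H^T = H ->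
  gauss_integrable (fun x => quad_form A x * quad_form H x ^+ k).
Proof.
move=> symH; have sQ := stein_quad_formX k symH.
under eq_fun do rewrite quad_form_mxapp mulr_suml.
apply: gauss_integrable_sum => i; under eq_fun do rewrite -mulrA.
by have [_ /(_ i)[_ []]] := stein0 (stein_mxapp A i sQ).
Qed.

(** Integration by parts applied to the [i]-th coordinate of [A x] times the
    [k]-th power of [x^T H x], summed over [i]: the trace comes from
    differentiating [A x], and the last term from [d (x^T H x) = 2 H x]. *)
Lemma gauss_stein (A H : 'M[R]_n.+1) k : H^T = H ->
  2 * gauss_mean (fun x => quad_form A x * quad_form H x ^+ k) =
  \tr A * gauss_mean (fun x => quad_form H x ^+ k)
  + 2 * k%:R * gauss_mean (fun x => quad_form (A^T *m H) x * quad_form H x ^+ k.-1).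
Proof.
move=> symH; have sQ := stein_quad_formX k symH.
have sQi i := stein0 (stein_mxapp A i sQ).
have [intQ _] := stein0 sQ.
have -> : (fun x => quad_form A x * quad_form H x ^+ k) =
    (fun x => \sum_i tnth x i * (mxapp A i x * quad_form H x ^+ k)).
  apply/funext => x; rewrite quad_form_mxapp mulr_suml.
  by apply: eq_bigr => i _; rewrite mulrA.
rewrite gauss_mean_sum => [|i]; last by have [_ /(_ i)[_ []]] := sQi i.
rewrite mulr_sumr.
under eq_bigr => i _.
  have [_ /(_ i)[_ [_ E]]] := sQi i.
  rewrite E; over.
rewrite -gauss_mean_sum => [|i]; last by have [_ /(_ i)[]] := sQi i.
rewrite -gauss_meanZ// -gauss_meanZ; last exact: gauss_integrable_quad_form.
rewrite -gauss_meanD; last 2 first.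
- exact: gauss_integrableZ.
- apply: gauss_integrableZ; exact: gauss_integrable_quad_form.
congr gauss_mean; apply/funext => x; rewrite big_split /= /mxtrace mulr_suml.
congr (_ + _); rewrite -sum_mxapp2 mulr_suml mulr_sumr.
by apply: eq_bigr => i _; ring.
Qed.

End gaussian_stein.

(** * The Frobenius norm *)
Section frobenius_norm.
Context {R : realType}.

(** Lagrange's identity. *)
Lemma sum_cauchy_schwarz (I : finType) (a b : I -> R) :
  (\sum_i a i * b i) ^+ 2 <= (\sum_i a i ^+ 2) * (\sum_i b i ^+ 2).
Proof.
rewrite -subr_ge0.
have -> : (\sum_i a i ^+ 2) * (\sum_i b i ^+ 2) - (\sum_i a i * b i) ^+ 2 =
    2^-1 * \sum_i \sum_j (a i * b j - a j * b i) ^+ 2.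
  have e1 : \sum_i \sum_j (a i * b j - a j * b i) ^+ 2 =
      \sum_i \sum_j (a i ^+ 2 * b j ^+ 2) + \sum_i \sum_j (b i ^+ 2 * a j ^+ 2)
      - 2 * \sum_i \sum_j ((a i * b i) * (a j * b j)).
    rewrite mulr_sumr -big_split -sumrB; apply: eq_bigr => i _.
    rewrite mulr_sumr -big_split -sumrB; apply: eq_bigr => j _ /=; ring.
  have e2 (c d : I -> R) : \sum_i \sum_j (c i * d j) = (\sum_i c i) * (\sum_i d i).
    by rewrite big_distrlr.
  by rewrite e1 !e2; field.
by rewrite mulr_ge0 ?invr_ge0// sumr_ge0// => i _; rewrite sumr_ge0// => j _; exact: sqr_ge0.
Qed.

Definition fnorm2 m n (A : 'M[R]_(m, n)) : R := \sum_i \sum_j A i j ^+ 2.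
Definition fnorm m n (A : 'M[R]_(m, n)) : R := Num.sqrt (fnorm2 A).

Lemma fnorm2_ge0 m n (A : 'M[R]_(m, n)) : 0 <= fnorm2 A.
Proof. by rewrite sumr_ge0// => i _; rewrite sumr_ge0// => j _; exact: sqr_ge0. Qed.

Lemma fnorm_ge0 m n (A : 'M[R]_(m, n)) : 0 <= fnorm A.
Proof. exact: sqrtr_ge0. Qed.

Lemma sqr_fnorm m n (A : 'M[R]_(m, n)) : fnorm A ^+ 2 = fnorm2 A.
Proof. by rewrite sqr_sqrtr// fnorm2_ge0. Qed.

Lemma frobeniusE n (A : 'M[R]_n) : A^T = A -> frobenius A = fnorm A.
Proof.
move=> symA; rewrite /frobenius /fnorm; congr Num.sqrt.
rewrite /mxtrace /fnorm2; apply: eq_bigr => i _; rewrite expr2 mxE.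
apply: eq_bigr => j _; have -> : A j i = A i j by rewrite -[in LHS]symA mxE.
by rewrite expr2.
Qed.

Lemma fnorm2_pair m n (A : 'M[R]_(m, n)) : fnorm2 A = \sum_p A p.1 p.2 ^+ 2.
Proof. by rewrite /fnorm2 pair_bigA. Qed.

Lemma ler_sqr_abs (x y : R) : 0 <= y -> x ^+ 2 <= y ^+ 2 -> `|x| <= y.
Proof. by move=> y0 h; rewrite -(@ler_pXn2r _ 2)// ?nnegrE// real_normK ?num_real. Qed.

Lemma mxtrace_fnorm m n (A B : 'M[R]_(m, n)) :
  `|\tr (A^T *m B)| <= fnorm A * fnorm B.
Proof.
apply: ler_sqr_abs; first by rewrite mulr_ge0// fnorm_ge0.
rewrite exprMn !sqr_fnorm !fnorm2_pair.
have -> : \tr (A^T *m B) = \sum_p A p.1 p.2 * B p.1 p.2.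
  rewrite -(pair_bigA _ (fun i j => A i j * B i j)) /= exchange_big /=.
  by apply: eq_bigr => i _; rewrite mxE; apply: eq_bigr => j _; rewrite mxE.
exact: sum_cauchy_schwarz.
Qed.

Lemma fnormD m n (A B : 'M[R]_(m, n)) : fnorm (A + B) <= fnorm A + fnorm B.
Proof.
rewrite -(@ler_pXn2r _ 2)// ?nnegrE ?addr_ge0 ?fnorm_ge0//.
have -> : fnorm (A + B) ^+ 2 = fnorm A ^+ 2 + fnorm B ^+ 2 + 2 * \tr (A^T *m B).
  rewrite !sqr_fnorm !fnorm2_pair.
  have -> : \tr (A^T *m B) = \sum_p A p.1 p.2 * B p.1 p.2.
    rewrite -(pair_bigA _ (fun i j => A i j * B i j)) /= exchange_big /=.
    by apply: eq_bigr => i _; rewrite mxE; apply: eq_bigr => j _; rewrite mxE.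
  rewrite mulr_sumr -!big_split /=; apply: eq_bigr => p _; rewrite mxE; ring.
have := le_trans (ler_norm _) (mxtrace_fnorm A B); nra.
Qed.

Lemma fnormZ m n c (A : 'M[R]_(m, n)) : fnorm (c *: A) = `|c| * fnorm A.
Proof.
rewrite /fnorm -sqrtr_sqr -sqrtrM ?sqr_ge0//; congr Num.sqrt.
rewrite /fnorm2 mulr_sumr; apply: eq_bigr => i _; rewrite mulr_sumr.
by apply: eq_bigr => j _; rewrite mxE exprMn.
Qed.

Lemma fnormN m n (A : 'M[R]_(m, n)) : fnorm (- A) = fnorm A.
Proof. by rewrite -scaleN1r fnormZ normrN1 mul1r. Qed.

Lemma fnormB m n (A B : 'M[R]_(m, n)) : fnorm (A - B) <= fnorm A + fnorm B.
Proof. by rewrite -(fnormN B); exact: fnormD. Qed.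

Lemma fnorm0 m n : fnorm (0 : 'M[R]_(m, n)) = 0.
Proof. by rewrite -(scale0r 0) fnormZ normr0 mul0r. Qed.

Lemma fnormM m n p (A : 'M[R]_(m, n)) (B : 'M[R]_(n, p)) :
  fnorm (A *m B) <= fnorm A * fnorm B.
Proof.
rewrite -sqrtrM ?fnorm2_ge0// ler_wsqrtr//.
rewrite /fnorm2 mulr_suml; apply: ler_sum => i _.
rewrite [X in _ * X]exchange_big /= mulr_sumr; apply: ler_sum => j _.
by rewrite mxE; exact: sum_cauchy_schwarz.
Qed.

Lemma fnorm1 n : fnorm (1%:M : 'M[R]_n) = Num.sqrt n%:R.
Proof.
congr Num.sqrt; rewrite /fnorm2.
transitivity (\sum_(i < n) (1 : R)); last by rewrite sumr_const card_ord.
apply: eq_bigr => i _; rewrite (bigD1 i)//= big1 ?addr0 => [|j ji].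
  by rewrite mxE eqxx expr1n.
by rewrite mxE eq_sym (negbTE ji) expr0n.
Qed.

Lemma mxtrace_le n (A : 'M[R]_n) : `|\tr A| <= Num.sqrt n%:R * fnorm A.
Proof. by have := mxtrace_fnorm 1%:M A; rewrite fnorm1 trmx1 mul1mx. Qed.

Lemma fnormX n (A : 'M[R]_n) k : fnorm (A ^+ k) <= Num.sqrt n%:R * fnorm A ^+ k.
Proof.
elim: k => [|k IH]; first by rewrite !expr0 fnorm1 mulr1.
rewrite !exprS; apply: le_trans (fnormM _ _) _.
by rewrite mulrCA ler_wpM2l// fnorm_ge0.
Qed.

Lemma fnormXS n (A : 'M[R]_n) k : fnorm (A ^+ k.+1) <= fnorm A ^+ k.+1.
Proof.
elim: k => [|k IH]; first by rewrite !expr1.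
rewrite exprS [leRHS]exprS; apply: le_trans (fnormM _ _) _.
by rewrite ler_wpM2l// fnorm_ge0.
Qed.

Lemma trmxX n (A : 'M[R]_n) k : A^T = A -> (A ^+ k)^T = A ^+ k.
Proof.
move=> symA; elim: k => [|k IH]; first by rewrite expr0 trmx1.
by rewrite exprS trmx_mul IH symA -[RHS]exprS exprSr.
Qed.

(** For [k = 0] this is Cauchy-Schwarz with the identity matrix, which costs the
    factor [sqrt n]; for higher powers submultiplicativity gives the bound
    without this factor, which is at least [1]. *)
Lemma mxtraceX_le n (A : 'M[R]_n.+1) k : A^T = A ->
  `|\tr (A ^+ k.+1)| <= (Num.sqrt n.+1%:R * fnorm A) ^+ k.+1.
Proof.
move=> symA; case: k => [|k]; first by rewrite !expr1 mxtrace_le.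
have := mxtrace_fnorm A (A ^+ k.+1); rewrite symA -[A *m _]exprS.
move/le_trans; apply; apply: (@le_trans _ _ (fnorm A ^+ k.+2)).
  by rewrite [leRHS]exprS ler_wpM2l ?fnorm_ge0// fnormXS.
apply: lerXn2r; rewrite ?nnegrE ?mulr_ge0 ?fnorm_ge0//.
by rewrite ler_peMl ?fnorm_ge0// -[leLHS]sqrtr1 ler_wsqrtr// ler1n.
Qed.

End frobenius_norm.

(** * Moments of quadratic forms on the sphere *)
Section sphere_moments.
Context {R : realType} (n : nat).
Local Notation pt := (n.+1.-tuple R).
Local Notation E := (@sphere_mean R n).
Local Notation dim := (n.+1%:R : R).
Implicit Types (A H : 'M[R]_n.+1) (f g : pt -> R).

Lemma sphere_bounded_quad_form A : sphere_bounded (quad_form A : pt -> R).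
Proof.
rewrite (_ : quad_form A = (fun x => \sum_i \sum_j tnth x i * (A i j * tnth x j))); last first.
  by apply/funext => x; exact: quad_formE.
apply: sphere_bounded_sum => i; apply: sphere_bounded_sum => j.
apply: sphere_boundedM; first exact: sphere_bounded_tnth.
by apply: sphere_boundedZ; exact: sphere_bounded_tnth.
Qed.

Lemma quad_form1 (x : pt) : quad_form 1%:M x = sqnorm x.
Proof.
rewrite quad_formE; apply: eq_bigr => i _; rewrite (bigD1 i)//= big1 ?addr0 => [|j ji].
  by rewrite mxE eqxx mul1r expr2.
by rewrite mxE eq_sym (negbTE ji) mul0r mulr0.
Qed.

Lemma quad_form_tscale A c (x : pt) :
  quad_form A (tscale c x) = c ^+ 2 * quad_form A x.
Proof.
rewrite !quad_formE mulr_sumr; apply: eq_bigr => i _; rewrite mulr_sumr.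
by apply: eq_bigr => j _; rewrite !tnth_mktuple; ring.
Qed.

Lemma quad_formZ A c (x : pt) : quad_form (c *: A) x = c * quad_form A x.
Proof.
rewrite !quad_formE mulr_sumr; apply: eq_bigr => i _; rewrite mulr_sumr.
by apply: eq_bigr => j _; rewrite mxE; ring.
Qed.

Lemma quad_form_delta i j (x : pt) :
  quad_form (delta_mx i j) x = tnth x i * tnth x j.
Proof.
rewrite quad_formE (bigD1 i)//= [X in X + _](bigD1 j)//= mxE !eqxx mul1r.
rewrite big1 => [|k /negbTE kj]; last by rewrite mxE kj andbF mul0r mulr0.
rewrite big1 ?addr0// => k /negbTE ki; rewrite big1// => l _.
by rewrite mxE ki mul0r mulr0.
Qed.

Let N k := gauss_mean (fun x : pt => sqnorm x ^+ k).

Let gauss_integrable_sqnorm k : gauss_integrable (fun x : pt => sqnorm x ^+ k).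
Proof.
have [h _] := stein0 (stein_quad_formX k (trmx1 R n.+1)).
by rewrite (_ : quad_form 1%:M = (@sqnorm R n.+1)) in h;
  last by apply/funext => x; exact: quad_form1.
Qed.

(** The case [A = H = 1] of [gauss_stein]. *)
Let N_rec k : 2 * N k.+1 = (dim + 2 * k%:R) * N k.
Proof.
have qE : quad_form 1%:M = (@sqnorm R n.+1) by apply/funext => x; exact: quad_form1.
have NS m : gauss_mean (fun x : pt => sqnorm x * sqnorm x ^+ m) = N m.+1.
  by congr gauss_mean; apply/funext => x; rewrite exprS.
have := @gauss_stein R n 1%:M 1%:M k (trmx1 _ _).
rewrite mxtrace1 trmx1 mul1mx qE !NS -/(N k) => ->; rewrite [RHS]mulrDl; congr (_ + _).
by case: k => [|k] //; rewrite mulr0 !mul0r.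
Qed.

Let N_gt0 k : 0 < N k.
Proof.
elim: k => [|k IH].
  rewrite /N (_ : (fun x => _) = monomial (fun=> 0%N)); last first.
    by apply/funext => x; rewrite expr0 monomial0.
  by rewrite /gauss_mean integral_monomial prodr_gt0// => i _; exact: gauss_moment0_gt0.
rewrite -(@pmulr_rgt0 _ 2)// N_rec mulr_gt0// ltr_wpDr ?mulr_ge0//.
Qed.

(** The three Gaussian means in [gauss_stein] have degrees [2 k + 2], [2 k] and
    [2 k]; dividing by their radial factors, whose ratio is given by [N_rec],
    leaves means over the sphere. *)
Lemma sphere_stein A H k : H^T = H ->
  (dim + 2 * k%:R) * E (fun x => quad_form A x * quad_form H x ^+ k) =
  \tr A * E (fun x => quad_form H x ^+ k)
  + 2 * k%:R * E (fun x => quad_form (A^T *m H) x * quad_form H x ^+ k.-1).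
Proof.
move=> symH.
have conv B m : gauss_mean (fun x : pt => quad_form B x * quad_form H x ^+ m) =
    N m.+1 * E (fun x => quad_form B x * quad_form H x ^+ m).
  apply: gauss_mean_homogeneous => //.
  - apply: sphere_boundedM; first exact: sphere_bounded_quad_form.
    by apply: sphere_boundedX; exact: sphere_bounded_quad_form.
  - by move=> c x c0; rewrite !quad_form_tscale exprMn mulnS exprD exprM; ring.
  - exact: gauss_integrable_quad_form.
  - exact: gauss_integrable_sqnorm.
have convX m : gauss_mean (fun x : pt => quad_form H x ^+ m) =
    N m * E (fun x => quad_form H x ^+ m).
  case: m => [|m]; last first.
    have := conv H m; have -> // : (fun x : pt => quad_form H x * quad_form H x ^+ m) =
      (fun x => quad_form H x ^+ m.+1) by apply/funext => x; rewrite exprS.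
  rewrite (_ : E _ = 1) ?mulr1//.
  by rewrite -[RHS](sphere_mean_cst n 1); apply: eq_sphere_mean => x _; rewrite expr0.
have := gauss_stein A k symH; rewrite !conv convX mulrA N_rec.
have Nk : N k != 0 by rewrite gt_eqF.
case: k Nk => [|k] Nk /=.
  rewrite mulr0 !mul0r !addr0 => h; apply: (mulfI Nk).
  by rewrite mulrCA mulrA h; ring.
move=> h; apply: (mulfI Nk); rewrite mulrCA mulrA h; ring.
Qed.


Let dim_gt0 : 0 < dim. Proof. by rewrite ltr0n. Qed.

Lemma sphere_mean_quad_form A : E (quad_form A) = \tr A / dim.
Proof.
have := @sphere_stein A 1%:M 0 (trmx1 _ _).
rewrite mulr0 mul0r !addr0 => h.
have -> : E (quad_form A) = E (fun x => quad_form A x * quad_form 1%:M x ^+ 0).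
  by apply: eq_sphere_mean => x _; rewrite expr0 mulr1.
apply: (mulfI (lt0r_neq0 dim_gt0)); rewrite h mulrCA divff ?lt0r_neq0// mulr1.
rewrite -[RHS]mulr1 -[in RHS](sphere_mean_cst n 1).
by congr (_ * _).
Qed.

Lemma sphere_mean_quad_formM A H : H^T = H ->
  E (fun x => quad_form A x * quad_form H x) =
  (\tr A * \tr H + 2 * \tr (A^T *m H)) / (dim * (dim + 2)).
Proof.
move=> symH; have := @sphere_stein A H 1 symH.
have e1 : E (fun x => quad_form H x ^+ 1) = \tr H / dim.
  by rewrite -sphere_mean_quad_form; apply: eq_sphere_mean => x _; rewrite expr1.
have e2 : E (fun x => quad_form (A^T *m H) x * quad_form H x ^+ 0) =
    \tr (A^T *m H) / dim.
  by rewrite -sphere_mean_quad_form; apply: eq_sphere_mean => x _; rewrite expr0 mulr1.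
have e3 : E (fun x => quad_form A x * quad_form H x ^+ 1) =
    E (fun x => quad_form A x * quad_form H x).
  by apply: eq_sphere_mean => x _; rewrite expr1.
rewrite e1 e2 e3 !mulr1 => h.
have d2 : dim + 2 != 0 by rewrite gt_eqF// addr_gt0.
apply: (mulfI d2); rewrite h; field.
by rewrite nat1r d2 lt0r_neq0.
Qed.

(** Mixed moments in which only powers of [H] occur stay within a
    combinatorial factor of [(D / dim) ^ degree], where [D = sqrt dim * fnorm H],
    because every trace of a power of [H] is at most the same power of [D]:
    the factors [2 k + 3] produced by [sphere_stein] build up the constant. *)
Lemma quad_form_moment_le H a k : H^T = H ->
  `|E (fun x => quad_form (H ^+ a.+1) x * quad_form H x ^+ k)| <=
  2 ^+ k * k.+1`!%:R * (Num.sqrt dim * fnorm H) ^+ (a + k).+1 / dim ^+ k.+1.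
Proof.
move=> symH; set D := Num.sqrt dim * fnorm H.
have D0 : 0 <= D by rewrite mulr_ge0 ?sqrtr_ge0 ?fnorm_ge0.
elim: k a => [|k IH] a.
  have -> : E (fun x => quad_form (H ^+ a.+1) x * quad_form H x ^+ 0) =
      \tr (H ^+ a.+1) / dim.
    by rewrite -sphere_mean_quad_form; apply: eq_sphere_mean => x _; rewrite expr0 mulr1.
  rewrite normrM [X in _ * X]gtr0_norm ?invr_gt0// expr0 !mul1r addn0 expr1.
  by rewrite ler_pM2r ?invr_gt0//; exact: mxtraceX_le.
have h := @sphere_stein (H ^+ a.+1) H k.+1 symH.
set x := E _ in h *; set y := E _ in h; set z := E _ in h.
have hy : `|y| <= 2 ^+ k * k.+1`!%:R * D ^+ k.+1 / dim ^+ k.+1.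
  have := IH 0%N; rewrite add0n expr1; congr (`| _ | <= _).
  by apply: eq_sphere_mean => u _; rewrite exprS.
have hz : `|z| <= 2 ^+ k * k.+1`!%:R * D ^+ (a.+1 + k).+1 / dim ^+ k.+1.
  have := IH a.+1; congr (`| _ | <= _).
  apply: eq_sphere_mean => u _; rewrite trmxX//; congr (quad_form _ _ * _).
  by rewrite -[in RHS]/(H ^+ a.+1 * H) -exprSr.
have ht := mxtraceX_le a symH; rewrite -/D in ht.
have dk0 : 0 < dim + 2 * k.+1%:R by rewrite addr_gt0// mulr_gt0.
have : (dim + 2 * k.+1%:R) * `|x| <= D ^+ a.+1 * `|y| + 2 * k.+1%:R * `|z|.
  rewrite -{1}(gtr0_norm dk0) -normrM h (le_trans (ler_normD _ _))//.
  by rewrite !normrM lerD// ?ler_wpM2r// !ger0_norm.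
set c := 2 ^+ k * k.+1`!%:R in IH hy hz *.
have c0 : 0 <= c by rewrite mulr_ge0// exprn_ge0.
set B := D ^+ (a + k.+1).+1 / dim ^+ k.+1.
have B0 : 0 <= B by rewrite mulr_ge0 ?invr_ge0 ?exprn_ge0.
have h1 : D ^+ a.+1 * `|y| <= c * B.
  have -> : c * B = D ^+ a.+1 * (c * D ^+ k.+1 / dim ^+ k.+1).
    by rewrite /B -addSn exprD; ring.
  by rewrite ler_wpM2l// exprn_ge0.
have h2 : `|z| <= c * B by rewrite /B -[(a + k.+1)%N]addSnnS mulrA.
have -> : 2 ^+ k.+1 * k.+2`!%:R * D ^+ (a + k.+1).+1 / dim ^+ k.+2 =
    2 * k.+2%:R * (c * B) / dim.
  rewrite /c /B [2 ^+ k.+1]exprS (factS k.+1) natrM [dim ^+ k.+2]exprS.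
  by field; rewrite nat1r expf_neq0 ?lt0r_neq0.
move=> h3; rewrite ler_pdivlMr//.
have : dim * `|x| <= c * B + 2 * k.+1%:R * (c * B).
  apply: le_trans (le_trans h3 _).
    by rewrite ler_wpM2r// lerDl mulr_ge0.
  by apply: lerD => //; rewrite ler_wpM2l// mulr_ge0.
have -> : 2 * k.+2%:R * (c * B) = c * B + 2 * k.+1%:R * (c * B) + c * B.
  by rewrite -[k.+2%:R]natr1; ring.
have := mulr_ge0 c0 B0; lra.
Qed.

(** The typical size of [x^T H x] on the sphere, its trace part included. *)
Definition qscale H : R := fnorm H / Num.sqrt dim.

Lemma qscale_ge0 H : 0 <= qscale H.
Proof. by rewrite divr_ge0 ?fnorm_ge0 ?sqrtr_ge0. Qed.

Lemma qscaleE H : Num.sqrt dim * fnorm H / dim = qscale H.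
Proof.
have s0 : Num.sqrt dim != 0 by rewrite gt_eqF// sqrtr_gt0.
rewrite /qscale -{2}(sqr_sqrtr (ltW dim_gt0)); field; exact: s0.
Qed.

Lemma quad_formX_moment_le H k : H^T = H ->
  `|E (fun x => quad_form H x ^+ k)| <= k`!%:R * (2 * qscale H) ^+ k.
Proof.
move=> symH; case: k => [|k].
  have -> : E (fun x => quad_form H x ^+ 0) = 1.
    by rewrite -[RHS](sphere_mean_cst n 1); apply: eq_sphere_mean => x _; rewrite expr0.
  by rewrite normr1 !expr0 mulr1.
have := quad_form_moment_le 0 k symH; rewrite expr1 add0n.
have -> : E (fun x => quad_form H x * quad_form H x ^+ k) =
    E (fun x => quad_form H x ^+ k.+1).
  by apply: eq_sphere_mean => x _; rewrite exprS.
move/le_trans; apply; rewrite -[leLHS]mulrA -expr_div_n qscaleE [in leRHS]exprMn.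
rewrite [leRHS]mulrA ler_wpM2r ?exprn_ge0 ?qscale_ge0// mulrC ler_wpM2l//.
by rewrite [leRHS]exprS ler_peMl ?exprn_ge0// ler1n.
Qed.

End sphere_moments.

(** * Exponential moments and moment matrices *)

(** In the symmetrized exponential series all terms are nonnegative, so that it
    can be integrated term by term. *)
Lemma expR_sym_series (R : realType) (y : R) :
  (\sum_(0 <= k <oo) ((y ^+ k + (- y) ^+ k) / k`!%:R)%:E)%E =
  (expR y + expR (- y))%:E.
Proof.
apply/cvg_lim => //.
under eq_fun do rewrite sumEFin.
apply: cvg_EFin; first by near=> k.
rewrite (_ : _ \o _ = (fun m => series (exp_coeff y) m + series (exp_coeff (- y)) m)).
  by apply: cvgD; exact: is_cvg_series_exp_coeff.
apply/funext => m /=; rewrite /series /= -big_split /=.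
by apply: eq_bigr => k _; rewrite mulrDl.
Unshelve. all: by end_near. Qed.

Lemma expR_sub1_le (R : realType) (y : R) : expR y - 1 <= y * expR y.
Proof.
have := expR_ge1Dx (- y); have := expR_gt0 y.
have : expR y * expR (- y) = 1 by rewrite -expRD subrr expR0.
nra.
Qed.

Lemma expR_taylor2_le (R : realType) (y : R) :
  `|expR y - 1 - y| <= y ^+ 2 * expR `|y|.
Proof.
have h1 := expR_ge1Dx y; have h2 := expR_sub1_le y.
rewrite ger0_norm; last lra.
have h0 := expR_gt0 y.
have [y0|y0] := leP 0 y.
  by rewrite ger0_norm//; nra.
have h3 : 1 <= expR `|y| by rewrite -[leLHS]expR0 ler_expR.
have : y * (expR y - 1) <= y ^+ 2 by nra.
have : y ^+ 2 <= y ^+ 2 * expR `|y| by rewrite ler_peMr ?sqr_ge0.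
by rewrite mulrBr mulr1; lra.
Qed.

(** Second order Taylor remainders of the exponential at scale [tau], measured
    against an exponential moment at the scale [1 / tau]. *)
Lemma sqr_expR_taylor2_le (R : realType) (tau u : R) : 0 <= tau <= 4^-1 ->
  (expR (tau * u) - 1 - tau * u) ^+ 2 <= 384 * tau ^+ 4 * (expR u + expR (- u)).
Proof.
move=> /andP[tau0 tau1].
have a0 : 0 <= `|u| by [].
have h1 : (expR (tau * u) - 1 - tau * u) ^+ 2 <= tau ^+ 4 * `|u| ^+ 4 * expR (`|u| / 2).
  apply: (@le_trans _ _ (((tau * u) ^+ 2 * expR `|tau * u|) ^+ 2)).
    rewrite -[leLHS]real_normK ?num_real//.
    apply: lerXn2r; rewrite ?nnegrE//; last exact: expR_taylor2_le.
    by rewrite mulr_ge0 ?sqr_ge0 ?expR_ge0.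
  rewrite exprMn -exprM exprMn -[`|u| ^+ 4]normrX.
  rewrite [`|u ^+ _|]ger0_norm ?exprn_even_ge0//; apply: ler_wpM2l.
    by rewrite mulr_ge0 ?exprn_even_ge0.
  rewrite expr2 -expRD ler_expR normrM (ger0_norm tau0); nra.
have h2 : `|u| ^+ 4 <= 384 * expR (`|u| / 2).
  (* 384 is [2 ^ 4 * 4!]: the fourth term of the series of [exp (|u| / 2)]. *)
  have := @expR_ge1Dxn R (`|u| / 2) 3 (divr_ge0 a0 (ler0n _ 2)).
  rewrite expr_div_n (_ : 2 ^+ 4 = 16); last by ring.
  rewrite (_ : 4`!%:R = 24) //; have := expR_gt0 (`|u| / 2); lra.
have h3 : expR (`|u| / 2) * expR (`|u| / 2) <= expR u + expR (- u).
  rewrite -expRD -splitr; have := expR_gt0 u; have := expR_gt0 (- u).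
  by have [u0|u0] := leP 0 u; [rewrite ger0_norm//|rewrite ltr0_norm//]; lra.
apply: (le_trans h1); apply: (@le_trans _ _ (tau ^+ 4 * (384 * expR (`|u| / 2)) * expR (`|u| / 2))).
  by rewrite ler_wpM2r ?expR_ge0// ler_wpM2l// exprn_ge0.
rewrite (_ : _ * _ * _ = 384 * tau ^+ 4 * (expR (`|u| / 2) * expR (`|u| / 2))); last by ring.
by rewrite ler_wpM2l// mulr_ge0// exprn_ge0.
Qed.

Section sphere_exponential.
Context {R : realType} (n : nat).
Local Notation pt := (n.+1.-tuple R).
Local Notation E := (@sphere_mean R n).
Local Notation dim := (n.+1%:R : R).
Implicit Types (A H : 'M[R]_n.+1) (f g : pt -> R).

Lemma sphere_mean_EFin f : sphere_bounded f ->
  (\int[@sphere_measure R n.+1]_(x in @sphere R n.+1) (f x)%:E)%E = (E f)%:E.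
Proof.
move=> bf; rewrite /sphere_mean /Rintegral fineK//.
apply: integrable_fin_num; first exact: measurable_sphere.
exact: sphere_bounded_integrable.
Qed.

(** The moment bound makes the exponential series at most twice a geometric
    series of ratio one half. *)
Lemma sphere_exp_moment_le H : H^T = H -> qscale H <= 4^-1 ->
  E (fun x => expR (quad_form H x) + expR (- quad_form H x)) <= 4.
Proof.
move=> symH scH.
pose q := quad_form H : pt -> R.
pose F k x := (q x ^+ k + (- q x) ^+ k) / k`!%:R.
have bq : sphere_bounded q by exact: sphere_bounded_quad_form.
have FE k x : F k x = ((1 + (-1) ^+ k) / k`!%:R) * q x ^+ k.
  by rewrite /F [in LHS]exprNn; ring.
have FfE k : F k = fun x => ((1 + (-1) ^+ k) / k`!%:R) * q x ^+ k.
  by apply/funext => x; exact: FE.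
have bF k : sphere_bounded (F k).
  by rewrite FfE; apply: sphere_boundedZ; exact: sphere_boundedX.
have F0 k x : 0 <= F k x.
  rewrite FE -signr_odd; case: (boolP (odd k)) => ok.
    by rewrite expr1 subrr !mul0r.
  apply: mulr_ge0; first by rewrite divr_ge0// expr0 addr_ge0.
  by rewrite -(even_halfK ok) -mul2n exprM exprn_ge0// sqr_ge0.
have EF k : E (F k) <= 2 * 2^-1 ^+ k.
  rewrite FfE sphere_meanZ; last exact: sphere_boundedX.
  have h := @quad_formX_moment_le R n H k symH.
  have fk : 0 < k`!%:R :> R by rewrite ltr0n fact_gt0.
  have s0 := qscale_ge0 H.
  have e2 : 0 <= (1 + (-1) ^+ k : R) <= 2.
    by rewrite -signr_odd; case: (odd k); rewrite ?expr1 ?expr0; lra.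
  have h' : E (fun x => q x ^+ k) / k`!%:R <= 2^-1 ^+ k.
    rewrite ler_pdivrMr// mulrC (le_trans (ler_norm _))// (le_trans h)//.
    rewrite ler_wpM2l//; apply: lerXn2r; rewrite ?nnegrE; lra.
  rewrite mulrAC -mulrA; case/andP: e2 => e20 e22.
  apply: le_trans (ler_wpM2l e20 h') _.
  by rewrite ler_wpM2r// exprn_ge0.
rewrite -lee_fin -sphere_mean_EFin; last first.
  apply: sphere_boundedD; apply: sphere_bounded_expR => //.
  have := sphere_boundedZ (-1) bq; by under eq_fun do rewrite mulN1r.
under eq_integral do rewrite -expR_sym_series.
rewrite integral_nneseries.
- apply: lime_le.
    by apply: is_cvg_nneseries => k _ _; apply: integral_ge0 => x _; rewrite lee_fin F0.
  apply: nearW => m.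
  rewrite (eq_bigr (fun k => (E (F k))%:E)) => [|k _]; last exact: sphere_mean_EFin (bF k).
  rewrite sumEFin lee_fin.
  apply: (@le_trans _ _ (4 - 4 * 2^-1 ^+ m)); last first.
    by have : 0 <= (2^-1 : R) ^+ m by [rewrite exprn_ge0]; lra.
  elim: m => [|m IH]; first by rewrite big_geq// expr0; lra.
  rewrite big_nat_recr//= exprS; have := EF m; rewrite /F; lra.
- exact: measurable_sphere.
- move=> k; apply: measurable_funTS; apply/measurable_EFinP; by case: (bF k).
- by move=> k x _; rewrite lee_fin F0.
Qed.


Lemma sphere_cauchy_schwarz f g : sphere_bounded f -> sphere_bounded g ->
  E (fun x => f x * g x) ^+ 2 <= E (fun x => f x ^+ 2) * E (fun x => g x ^+ 2).
Proof.
move=> bf bg.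
set a := E (fun x => f x ^+ 2); set b := E (fun x => f x * g x).
set c := E (fun x => g x ^+ 2).
have bfg := sphere_boundedM bf bg.
have bf2 := sphere_boundedX 2 bf; have bg2 := sphere_boundedX 2 bg.
have key l : 0 <= a + 2 * l * b + l ^+ 2 * c.
  have -> : a + 2 * l * b + l ^+ 2 * c = E (fun x => (f x + l * g x) ^+ 2).
    rewrite /a /b /c -!sphere_meanZ// -!sphere_meanD//; try exact: sphere_boundedZ.
      by apply: eq_sphere_mean => x _; ring.
    by apply: sphere_boundedD => //; exact: sphere_boundedZ.
  by apply: sphere_mean_ge0 => x _; exact: sqr_ge0.
have c0 : 0 <= c by apply: sphere_mean_ge0 => x _; exact: sqr_ge0.
have a0 : 0 <= a by apply: sphere_mean_ge0 => x _; exact: sqr_ge0.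
have [c_eq0|c_neq0] := eqVneq c 0.
  have [b0|b0] := eqVneq b 0; first by rewrite b0 expr0n mulr_ge0.
  have := key (- (a + 1) / (2 * b)); rewrite c_eq0 mulr0 addr0.
  rewrite (_ : 2 * _ * b = - (a + 1)); first lra.
  by field.
have := key (- b / c).
rewrite (_ : a + _ + _ = (a * c - b ^+ 2) / c); last by field.
by rewrite pmulr_lge0 ?invr_gt0 ?lt0r ?c_neq0// subr_ge0.
Qed.

(** The mean of [f x *: (x x^T)]. *)
Definition moment_mx f : 'M[R]_n.+1 := \matrix_(i, j) E (fun x => f x * (tnth x i * tnth x j)).

Lemma trmx_moment_mx f : (moment_mx f)^T = moment_mx f.
Proof.
apply/matrixP => i j; rewrite !mxE; apply: eq_sphere_mean => x _.
by rewrite [tnth x j * _]mulrC.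
Qed.

Let b_ij i j : sphere_bounded (fun x : pt => tnth x i * tnth x j).
Proof. by apply: sphere_boundedM; exact: sphere_bounded_tnth. Qed.

Lemma moment_mxD f g : sphere_bounded f -> sphere_bounded g ->
  moment_mx (fun x => f x + g x) = moment_mx f + moment_mx g.
Proof.
move=> bf bg; apply/matrixP => i j; rewrite !mxE -sphere_meanD.
- by apply: eq_sphere_mean => x _; rewrite mulrDl.
- exact: sphere_boundedM.
- exact: sphere_boundedM.
Qed.

Lemma sphere_mean_quad_form_sqr A : A^T = A ->
  E (fun x => quad_form A x ^+ 2) <= fnorm A ^+ 2 / dim.
Proof.
move=> symA.
have -> : E (fun x => quad_form A x ^+ 2) = E (fun x => quad_form A x * quad_form A x).
  by apply: eq_sphere_mean => x _; rewrite expr2.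
rewrite sphere_mean_quad_formM//.
have d0 : 0 < dim by rewrite ltr0n.
have trA : \tr (A^T *m A) = fnorm A ^+ 2.
  rewrite sqr_fnorm /mxtrace /fnorm2 exchange_big /=; apply: eq_bigr => i _.
  by rewrite mxE; apply: eq_bigr => j _; rewrite mxE expr2.
have tr1 : \tr A ^+ 2 <= dim * fnorm A ^+ 2.
  rewrite -[leLHS]real_normK ?num_real// -[dim](sqr_sqrtr (ltW d0)) -exprMn.
  apply: lerXn2r; rewrite ?nnegrE ?mulr_ge0 ?sqrtr_ge0 ?fnorm_ge0//.
  exact: mxtrace_le.
rewrite trA ler_pdivrMr ?mulr_gt0 ?addr_gt0// -expr2.
rewrite (_ : _ / dim * _ = dim * fnorm A ^+ 2 + 2 * fnorm A ^+ 2); last first.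
  by field; rewrite nat1r gt_eqF.
by rewrite lerD2r.
Qed.

(** Duality: [fnorm M ^ 2 = E (f x^T M x)] for [M = moment_mx f], and
    Cauchy-Schwarz bounds the right side by a multiple of [fnorm M]. *)
Lemma fnorm_moment_mx f : sphere_bounded f ->
  fnorm (moment_mx f) ^+ 2 <= E (fun x => f x ^+ 2) / dim.
Proof.
move=> bf; set M := moment_mx f.
have e1 : fnorm M ^+ 2 = E (fun x => f x * quad_form M x).
  have bF i j : sphere_bounded (fun x => M i j * (f x * (tnth x i * tnth x j))).
    by apply: sphere_boundedZ; exact: sphere_boundedM.
  transitivity (\sum_i \sum_j E (fun x => M i j * (f x * (tnth x i * tnth x j)))).
    rewrite sqr_fnorm; apply: eq_bigr => i _; apply: eq_bigr => j _.
    rewrite sphere_meanZ; last exact: sphere_boundedM.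
    by rewrite expr2 {2}/M mxE.
  under eq_bigr do rewrite -sphere_mean_sum//.
  rewrite -sphere_mean_sum => [|i]; last exact: sphere_bounded_sum.
  apply: eq_sphere_mean => x _; rewrite quad_formE mulr_sumr; apply: eq_bigr => i _.
  by rewrite mulr_sumr; apply: eq_bigr => j _; ring.
have := sphere_cauchy_schwarz bf (sphere_bounded_quad_form M); rewrite -e1.
have := sphere_mean_quad_form_sqr (trmx_moment_mx f); rewrite -/M.
have f0 : 0 <= E (fun x => f x ^+ 2) by apply: sphere_mean_ge0 => x _; exact: sqr_ge0.
set t := fnorm M ^+ 2; have t0 : 0 <= t by exact: sqr_ge0.
move=> h1 h2; have [->|t_neq0] := eqVneq t 0; first by rewrite divr_ge0.
have t_gt0 : 0 < t by rewrite lt0r t_neq0.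
rewrite -(ler_pM2r t_gt0) -expr2 (le_trans h2)// -mulrA ler_wpM2l//.
by rewrite mulrC.
Qed.

Lemma mxtrace_delta i j : \tr (delta_mx i j : 'M[R]_n.+1) = (i == j)%:R.
Proof.
rewrite /mxtrace (bigD1 i)//= big1 ?addr0 => [|k /negbTE ki]; last by rewrite mxE ki.
by rewrite mxE eqxx.
Qed.

Lemma moment_mx1 : moment_mx (fun=> 1) = dim^-1 *: 1%:M.
Proof.
apply/matrixP => i j; rewrite !mxE.
have -> : E (fun x => 1 * (tnth x i * tnth x j)) = E (quad_form (delta_mx i j)).
  by apply: eq_sphere_mean => x _; rewrite quad_form_delta mul1r.
by rewrite sphere_mean_quad_form mulrC mxtrace_delta.
Qed.

Lemma moment_mx_quad_form H : H^T = H ->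
  moment_mx (quad_form H) = (dim * (dim + 2))^-1 *: (\tr H *: 1%:M + 2 *: H).
Proof.
move=> symH; apply/matrixP => i j; rewrite !mxE.
have -> : E (fun x => quad_form H x * (tnth x i * tnth x j)) =
    E (fun x => quad_form (delta_mx i j) x * quad_form H x).
  by apply: eq_sphere_mean => x _; rewrite quad_form_delta mulrC.
rewrite sphere_mean_quad_formM// mxtrace_delta trmx_delta.
have -> : \tr (delta_mx j i *m H) = H i j.
  rewrite /mxtrace (bigD1 j)//= big1 ?addr0 => [|k /negbTE kj].
    rewrite mxE (bigD1 i)//= big1 ?addr0 => [|k /negbTE ki].
      by rewrite mxE !eqxx mul1r.
    by rewrite mxE ki andbF mul0r.
  by rewrite mxE big1// => l _; rewrite mxE kj mul0r.
by rewrite [LHS]mulrC [\tr H * _]mulrC.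
Qed.

End sphere_exponential.

(** * The covariance of a Bingham vector *)
Section sphere_symmetry.
Context {R : realType} (n : nat).
Local Notation pt := (n.+1.-tuple R).
Local Notation E := (@sphere_mean R n).
Local Notation sigma := (@sphere_measure R n.+1).

Lemma direction_tscaleN (x : pt) : direction (tscale (-1) x) = tscale (-1) (direction x).
Proof. by rewrite !directionE enorm_tscale normrN1 mul1r !tscaleA mulrC. Qed.

Lemma sphere_measureN (A : set pt) : measurable A ->
  sigma (tscale (-1) @^-1` A) = sigma A.
Proof.
move=> mA; rewrite /sphere_measure; congr (_ * _)%E.
have mN : measurable (tscale (-1) @^-1` A : set pt).
  by rewrite -[X in measurable X]setTI; exact: (@measurable_tscale R n.+1 (-1)).
have mC B : measurable B -> measurable (cone B : set pt).
  by move=> mB; rewrite coneE; exact: measurable_shell.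
have iE (B : set pt) : measurable B ->
    lebesgue_tuple B = (\int[@lebesgue_tuple R n.+1]_x (\1_B x)%:E)%E.
  by move=> mB; rewrite integral_indic// setIT.
rewrite !iE; [|exact: mC|exact: mC].
rewrite [RHS](@ge0_integral_tscale _ _ (-1)) ?oppr_eq0 ?oner_eq0//.
  rewrite normrN1 expr1n mul1e; apply: eq_integral => x _; congr (_%:E).
  rewrite !indicE; congr ((nat_of_bool _)%:R).
  by apply/idP/idP; rewrite !inE /cone /= enorm_tscale normrN1 mul1r direction_tscaleN.
by apply/measurable_EFinP; apply: measurable_indic; exact: mC.
Qed.

Lemma sphere_meanN (f : pt -> R) : sphere_bounded f ->
  E (fun x => f (tscale (-1) x)) = E f.
Proof.
move=> bf; have [mf [M fM]] := bf.
have SN (x : pt) : sphere (tscale (-1) x) = sphere x.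
  by rewrite /sphere /= enorm_tscale normrN1 mul1r.
have bfN : sphere_bounded (fun x => f (tscale (-1) x)).
  split; first by apply: measurableT_comp mf _; exact: measurable_tscale.
  by exists M => x Sx; apply: fM; rewrite SN.
have preS : tscale (-1) @^-1` (@sphere R n.+1) = @sphere R n.+1.
  by apply/seteqP; split=> x /=; rewrite SN.
rewrite /sphere_mean /Rintegral; congr fine.
have := @integral_pushforward _ _ _ _ R _ (@measurable_tscale R n.+1 (-1)) sigma
  (@sphere R n.+1) (EFin \o f) _ _ (@measurable_sphere R n.+1).
rewrite preS => <-.
- apply: eq_measure_integral => [|mN A mA _]; first exact: measurable_tscale.
  exact: sphere_measureN.
- exact/measurable_EFinP.
- exact: (sphere_bounded_integrable bfN).
Qed.

End sphere_symmetry.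

Section bingham.
Context {R : realType} (n : nat) (disp : measure_display)
  (T : measurableType disp) (P : probability T R)
  (X : {RV P >-> n.+1.-tuple R}) (S : 'M[R]_n.+1).
Local Notation pt := (n.+1.-tuple R).
Local Notation E := (@sphere_mean R n).
Local Notation sigma := (@sphere_measure R n.+1).
Hypothesis hX : has_bingham X S.
Local Notation nu := (distribution P X).

Let w (x : pt) : R := expR (quad_form S x).

Let bw : sphere_bounded w.
Proof. by apply: sphere_bounded_expR; exact: sphere_bounded_quad_form. Qed.

Lemma bingham_constE : bingham_const S = E w.
Proof. by []. Qed.

Let rho (x : pt) : R := (bingham_density S x).

Let brho : sphere_bounded rho.
Proof. exact: sphere_boundedZ. Qed.

Let rhoS : pt -> \bar R := (EFin \o rho) \_ (@sphere R n.+1).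

Let nuE A : measurable A -> nu A = (\int[sigma]_(x in A) rhoS x)%E.
Proof. by move=> mA; rewrite hX// integral_mkcondr. Qed.

Let int_rhoS : sigma.-integrable setT rhoS.
Proof.
apply/(integrable_mkcond (EFin \o rho) (@measurable_sphere R n.+1)).
exact: sphere_bounded_integrable.
Qed.

Let nu_dominated : nu `<< sigma.
Proof.
apply/null_content_dominatesP => A mA A0; rewrite nuE//.
apply: null_set_integral => //; apply: measurable_funTS.
exact: measurable_int int_rhoS.
Qed.

Let nu_setC : nu (~` @sphere R n.+1) = 0%E.
Proof.
by rewrite hX ?setICl ?integral_set0//; apply: measurableC; exact: measurable_sphere.
Qed.

Let nu_integrable f : sphere_bounded f -> nu.-integrable setT (EFin \o f).
Proof.
move=> [mf [M fM]]; apply/integrableP; split; first exact/measurable_EFinP.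
apply: (@le_lt_trans _ _ (\int[nu]_x `|M|%:E)%E).
  apply: ae_ge0_le_integral => //.
  - by apply: measurableT_comp => //; exact/measurable_EFinP.
  - exists (~` @sphere R n.+1); split => //.
      by apply: measurableC; exact: measurable_sphere.
    apply: subsetC => x Sx _ /=; rewrite lee_fin.
    exact: le_trans (fM x Sx) (ler_norm M).
by rewrite integral_cst//= probability_setT mule1 ltry.
Qed.

(** The density of [has_bingham] is a Radon-Nikodym derivative of the law of [X],
    hence agrees almost everywhere with the one used by the change of variables
    theorem. *)
Let nu_mean f : sphere_bounded f ->
  (\int[nu]_x (f x)%:E = ((E w)^-1 * E (fun x => f x * w x))%:E)%E.
Proof.
move=> bf; have intf := nu_integrable bf.
have <- := Radon_Nikodym_change_of_variables nu_dominated measurableT intf.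
have ae : ae_eq sigma setT (Radon_Nikodym (charge_of_finite_measure nu) sigma) rhoS.
  apply: integral_ae_eq => //.
  - by apply: Radon_Nikodym_integrable; exact: nu_dominated.
  - exact: measurable_int int_rhoS.
  - by move=> A _ mA; rewrite -nuE// -Radon_Nikodym_integral.
have [mf _] := bf.
transitivity (\int[sigma]_x ((EFin \o f) x * rhoS x))%E.
  apply: ae_eq_integral => //.
  - apply: emeasurable_funM; first exact/measurable_EFinP.
    by apply: measurable_int; apply: Radon_Nikodym_integrable; exact: nu_dominated.
  - apply: emeasurable_funM; first exact/measurable_EFinP.
    exact: measurable_int int_rhoS.
  - by apply: filterS ae => x /= h _; rewrite h.
transitivity (\int[sigma]_(x in @sphere R n.+1) (f x * rho x)%:E)%E.
  rewrite [RHS]integral_mkcond; apply: eq_integral => x _.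
  by rewrite /rhoS !patchE; case: ifP => _; rewrite ?mule0// EFinM.
rewrite sphere_mean_EFin; last exact: sphere_boundedM.
congr (_%:E); rewrite -sphere_meanZ; last exact: sphere_boundedM.
by apply: eq_sphere_mean => x _; rewrite /rho /bingham_density bingham_constE mulrCA.
Qed.

Let mean_coord i : (\int[nu]_x (tnth x i)%:E = 0)%E.
Proof.
rewrite nu_mean; last exact: sphere_bounded_tnth.
suff -> : E (fun x => tnth x i * w x) = 0 by rewrite mulr0.
have bf : sphere_bounded (fun x => tnth x i * w x).
  by apply: sphere_boundedM => //; exact: sphere_bounded_tnth.
have := sphere_meanN bf.
have -> : E (fun x => tnth (tscale (-1) x) i * w (tscale (-1) x)) =
    - E (fun x => tnth x i * w x).
  rewrite -[RHS]mulN1r -[RHS]sphere_meanZ//; apply: eq_sphere_mean => x _.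
  by rewrite /w quad_form_tscale tnth_mktuple sqrrN expr1n mul1r mulrA.
by lra.
Qed.

Let P_integrable f : sphere_bounded f ->
  P.-integrable setT (EFin \o (fun t => f (X t))).
Proof.
move=> bf; have [mf _] := bf; have /integrableP[_ foo] := nu_integrable bf.
apply/integrableP; split.
  by apply/measurable_EFinP; apply: measurableT_comp mf _; exact: measurable_funP.
apply: le_lt_trans foo; rewrite (ge0_integral_distribution X)//.
by apply: measurableT_comp => //; exact/measurable_EFinP.
Qed.

Let P_mean f : sphere_bounded f ->
  (\int[P]_t (f (X t))%:E = \int[nu]_x (f x)%:E)%E.
Proof.
move=> bf; have [mf _] := bf.
by rewrite (integral_distribution (X := X)) //; [exact/measurable_EFinP|exact: P_integrable].
Qed.

(** The coordinates have mean zero, the Bingham density being even. *)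
Lemma cov_matrix_bingham :
  cov_matrix P X = (E (fun x => expR (quad_form S x)))^-1
                     *: moment_mx (fun x => expR (quad_form S x)).
Proof.
apply/matrixP => i j; rewrite !mxE.
have bi k := @sphere_bounded_tnth R n k.
have bij : sphere_bounded (fun x : pt => tnth x i * tnth x j) by exact: sphere_boundedM.
rewrite covarianceE; [|exact/Lfun1_integrable/(P_integrable (bi i))
  |exact/Lfun1_integrable/(P_integrable (bi j))|exact/Lfun1_integrable/(P_integrable bij)].
rewrite unlock.
rewrite (P_mean (bi i)) (P_mean bij) mean_coord mul0e sube0 (nu_mean bij) /=.
by congr (_ * _); apply: eq_sphere_mean => x _; rewrite mulrC.
Qed.

End bingham.

(** * Derivatives of functions of a symmetric matrix *)
Section matrix_derivatives.
Context {R : realType} (n : nat).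
Local Notation M := ('M[R]_n.+1).
Implicit Types (f g : M -> R) (A S V G : M).

Lemma is_derive_coord (i j : 'I_n.+1) S V :
  is_derive S V (fun A : M => A i j) (V i j).
Proof.
have c : h^-1 *: (((h *: V + S) : M) i j - S i j) @[h --> (0 : R)^'] --> V i j.
  apply: cvg_near_cst; near=> h.
  have h0 : h != 0 by near: h; exact: nbhs_dnbhs_neq.
  by rewrite !mxE addrK /GRing.scale /= mulKf.
apply: DeriveDef; first by apply/cvg_ex; exists (V i j).
exact: (cvg_lim _ c).
Unshelve. all: by end_near. Qed.

Lemma is_derive_funM f g S V df dg : is_derive S V f df -> is_derive S V g dg ->
  is_derive S V (fun A => f A * g A) (f S * dg + g S * df).
Proof. by move=> hf hg; exact: (is_deriveM hf hg). Qed.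

Lemma is_derive_funD f g S V df dg : is_derive S V f df -> is_derive S V g dg ->
  is_derive S V (fun A => f A + g A) (df + dg).
Proof. by move=> hf hg; exact: (is_deriveD hf hg). Qed.

Lemma is_derive_fun_sum I (r : seq I) (F : I -> M -> R) dF S V :
  (forall i, is_derive S V (F i) (dF i)) ->
  is_derive S V (fun A => \sum_(i <- r) F i A) (\sum_(i <- r) dF i).
Proof.
move=> hF; elim: r => [|i r IH].
  under eq_fun do rewrite big_nil; rewrite big_nil; exact: is_derive_cst.
under eq_fun do rewrite big_cons; rewrite big_cons; exact: is_derive_funD.
Qed.

(** The differential of the [m]-th matrix power at [S], applied to [V]. *)
Fixpoint dmxpow m S V : M :=
  if m is m'.+1 then V *m S ^+ m' + S *m dmxpow m' S V else 0.

Lemma is_derive_mxpow m S V i j :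
  is_derive S V (fun A : M => (A ^+ m) i j) (dmxpow m S V i j).
Proof.
elim: m i j => [|m IH] i j.
  by rewrite (_ : dmxpow 0 S V i j = 0) ?mxE//; exact: is_derive_cst.
have -> : (fun A : M => (A ^+ m.+1) i j) = (fun A : M => \sum_k A i k * (A ^+ m) k j).
  by apply/funext => A; rewrite exprS mxE.
have := is_derive_fun_sum (index_enum 'I_n.+1)
  (fun k => is_derive_funM (is_derive_coord i k S V) (IH k j)).
congr (is_derive _ _ _ _); rewrite /= !mxE -big_split; apply: eq_bigr => k _ /=.
by rewrite [_ * V i k]mulrC addrC.
Qed.

Lemma mxtrace_dmxpow l m S V :
  \tr (S ^+ l *m dmxpow m.+1 S V) = m.+1%:R * \tr (S ^+ (l + m) *m V).
Proof.
elim: m l => [|m IH] l.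
  by rewrite /= mulmx0 addr0 expr0 mulmx1 addn0 mul1r.
have -> : dmxpow m.+2 S V = V *m S ^+ m.+1 + S *m dmxpow m.+1 S V by [].
have e1 : S ^+ l *m S = S ^+ l.+1 by rewrite exprSr.
have e2 : S ^+ m.+1 *m S ^+ l = S ^+ (l + m.+1) by rewrite addnC exprD.
rewrite mulmxDr mxtraceD [S ^+ l *m (S *m _)]mulmxA e1 IH.
rewrite [S ^+ l *m (V *m _)]mulmxA mxtrace_mulC mulmxA e2.
by rewrite addSnnS -[in RHS]nat1r mulrDl mul1r.
Qed.

Lemma is_derive_mxtraceX m S V :
  is_derive S V (fun A : M => \tr (A ^+ m.+1)) (\tr (m.+1%:R *: S ^+ m *m V)).
Proof.
have := is_derive_fun_sum (index_enum 'I_n.+1) (fun i => is_derive_mxpow m.+1 S V i i).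
congr (is_derive _ _ _ _).
by have := mxtrace_dmxpow 0 m S V; rewrite expr0 mul1mx add0n -scalemxAl mxtraceZ.
Qed.

Lemma gradientE f S G : G^T = G ->
  (forall V, is_derive S V f (\tr (G *m V))) -> gradient f S = G.
Proof.
move=> symG hf; apply/matrixP => i j; rewrite mxE.
have sG : G j i = G i j by rewrite -[in LHS]symG mxE.
have trd k l : \tr (G *m delta_mx k l) = G l k.
  rewrite /mxtrace (bigD1 l)//= big1 ?addr0 => [|a /negbTE al].
    rewrite mxE (bigD1 k)//= big1 ?addr0 => [|a /negbTE ak].
      by rewrite mxE !eqxx mulr1.
    by rewrite mxE ak mulr0.
  by rewrite mxE big1// => b _; rewrite mxE al andbF mulr0.
rewrite (@derive_val _ _ _ _ _ _ _ (hf (sym_unit R i j))) /sym_unit.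
have [->|_] := eqVneq i j.
  by rewrite trd [true%:R](_ : _ = 1)//; field.
by rewrite mulmxDr mxtraceD !trd sG [false%:R](_ : _ = 0)//; field.
Qed.

End matrix_derivatives.

(** * Growth of zonal polynomials and of their gradients *)
Section controlled_functions.
Context {R : realType}.
Local Notation matfun := (forall n, 'M[R]_n.+1 -> R).
Implicit Types f g : matfun.

(** A common bound for the powers of the traces that appear in zonal polynomials:
    [|tr (S ^ k)| <= mxsize S ^ k] for all [k > 0]. *)
Definition mxsize n (S : 'M[R]_n.+1) : R := Num.sqrt n.+1%:R * fnorm S.

Lemma mxsize_ge0 n (S : 'M[R]_n.+1) : 0 <= mxsize S.
Proof. by rewrite mulr_ge0 ?sqrtr_ge0 ?fnorm_ge0. Qed.

(** Families of functions, one in each dimension, whose value and gradient at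
    a symmetric matrix [S] are [O(t ^ k)] and [O(sqrt dim * t ^ (k - 1))] for
    [t = mxsize S], with constants that do not depend on the dimension. The
    factor [k%:R] forces the gradient to vanish when [k] is zero, so that the
    class is stable under products. *)
Definition controlled (k : nat) f := exists2 c : R, 0 <= c &
  forall n (S : 'M[R]_n.+1), S^T = S -> `|f n S| <= c * mxsize S ^+ k /\
    exists G, [/\ G^T = G, forall V, is_derive S V (f n) (\tr (G *m V)) &
      fnorm G <= c * k%:R * Num.sqrt n.+1%:R * mxsize S ^+ k.-1].

Lemma controlled_cst a : controlled 0 (fun _ _ => a).
Proof.
exists `|a| => // n S _; split; first by rewrite expr0 mulr1.
exists 0; split; first exact: trmx0.
  by move=> V; rewrite mul0mx mxtrace0; exact: is_derive_cst.
by rewrite fnorm0 mulr0 !mul0r.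
Qed.

Lemma controlledD k f g : controlled k f -> controlled k g ->
  controlled k (fun n S => f n S + g n S).
Proof.
move=> [c c0 hf] [d d0 hg]; exists (c + d); first exact: addr_ge0.
move=> n S symS; have [f1 [F [symF dF nF]]] := hf n S symS.
have [g1 [G [symG dG nG]]] := hg n S symS; split.
  by rewrite (le_trans (ler_normD _ _))// mulrDl lerD.
exists (F + G); split.
- by rewrite linearD /= symF symG.
- by move=> V; rewrite mulmxDl mxtraceD; exact: is_derive_funD.
- by rewrite (le_trans (fnormD _ _))// !mulrDl lerD.
Qed.

Lemma controlledM a b f g : controlled a f -> controlled b g ->
  controlled (a + b) (fun n S => f n S * g n S).
Proof.
move=> [c c0 hf] [d d0 hg]; exists (c * d); first exact: mulr_ge0.
move=> n S symS; have [f1 [F [symF dF nF]]] := hf n S symS.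
have [g1 [G [symG dG nG]]] := hg n S symS; have s0 := mxsize_ge0 S; split.
  by rewrite normrM exprD mulrACA ler_pM.
exists (f n S *: G + g n S *: F); split.
- by rewrite linearD /= !linearZ /= symF symG.
- move=> V; rewrite mulmxDl -!scalemxAl mxtraceD !mxtraceZ; exact: is_derive_funM.
set s := mxsize S in f1 g1 nF nG s0 *; set e := Num.sqrt _ in nF nG *.
have e0 : 0 <= e by exact: sqrtr_ge0.
have p1 : `|f n S| * fnorm G <= (c * d) * b%:R * e * s ^+ (a + b).-1.
  apply: (le_trans (ler_pM _ _ f1 nG)); rewrite ?fnorm_ge0//.
  rewrite (_ : c * s ^+ a * _ = c * d * b%:R * e * (s ^+ a * s ^+ b.-1)); last by ring.
  by case: b {hg g1 nG} => [|b]; rewrite ?mulr0 ?mul0r// -exprD addnS.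
have p2 : `|g n S| * fnorm F <= (c * d) * a%:R * e * s ^+ (a + b).-1.
  apply: (le_trans (ler_pM _ _ g1 nF)); rewrite ?fnorm_ge0//.
  rewrite (_ : d * s ^+ b * _ = c * d * a%:R * e * (s ^+ b * s ^+ a.-1)); last by ring.
  by case: a {hf f1 nF p1} => [|a]; rewrite ?mulr0 ?mul0r// -exprD addnC addSn.
apply: (le_trans (fnormD _ _)); rewrite !fnormZ.
by rewrite natrD mulrDr !mulrDl addrC lerD.
Qed.

Lemma controlledZ k a f : controlled k f -> controlled k (fun n S => a * f n S).
Proof. by move=> hf; exact: (controlledM (controlled_cst a) hf). Qed.

Lemma controlledX k m f : controlled k f -> controlled (k * m) (fun n S => f n S ^+ m).
Proof.
move=> hf; elim: m => [|m IH]; first by rewrite muln0; exact: controlled_cst 1.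
rewrite mulnS; have := controlledM hf IH.
congr (controlled _ _); apply/functional_extensionality_dep => n.
by apply/funext => S; rewrite exprS.
Qed.

Lemma controlled_sum I (r : seq I) (P : pred I) k (F : I -> matfun) :
  (forall i, P i -> controlled k (F i)) ->
  controlled k (fun n S => \sum_(i <- r | P i) F i n S).
Proof.
move=> hF; elim: r => [|i r IH].
  exists 0 => // n S symS; rewrite big_nil normr0 !mul0r; split => //.
  exists 0; split; first exact: trmx0; last by rewrite fnorm0.
  move=> V; rewrite mul0mx mxtrace0.
  by under eq_fun do rewrite big_nil; exact: is_derive_cst.
have eqF : (fun n S => \sum_(i <- i :: r | P i) F i n S) =
    (fun n S => (if P i then F i n S else 0) + \sum_(i <- r | P i) F i n S) :> matfun.
  apply/functional_extensionality_dep => n; apply/funext => S.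
  by rewrite big_cons; case: (P i); rewrite ?add0r.
rewrite eqF; case: (boolP (P i)) => [Pi|_]; first exact: controlledD (hF i Pi) IH.
by under [X in controlled _ X]functional_extensionality_dep do
  under eq_fun do rewrite add0r.
Qed.

Lemma controlled_prod I (r : seq I) (k : I -> nat) (F : I -> matfun) :
  (forall i, controlled (k i) (F i)) ->
  controlled (\sum_(i <- r) k i) (fun n S => \prod_(i <- r) F i n S).
Proof.
move=> hF; elim: r => [|i r IH].
  rewrite big_nil; have := controlled_cst 1; congr (controlled _ _).
  by apply/functional_extensionality_dep => n; apply/funext => S; rewrite big_nil.
rewrite big_cons; have := controlledM (hF i) IH; congr (controlled _ _).
by apply/functional_extensionality_dep => n; apply/funext => S; rewrite big_cons.
Qed.

Lemma controlled_mxtraceX m : controlled m.+1 (fun n S => \tr (S ^+ m.+1)).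
Proof.
exists 1 => // n S symS; split; first by rewrite mul1r; exact: mxtraceX_le.
exists (m.+1%:R *: S ^+ m); split.
- by rewrite linearZ /= trmxX.
- by move=> V; exact: is_derive_mxtraceX.
rewrite fnormZ normr_nat mul1r -mulrA ler_wpM2l// (le_trans (fnormX _ _))//.
rewrite ler_wpM2l ?sqrtr_ge0//; apply: lerXn2r; rewrite ?nnegrE ?mxsize_ge0 ?fnorm_ge0//.
by rewrite ler_peMl ?fnorm_ge0// -[leLHS]sqrtr1 ler_wsqrtr// ler1n.
Qed.

Lemma controlled_zonal k : controlled k (fun n S => zonal k S).
Proof.
apply: controlledZ; apply: controlled_sum => i /eqP ki.
rewrite -[X in controlled X _]ki.
apply: controlled_prod => j; have := controlledZ (((i j)`!%:R * (2 * j.+1%:R) ^+ i j)^-1)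
  (controlledX (i j) (controlled_mxtraceX j)).
congr (controlled _ _); apply/functional_extensionality_dep => n.
by apply/funext => S; rewrite mulrC.
Qed.

Lemma zonal_le k : exists2 c : R, 0 <= c & forall n (S : 'M[R]_n.+1), S^T = S ->
  [/\ `|zonal k S| <= c * mxsize S ^+ k,
      (gradient (zonal k) S)^T = gradient (zonal k) S &
      fnorm (gradient (zonal k) S) <= c * Num.sqrt n.+1%:R * mxsize S ^+ k.-1].
Proof.
have [c c0 hc] := controlled_zonal k.
exists (c + c * k%:R); first by rewrite addr_ge0// mulr_ge0.
move=> n S symS; have [h1 [G [symG dG nG]]] := hc n S symS.
have s0 := mxsize_ge0 S.
rewrite (gradientE symG dG); split => //.
  by rewrite (le_trans h1)// ler_wpM2r ?exprn_ge0// lerDl mulr_ge0.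
rewrite (le_trans nG)// ler_wpM2r ?exprn_ge0// ler_wpM2r ?sqrtr_ge0//.
by rewrite lerDr.
Qed.

End controlled_functions.

(** * Zonal polynomials of degree one and two *)
Section zonal_low.
Context {R : realType} (n : nat).
Implicit Types S : 'M[R]_n.+1.

Lemma zonal1E S : zonal 1 S = \tr S.
Proof.
rewrite /zonal /rising big_ord1 addr0 (big_pred1 [ffun=> ord_max]) => [|i].
  rewrite big_ord1 ffunE (_ : (ord_max : 'I_2) = 1%N :> nat)// (_ : 1`! = 1%N)// !expr1.
  rewrite (_ : (ord0 : 'I_1).+1%:R = 1)//.
  by field.
rewrite big_ord1 mul1n; apply/eqP/eqP => [i1|->]; last by rewrite ffunE.
by apply/ffunP => j; rewrite ffunE (ord1 j); apply: val_inj.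
Qed.

Lemma zonal2E S : zonal 2 S = 3^-1 * (2 * \tr (S ^+ 2) + \tr S ^+ 2).
Proof.
(* The partitions 1 + 1 and 2 of the number 2. *)
pose a : {ffun 'I_2 -> 'I_3} := [ffun j => if j == ord0 then inord 2 else inord 0].
pose b : {ffun 'I_2 -> 'I_3} := [ffun j => if j == ord0 then inord 0 else inord 1].
have ab : a != b.
  apply/eqP => /ffunP/(_ ord0); rewrite !ffunE /= => /(congr1 val).
  by rewrite /= !inordK.
have eqab (i : {ffun 'I_2 -> 'I_3}) :
    (\sum_(j < 2) j.+1 * i j == 2)%N = (i == a) || (i == b).
  rewrite !big_ord_recl big_ord0 /= mul1n addn0.
  apply/eqP/orP => [h|[/eqP->|/eqP->]]; last 2 first.
  - by rewrite !ffunE /= !inordK.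
  - by rewrite !ffunE /= !inordK.
  have {}h : (i ord0 + 2 * i (lift ord0 ord0))%N = 2%N by exact: h.
  have kE (k : 'I_1) : k = ord0 by exact: ord1.
  have [i10|i10] := eqVneq (i (lift ord0 ord0) : nat) 0%N; [left|right];
    apply/eqP/ffunP => j; apply: val_inj; rewrite !ffunE;
    have [k ->|->] := unliftP ord0 j; rewrite ?(kE k) /= ?inordK//;
    move: h i10; move: (nat_of_ord (i ord0)) (nat_of_ord (i (lift ord0 ord0))); lia.
rewrite /zonal (eq_bigl _ _ eqab) (bigD1 a) ?eqxx//= (big_pred1 b) => [|i]; last first.
  rewrite /=; have [->|] := eqVneq i b; first by rewrite orbT eq_sym ab.
  by rewrite orbF andbN.
rewrite /rising !big_ord_recl !big_ord0 !ffunE /= !inordK//.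
rewrite !expr0 !expr1 /= /bump /=.
rewrite (_ : 2`! = 2%N)// (_ : 1`! = 1%N)// (_ : 0`! = 1%N)// (_ : (1 + 0)%N = 1%N)//.
by field.
Qed.

Lemma gradient_zonal1 S : gradient (zonal 1) S = 1%:M.
Proof.
apply: gradientE => [|V]; first exact: trmx1.
have -> : @zonal R n.+1 1 = (fun A => \tr (A ^+ 1)) by apply/funext => A; rewrite zonal1E.
by have := is_derive_mxtraceX 0 S V; rewrite expr0 scale1r.
Qed.

Lemma gradient_zonal2 S : S^T = S ->
  gradient (zonal 2) S = (2 / 3) *: (\tr S *: 1%:M + 2 *: S).
Proof.
move=> symS; apply: gradientE => [|V].
  by rewrite linearZ linearD !linearZ /= trmx1 symS.
have -> : @zonal R n.+1 2 = (fun A => 3^-1 * (2 * \tr (A ^+ 2) + \tr (A ^+ 1) * \tr (A ^+ 1))).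
  by apply/funext => A; rewrite zonal2E expr1 expr2.
have cst c : is_derive S V (fun _ : 'M[R]_n.+1 => c) (0 : R) by exact: is_derive_cst.
have d1 := is_derive_mxtraceX 0 S V; have d2 := is_derive_mxtraceX 1 S V.
have := is_derive_funM (cst 3^-1)
  (is_derive_funD (is_derive_funM (cst 2) d2) (is_derive_funM d1 d1)).
congr (is_derive _ _ _ _).
rewrite !mulr0 !addr0 expr0 !expr1 -!scalemxAl mulmxDl -!scalemxAl.
rewrite !mxtraceZ mxtraceD !mxtraceZ mul1mx.
by field.
Qed.

End zonal_low.

(** * The expansion in a fixed dimension *)
Section expansion_in_fixed_dimension.
Context {R : realType} (n : nat).
Local Notation pt := (n.+1.-tuple R).
Local Notation E := (@sphere_mean R n).
Local Notation dim := (n.+1%:R : R).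
Variables (S : 'M[R]_n.+1) (tau : R).
Hypotheses (symS : S^T = S) (tau_gt0 : 0 < tau) (tau_le : tau <= 8^-1)
  (scale_le : 4 * qscale S <= tau).

Let q : pt -> R := quad_form S.
Let w (x : pt) : R := expR (q x).
Let u (x : pt) : R := quad_form (tau^-1 *: S) x.
Let f (x : pt) : R := w x - 1 - q x.

Let bq : sphere_bounded q. Proof. exact: sphere_bounded_quad_form. Qed.
Let bw : sphere_bounded w. Proof. exact: sphere_bounded_expR. Qed.
Let b1 : sphere_bounded (fun _ : pt => 1 : R). Proof. exact: sphere_bounded_cst. Qed.
Let bf : sphere_bounded f.
Proof. by apply: sphere_boundedB => //; exact: sphere_boundedB. Qed.

Let dim_gt0 : 0 < dim. Proof. by rewrite ltr0n. Qed.
Let sqrtd_gt0 : 0 < Num.sqrt dim. Proof. by rewrite sqrtr_gt0. Qed.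
Let sqr_sqrtd : Num.sqrt dim ^+ 2 = dim. Proof. by rewrite sqr_sqrtr// ltW. Qed.

Let qE x : q x = tau * u x.
Proof. by rewrite /u quad_formZ mulrA divff ?mul1r// gt_eqF. Qed.

Let bu : sphere_bounded (fun x => expR (u x) + expR (- u x)).
Proof.
have bu : sphere_bounded u by exact: sphere_bounded_quad_form.
apply: sphere_boundedD; apply: sphere_bounded_expR => //.
have -> : (fun x => - u x) = (fun x => -1 * u x) by apply/funext => x; rewrite mulN1r.
exact: sphere_boundedZ.
Qed.

Let exp_moment : E (fun x => expR (u x) + expR (- u x)) <= 4.
Proof.
have ht0 := tau_gt0; have ht1 := tau_le; have hsc := scale_le.
apply: sphere_exp_moment_le; first by rewrite linearZ /= symS.
rewrite /qscale fnormZ gtr0_norm ?invr_gt0// -mulrA -/(qscale S).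
by rewrite mulrC ler_pdivrMr//; lra.
Qed.

Lemma sphere_mean_expR_sqr_le : E (fun x => w x ^+ 2) <= 4.
Proof.
have ht0 := tau_gt0; have ht1 := tau_le; have hsc := scale_le.
apply: le_trans exp_moment; apply: le_sphere_mean => // [|x _].
  exact: sphere_boundedX.
have h1 : 0 <= expR (u x) by exact: expR_ge0.
have h2 : 0 <= expR (- u x) by exact: expR_ge0.
rewrite /w expr2 -expRD qE; have [u0|u0] := leP 0 (u x).
  apply: (@le_trans _ _ (expR (u x))); last by rewrite lerDl.
  by rewrite ler_expR; nra.
apply: (@le_trans _ _ (expR (- u x))); last by rewrite lerDr.
by rewrite ler_expR; nra.
Qed.

(** The remainder is small in mean square, though not uniformly on the sphere,
    where [q] can be as large as the operator norm of [S]. *)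
Lemma sphere_mean_taylor_sqr_le : E (fun x => f x ^+ 2) <= (40 * tau ^+ 2) ^+ 2.
Proof.
have ht0 := tau_gt0; have ht1 := tau_le; have hsc := scale_le.
apply: (@le_trans _ _ (E (fun x => 384 * tau ^+ 4 * (expR (u x) + expR (- u x))))).
  apply: le_sphere_mean => [||x _].
  - exact: sphere_boundedX.
  - exact: sphere_boundedZ.
  - by rewrite /f /w qE; apply: sqr_expR_taylor2_le; lra.
(* 40 is the square root of 1600, which exceeds [384 * 4]. *)
rewrite sphere_meanZ// (_ : (40 * tau ^+ 2) ^+ 2 = 1600 * tau ^+ 4); last by ring.
have t4 : 0 <= tau ^+ 4 by rewrite exprn_ge0// ltW.
have := exp_moment; nra.
Qed.

Lemma fnorm_moment_mx_le g (c : R) : sphere_bounded g -> 0 <= c ->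
  E (fun x => g x ^+ 2) <= c ^+ 2 -> fnorm (moment_mx g) <= c / Num.sqrt dim.
Proof.
move=> bg c0 gc; rewrite -(@ler_pXn2r _ 2)// ?nnegrE ?fnorm_ge0//; last first.
  by rewrite divr_ge0// ltW.
apply: le_trans (fnorm_moment_mx bg) _; rewrite expr_div_n sqr_sqrtd.
by rewrite ler_pM2r// invr_gt0.
Qed.

Lemma moment_mx_expansion :
  moment_mx w = moment_mx (fun=> 1) + moment_mx q + moment_mx f.
Proof.
rewrite -moment_mxD// -moment_mxD//; last exact: sphere_boundedD.
by congr moment_mx; apply/funext => x; rewrite /f; ring.
Qed.

Lemma fnorm_moment_expR : fnorm (moment_mx w) <= 2 / Num.sqrt dim.
Proof.
have ht0 := tau_gt0; have ht1 := tau_le; have hsc := scale_le.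
apply: fnorm_moment_mx_le => //; apply: le_trans sphere_mean_expR_sqr_le _.
by rewrite expr2; lra.
Qed.

Lemma fnorm_moment_taylor : fnorm (moment_mx f) <= 40 * tau ^+ 2 / Num.sqrt dim.
Proof.
apply: fnorm_moment_mx_le => //; first by rewrite mulr_ge0// sqr_ge0.
exact: sphere_mean_taylor_sqr_le.
Qed.

Let scale0 : 0 <= qscale S. Proof. exact: qscale_ge0. Qed.

Lemma fnorm_moment_quad : fnorm (moment_mx q) <= tau / Num.sqrt dim.
Proof.
have ht0 := tau_gt0; have ht1 := tau_le; have hsc := scale_le; have hs0 := scale0.
apply: fnorm_moment_mx_le => //; first lra.
apply: le_trans (sphere_mean_quad_form_sqr symS) _.
have -> : fnorm S ^+ 2 / dim = qscale S ^+ 2 by rewrite /qscale expr_div_n sqr_sqrtd.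
by apply: lerXn2r; rewrite ?nnegrE; lra.
Qed.

Lemma mxtrace_dim_le : `|\tr S / dim| <= tau.
Proof.
have ht0 := tau_gt0; have ht1 := tau_le; have hsc := scale_le; have hs0 := scale0.
rewrite normrM [X in _ * X]gtr0_norm ?invr_gt0//.
apply: (@le_trans _ _ (qscale S)); last lra.
by rewrite -qscaleE ler_pM2r ?invr_gt0// mxtrace_le.
Qed.

Lemma sphere_mean_expR_near : `|E w - 1 - \tr S / dim| <= 40 * tau ^+ 2.
Proof.
have -> : E w - 1 - \tr S / dim = E f.
  rewrite -sphere_mean_quad_form sphere_meanB//; last exact: sphere_boundedB.
  by rewrite sphere_meanB// sphere_mean_cst.
apply: ler_sqr_abs; first by rewrite mulr_ge0// sqr_ge0.
apply: le_trans sphere_mean_taylor_sqr_le.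
have := sphere_cauchy_schwarz bf b1.
have -> : E (fun x => f x * 1) = E f by apply: eq_sphere_mean => x _; rewrite mulr1.
have -> : E (fun=> 1 ^+ 2) = 1 by rewrite sphere_mean_cst expr1n.
by rewrite mulr1.
Qed.

Lemma sphere_mean_expR_ge : 2^-1 <= E w.
Proof.
have ht0 := tau_gt0; have ht1 := tau_le; have hsc := scale_le; have hs0 := scale0.
apply: (@le_trans _ _ (E (fun x => 1 + q x))); last first.
  apply: le_sphere_mean => // [|x _]; first exact: sphere_boundedD.
  exact: expR_ge1Dx.
rewrite sphere_meanD// sphere_mean_cst sphere_mean_quad_form.
have := mxtrace_dim_le; rewrite ler_norml => /andP[+ _]; move: (\tr S / dim) => z h. lra.
Qed.

(** With [A = E w - 1], [A'] an approximation of [A] and [B'] an approximation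
    of [B = moment_mx w],
    [B / (1 + A) - (1 - A') B' = A^2 / (1 + A) B + (A' - A) B + (1 - A') (B - B')].
    The parameter [e] is [tau] or [tau ^+ 2], according to whether [B'] contains
    the second term of [B]. *)
Lemma expansion_error_le (A' : R) (B' : 'M[R]_n.+1) (c e : R) :
  0 <= c -> tau ^+ 2 <= e ->
  `|A' - \tr S / dim| <= c * tau ^+ 2 ->
  fnorm (moment_mx w - B') <= c * e / Num.sqrt dim ->
  fnorm ((E w)^-1 *: moment_mx w - (1 - A') *: B') <=
  (4 * 41 ^+ 2 + 2 * (40 + c) + (2 + c) * c) * e / Num.sqrt dim.
Proof.
have ht0 := tau_gt0; have ht1 := tau_le; have hsc := scale_le; have hs0 := scale0.
move=> c0 te hA hB; set B := moment_mx w in hB *; set A := E w - 1.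
have w12 := sphere_mean_expR_ge.
have Ew0 : E w != 0 by rewrite gt_eqF//; lra.
have -> : (E w)^-1 *: B - (1 - A') *: B' =
    (A ^+ 2 / E w) *: B + (A' - A) *: B + (1 - A') *: (B - B').
  rewrite scalerBr !addrA -!scalerDl; congr (_ *: _ - _).
  by rewrite /A; field.
have hw := sphere_mean_expR_near; have htr := mxtrace_dim_le.
have t2 : 0 <= tau ^+ 2 by exact: sqr_ge0.
have t2t : tau ^+ 2 <= tau by rewrite expr2 ler_piMr//; lra.
have t21 : tau ^+ 2 <= 1 by lra.
have A_le : `|A| <= 41 * tau.
  have -> : A = (E w - 1 - \tr S / dim) + \tr S / dim by rewrite /A; ring.
  by rewrite (le_trans (ler_normD _ _))//; lra.
have A2 : `|A ^+ 2 / E w| <= 2 * 41 ^+ 2 * e.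
  rewrite normrM normrX [`|(E w)^-1|]gtr0_norm ?invr_gt0; last lra.
  have i2 : (E w)^-1 <= 2 by rewrite -[2]invrK lef_pV2// posrE; lra.
  have i0 : 0 <= (E w)^-1 by rewrite invr_ge0; lra.
  have : `|A| ^+ 2 <= 41 ^+ 2 * e.
    apply: (@le_trans _ _ ((41 * tau) ^+ 2)).
      by apply: lerXn2r; rewrite ?nnegrE//; lra.
    by rewrite exprMn ler_pM2l.
  have : 0 <= `|A| ^+ 2 by exact: sqr_ge0.
  nra.
have AA : `|A' - A| <= (40 + c) * e.
  have -> : A' - A = (A' - \tr S / dim) - (E w - 1 - \tr S / dim) by rewrite /A; ring.
  apply: (le_trans (ler_normB _ _)); nra.
have A1 : `|1 - A'| <= 2 + c.
  have -> : 1 - A' = 1 - (A' - \tr S / dim) - \tr S / dim by ring.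
  apply: (le_trans (ler_normB _ _)); apply: (le_trans (lerD (ler_normB _ _) (lexx _))).
  rewrite normr1; nra.
have hB2 := fnorm_moment_expR; rewrite -/B in hB2.
have s0 : 0 <= (Num.sqrt dim)^-1 by rewrite invr_ge0 ltW.
apply: (le_trans (fnormD _ _)); apply: (le_trans (lerD (fnormD _ _) (lexx _))).
rewrite !fnormZ.
have p1 : `|A ^+ 2 / E w| * fnorm B <= 2 * 41 ^+ 2 * e * (2 / Num.sqrt dim).
  by apply: ler_pM => //; exact: fnorm_ge0.
have p2 : `|A' - A| * fnorm B <= (40 + c) * e * (2 / Num.sqrt dim).
  by apply: ler_pM => //; exact: fnorm_ge0.
have p3 : `|1 - A'| * fnorm (B - B') <= (2 + c) * (c * e / Num.sqrt dim).
  by apply: ler_pM => //; exact: fnorm_ge0.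
apply: (le_trans (lerD (lerD p1 p2) p3)).
rewrite le_eqVlt; apply/orP; left; apply/eqP; ring.
Qed.

End expansion_in_fixed_dimension.

(** * Uniform bounds on the terms of the two sums *)
Section expansion_terms.
Context {R : realType}.
Local Notation dim n := (n.+1%:R : R).

Lemma rising_gt0 (a : R) k : 0 < a -> 0 < rising a k.
Proof. by move=> a0; rewrite prodr_gt0// => i _; rewrite ltr_wpDr. Qed.

Lemma rising_ge (a : R) k : 0 < a -> a ^+ k <= rising a k.
Proof.
move=> a0; rewrite /rising -[k in leLHS]card_ord -prodr_const.
by apply: ler_prod => i _; rewrite ltW//= lerDl.
Qed.

Definition expansion_coef n k : R := rising (2^-1) k / rising (dim n / 2) k.

Lemma expansion_coef_ge0 n k : 0 <= expansion_coef n k.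
Proof. by rewrite divr_ge0// ltW// rising_gt0// ?divr_gt0// ltr0n. Qed.

Lemma expansion_coef_le n k :
  expansion_coef n k <= rising (2^-1) k * 2 ^+ k / dim n ^+ k.
Proof.
have d0 : 0 < dim n by rewrite ltr0n.
rewrite /expansion_coef -mulrA ler_wpM2l//; first by rewrite ltW// rising_gt0.
have -> : 2 ^+ k / dim n ^+ k = ((dim n / 2) ^+ k)^-1.
  by rewrite expr_div_n invf_div.
rewrite lef_pV2 ?posrE ?exprn_gt0 ?rising_gt0 ?divr_gt0//.
by apply: rising_ge; rewrite divr_gt0.
Qed.

Definition scalar_term n k (S : 'M[R]_n.+1) : R :=
  expansion_coef n k * (zonal k S / k`!%:R).

Definition matrix_term n k (S : 'M[R]_n.+1) : 'M[R]_n.+1 :=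
  expansion_coef n k *: (k`!%:R^-1 *: gradient (zonal k) S).

(** The rising factorial of [dim / 2] is at least [(dim / 2) ^ k], and
    [mxsize S / dim = qscale S]. *)
Lemma expansion_terms_le k : exists2 c : R, 0 <= c & forall n (S : 'M[R]_n.+1),
  S^T = S -> [/\ `|scalar_term k S| <= c * qscale S ^+ k,
    (matrix_term k S)^T = matrix_term k S &
    (0 < k)%N -> fnorm (matrix_term k S) <= c * qscale S ^+ k.-1 / Num.sqrt (dim n)].
Proof.
have [c c0 hc] := @zonal_le R k.
pose a : R := rising (2^-1) k * 2 ^+ k * k`!%:R^-1.
have a0 : 0 <= a.
  by rewrite !mulr_ge0 ?exprn_ge0 ?invr_ge0// ltW// rising_gt0.
exists (a * c); first exact: mulr_ge0.
move=> n S symS; have [h1 symG h2] := hc n S symS.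
have d0 : 0 < dim n by rewrite ltr0n.
have s0 : 0 < Num.sqrt (dim n) by rewrite sqrtr_gt0.
have ce := expansion_coef_le n k; have ce0 := expansion_coef_ge0 n k.
have m0 := mxsize_ge0 S.
split.
- rewrite /scalar_term normrM (ger0_norm ce0) normrM (ger0_norm (_ : 0 <= k`!%:R^-1)) ?invr_ge0//.
  have -> : a * c * qscale S ^+ k =
      (rising (2^-1) k * 2 ^+ k / dim n ^+ k) * (c * mxsize S ^+ k / k`!%:R).
    by rewrite -qscaleE -/(mxsize S) expr_div_n /a; ring.
  apply: ler_pM => //.
  by rewrite ler_wpM2r ?invr_ge0.
- by rewrite /matrix_term linearZ /= linearZ /= symG.
move=> k0; rewrite /matrix_term !fnormZ (ger0_norm ce0).
rewrite (ger0_norm (_ : 0 <= k`!%:R^-1)) ?invr_ge0//.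
have -> : a * c * qscale S ^+ k.-1 / Num.sqrt (dim n) =
    (rising (2^-1) k * 2 ^+ k / dim n ^+ k) *
    (k`!%:R^-1 * (c * Num.sqrt (dim n) * mxsize S ^+ k.-1)).
  have -> : (Num.sqrt (dim n))^-1 = Num.sqrt (dim n) / dim n.
    rewrite -{3}(sqr_sqrtr (ltW d0)); field.
    by rewrite ?nat1r gt_eqF.
  have -> : dim n ^+ k = dim n ^+ k.-1 * dim n by rewrite -exprSr prednK.
  by rewrite -qscaleE -/(mxsize S) expr_div_n /a invfM; ring.
apply: ler_pM => //; first by rewrite mulr_ge0 ?invr_ge0 ?fnorm_ge0.
by rewrite ler_wpM2l ?invr_ge0.
Qed.

Lemma scalar_term1 n (S : 'M[R]_n.+1) : scalar_term 1 S = \tr S / dim n.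
Proof.
rewrite /scalar_term /expansion_coef /rising !big_ord1 !addr0 zonal1E (_ : 1`! = 1%N)//.
by field; rewrite nat1r pnatr_eq0.
Qed.

Lemma matrix_term1 n (S : 'M[R]_n.+1) : matrix_term 1 S = moment_mx (fun=> 1).
Proof.
rewrite /matrix_term gradient_zonal1 moment_mx1 scalerA; congr (_ *: _).
rewrite /expansion_coef /rising !big_ord1 !addr0 (_ : 1`! = 1%N)//.
by field; rewrite nat1r pnatr_eq0.
Qed.

Lemma matrix_term2 n (S : 'M[R]_n.+1) : S^T = S ->
  matrix_term 2 S = moment_mx (quad_form S).
Proof.
move=> symS; rewrite /matrix_term gradient_zonal2// moment_mx_quad_form// !scalerA.
congr (_ *: _).
rewrite /expansion_coef /rising !big_ord_recl !big_ord0 /= (_ : 2`! = 2%N)//.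
rewrite !addr0 /bump /= addn0.
have d0 : dim n != 0 by rewrite pnatr_eq0.
have d2 : dim n + 2 != 0 by rewrite gt_eqF// addr_gt0// ltr0n.
field.
by rewrite nat1r d2 d0.
Qed.

(** Here [x] is to range over all dimensions, matrices and scales at once, so
    that [c] depends on none of them; the family [V] lets one statement serve the
    scalar and the matrix sums. *)
Lemma uniform_sum_le (I : Type) (V : I -> zmodType) (nm : forall x, V x -> R)
    (F : nat -> forall x, V x) (g : I -> R) (good : I -> Prop) a l :
  (forall x, nm x 0 = 0) -> (forall x u v, nm x (u + v) <= nm x u + nm x v) ->
  (forall j, (a <= j)%N -> exists2 c, 0 <= c & forall x, good x -> nm x (F j x) <= c * g x) ->
  exists2 c, 0 <= c & forall x, good x -> nm x (\sum_(a <= j < l) F j x) <= c * g x.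
Proof.
move=> nm0 nmD hF; elim: l => [|l [c c0 IH]].
  by exists 0 => // x _; rewrite big_geq// nm0 mul0r.
have [al|la] := leqP a l; last first.
  by exists 0 => // x _; rewrite big_geq// nm0 mul0r.
have [d d0 hd] := hF l al; exists (c + d); first exact: addr_ge0.
move=> x gx; rewrite big_nat_recr//= mulrDl (le_trans (nmD _ _ _))//.
by rewrite lerD ?IH ?hd.
Qed.

End expansion_terms.

(** * The asymptotic expansion *)
Section uniform_expansion.
Context {R : realType}.
Local Notation dim n := (n.+1%:R : R).

(** A dimension, a parameter matrix and a scale, packed together so that
    constants can be uniform in all three. *)
Let datum := {n : nat & ('M[R]_n.+1 * R)%type}.
Let mx (x : datum) : 'M[R]_((projT1 x).+1) := (projT2 x).1.
Let scale (x : datum) : R := (projT2 x).2.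
Let good (x : datum) : Prop :=
  [/\ (mx x)^T = mx x, 0 < scale x, scale x <= 8^-1 & 4 * qscale (mx x) <= scale x].

Lemma qscaleX_le n (S : 'M[R]_n.+1) (tau : R) k : (2 <= k)%N ->
  0 < tau -> tau <= 8^-1 -> 4 * qscale S <= tau -> qscale S ^+ k <= tau ^+ 2.
Proof.
move=> k2 t0 t1 ht; have s0 := qscale_ge0 S.
have s1 : qscale S <= tau by lra.
apply: (@le_trans _ _ (qscale S ^+ 2)); last by apply: lerXn2r; rewrite ?nnegrE//; lra.
by apply: ler_wiXn2l => //; lra.
Qed.

Lemma bingham_expansion_error_le l m : (2 <= l)%N -> (2 <= m)%N ->
  exists2 C : R, 0 <= C & forall n (S : 'M[R]_n.+1) (tau : R),
    S^T = S -> 0 < tau -> tau <= 8^-1 -> 4 * qscale S <= tau ->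
    fnorm ((sphere_mean (fun x => expR (quad_form S x)))^-1
             *: moment_mx (fun x => expR (quad_form S x))
           - (1 - \sum_(1 <= j < l) scalar_term j S)
             *: \sum_(1 <= k < m) matrix_term k S)
    <= C * (if m == 2%N then tau else tau ^+ 2) / Num.sqrt (dim n).
Proof.
move=> l2 m2.
have [c1 c10 h1] : exists2 c : R, 0 <= c & forall x : datum, good x ->
    `|\sum_(2 <= j < l) scalar_term j (mx x)| <= c * scale x ^+ 2.
  apply: (@uniform_sum_le R datum (fun=> R) (fun=> @Num.norm _ R)
    (fun j x => scalar_term j (mx x)) (fun x => scale x ^+ 2) good).
  - by move=> x; exact: normr0.
  - by move=> x; exact: ler_normD.
  - move=> j j2; have [c c0 hc] := @expansion_terms_le R j.
    exists c => // x [symx x0 x1 x2]; have [h _ _] := hc _ _ symx.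
    by apply: le_trans h _; rewrite ler_wpM2l//; exact: qscaleX_le.
have [c2 c20 h2] : exists2 c : R, 0 <= c & forall x : datum, good x ->
    fnorm (\sum_(3 <= j < m) matrix_term j (mx x)) <=
    c * (scale x ^+ 2 / Num.sqrt (dim (projT1 x))).
  apply: (@uniform_sum_le R datum (fun x => 'M[R]_((projT1 x).+1))
    (fun x => @fnorm R _ _) (fun j x => matrix_term j (mx x))
    (fun x => scale x ^+ 2 / Num.sqrt (dim (projT1 x))) good).
  - by move=> x; exact: fnorm0.
  - by move=> x; exact: fnormD.
  - move=> j j3; have [c c0 hc] := @expansion_terms_le R j.
    exists c => // x [symx x0 x1 x2]; have [_ _ h] := hc _ _ symx.
    apply: le_trans (h (ltn_trans _ j3)) _ => //; rewrite -mulrA ler_wpM2l//.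
    rewrite ler_wpM2r ?invr_ge0 ?sqrtr_ge0//; apply: qscaleX_le => //.
    by rewrite -ltnS prednK// (ltn_trans _ j3).
(* 41 covers the first and second order terms [tau + 40 * tau ^+ 2] of [B] that
   are missing from [B'] when [m] is [2]. *)
pose c := c1 + c2 + 41; have c0 : 0 <= c by rewrite !addr_ge0.
exists (4 * 41 ^+ 2 + 2 * (40 + c) + (2 + c) * c).
  by rewrite !addr_ge0// mulr_ge0// addr_ge0.
move=> n S tau symS t0 t1 ht.
have gx : good (existT _ n (S, tau)) by [].
have {}h1 := h1 _ gx; have {}h2 := h2 _ gx; rewrite /mx /scale /= in h1 h2.
have s0 : 0 <= (Num.sqrt (dim n))^-1 by rewrite invr_ge0 sqrtr_ge0.
have t20 : 0 <= tau ^+ 2 by exact: sqr_ge0.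
have t2t : tau ^+ 2 <= tau by rewrite expr2; nra.
apply: (expansion_error_le symS t0 t1 ht c0).
- by case: ifP.
- rewrite big_ltn// scalar_term1 addrC addKr (le_trans h1)//.
  by rewrite ler_wpM2r// /c; lra.
rewrite (@moment_mx_expansion _ _ S) big_ltn// matrix_term1.
have hq := fnorm_moment_quad symS t0 t1 ht.
have hf := fnorm_moment_taylor symS t0 t1 ht.
case: ifPn => [/eqP->|m_neq2].
  rewrite big_geq// addr0.
  rewrite -[moment_mx (fun=> 1) + _ + _]addrA [moment_mx (fun=> 1) + _]addrC addrK.
  apply: (le_trans (fnormD _ _)); apply: (le_trans (lerD hq hf)).
  rewrite -mulrDl ler_wpM2r//.
  have := mulr_ge0 c10 (ltW t0); have := mulr_ge0 c20 (ltW t0); rewrite /c; lra.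
have m3 : (2 < m)%N by rewrite ltn_neqAle eq_sym m_neq2.
rewrite big_ltn// matrix_term2//.
set M1 := moment_mx _; set M2 := moment_mx _; set M3 := moment_mx _; set B := \sum_(_ <= _ < _) _.
have -> : M1 + M2 + M3 - (M1 + (M2 + B)) = M3 - B.
  by rewrite [M1 + (M2 + B)]addrA opprD addrA [M1 + M2 + M3]addrC addrK.
apply: (le_trans (fnormB _ _)); apply: (le_trans (lerD hf h2)).
rewrite mulrA -mulrDl ler_wpM2r// -mulrDl ler_wpM2r//; rewrite /c; lra.
Qed.

End uniform_expansion.

Lemma bingham_cov_error_le (R : realType) l m : (2 <= l)%N -> (2 <= m)%N ->
  exists2 C : R, 0 <= C & forall (d : nat) (S : 'M[R]_d) (tau : R)
    (disp : measure_display) (T : measurableType disp) (P : probability T R)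
    (X : {RV P >-> d.-tuple R}),
    (0 < d)%N -> S^T = S -> has_bingham X S ->
    0 < tau -> tau <= 8^-1 -> 4 * (fnorm S / Num.sqrt d%:R) <= tau ->
    frobenius
      (cov_matrix P X
       - (1 - \sum_(1 <= j < l) rising (2^-1) j / rising (d%:R / 2) j
                * (zonal j S / j`!%:R))
         *: (\sum_(1 <= k < m) (rising (2^-1) k / rising (d%:R / 2) k)
                *: (k`!%:R^-1 *: gradient (zonal k) S)))
    <= C * (if m == 2%N then tau else tau ^+ 2) / Num.sqrt d%:R.
Proof.
move=> l2 m2; have [C C0 hC] := bingham_expansion_error_le (R := R) l2 m2.
exists C => // -[//|n] S tau disp T P X _ symS bX t0 t1 ht.
rewrite frobeniusE; first by rewrite (cov_matrix_bingham bX); exact: hC.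
have symB : (\sum_(1 <= k < m) matrix_term k S)^T = \sum_(1 <= k < m) matrix_term k S.
  rewrite linear_sum; apply: eq_bigr => k _; have [c c0 h] := @expansion_terms_le R k.
  by have [] := h n S symS.
by rewrite (cov_matrix_bingham bX) linearB /= !linearZ /= trmx_moment_mx symB.
Qed.

Theorem theorem3p3 (R : realType) (gamma0 r : R)
    (hgamma0 : 0 < gamma0) (hr : 0 <= r < 1)
    (gamma1 gamma2 : R)
    (hgamma1 : gamma1 = 2^-1 * (1 + Num.sqrt 3))
    (hgamma2 : gamma2 = gamma0 * gamma1)
    (Sigma : forall d : nat, 'M[R]_d)
    (hsym : forall d : nat, (2 <= d)%N -> (Sigma d)^T = Sigma d)
    (hbound : forall d : nat, (2 <= d)%N ->
       frobenius (Sigma d) <= gamma0 * d%:R `^ (r / 2))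
    (disp : nat -> measure_display)
    (T : forall d : nat, measurableType (disp d))
    (P : forall d : nat, probability (T d) R)
    (X : forall d : nat, {RV (P d) >-> d.-tuple R})
    (hX : forall d : nat, (2 <= d)%N -> has_bingham (X d) (Sigma d))
    (l m : nat) (hl : (2 <= l)%N) (hm : (2 <= m)%N)
    (alpha : R)
    (halpha : alpha = 2^-1 * Num.min (3 - 2 * r) (1 + (m%:R - 1) * (1 - r))) :
  alpha = (if (m == 2)%N then 2^-1 * (2 - r) else 2^-1 * (3 - 2 * r)) /\
  exists2 gamma : R, 0 < gamma &
    forall d : nat, (2 <= d)%N ->
      (6 * gamma2 ^+ 2) `^ (1 - r)^-1 < d%:R ->
      frobenius
        (cov_matrix (P d) (X d)
         - (1 - \sum_(1 <= j < l)
                  rising (2^-1) j / rising (d%:R / 2) j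
                    * (zonal j (Sigma d) / j`!%:R))
           *: (\sum_(1 <= k < m)
                 (rising (2^-1) k / rising (d%:R / 2) k)
                   *: (k`!%:R^-1 *: gradient (zonal k) (Sigma d))))
      <= gamma * d%:R `^ (- alpha).
Proof.
have /andP[r0 r1] := hr.
have alphaE : alpha = (if (m == 2)%N then 2^-1 * (2 - r) else 2^-1 * (3 - 2 * r)).
  rewrite halpha; case: ifPn => [/eqP ->|m2]; congr (_ * _).
    rewrite min_r; first ring.
    by lra.
  have m3 : (3 : R) <= m%:R by rewrite ler_nat ltn_neqAle eq_sym m2.
  by rewrite min_l//; nra.
split => //.
pose err d : R := frobenius
  (cov_matrix (P d) (X d)
   - (1 - \sum_(1 <= j < l) rising (2^-1) j / rising (d%:R / 2) j
            * (zonal j (Sigma d) / j`!%:R))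
     *: (\sum_(1 <= k < m) (rising (2^-1) k / rising (d%:R / 2) k)
            *: (k`!%:R^-1 *: gradient (zonal k) (Sigma d)))).
have [C C0 hC] := bingham_cov_error_le R hl hm.
(* By the bound on [Sigma d], [tau d] is at least four times its [qscale]; both
   cases of [alphaE] are the exponent of [tau d] or [tau d ^+ 2] over [sqrt d]. *)
pose beta : R := (1 - r) / 2; have beta0 : 0 < beta by rewrite /beta; lra.
pose tau d : R := 4 * gamma0 * d%:R `^ (- beta).
pose K : R := C * (if m == 2%N then 4 * gamma0 else (4 * gamma0) ^+ 2).
have large d : (2 <= d)%N -> tau d <= 8^-1 -> err d <= K * d%:R `^ (- alpha).
  move=> d2 td; have d0 : 0 < d%:R :> R by rewrite ltr0n (ltn_trans _ d2).
  have td0 : 0 < tau d by rewrite /tau mulr_gt0 ?powR_gt0// mulr_gt0.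
  have sqrtE : (Num.sqrt d%:R)^-1 = d%:R `^ (- 2^-1) :> R.
    by rewrite powRN powR12_sqrt// ltW.
  have -> : K * d%:R `^ (- alpha) =
      C * (if m == 2%N then tau d else tau d ^+ 2) / Num.sqrt d%:R.
    have dn0 (b : bool) : b ==> ((d%:R : R) != 0) by rewrite gt_eqF// implybT.
    rewrite sqrtE /K alphaE /tau; case: ifP => _.
      rewrite -!mulrA; do 3 congr (_ * _); rewrite -powRD//; congr (_ `^ _).
      by rewrite /beta; field.
    rewrite [(_ * d%:R `^ _) ^+ 2]exprMn -!mulrA; do 2 congr (_ * _).
    do 3 congr (_ * _); rewrite -!powRD//; congr (_ `^ _).
    by rewrite /beta; field.
  have symS := hsym d d2; have bS := hbound d d2.
  apply: hC => //; [exact: ltn_trans d2|exact: hX|].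
  rewrite /tau -[leRHS]mulrA ler_wpM2l// -frobeniusE// sqrtE.
  apply: (@le_trans _ _ (gamma0 * d%:R `^ (r / 2) * d%:R `^ (- 2^-1))).
    by rewrite ler_wpM2r// powR_ge0.
  rewrite -mulrA -powRD; last by rewrite (gt_eqF d0) implybT.
  rewrite (_ : r / 2 + - 2^-1 = - beta)//.
  by rewrite /beta; field.
(* From dimension [N] on, the scale [tau] is at most [8^-1]. *)
pose N := (Num.truncn ((32 * gamma0) `^ beta^-1)).+1.
have tau_small d : (N <= d)%N -> tau d <= 8^-1.
  move=> Nd; have x0 : 0 <= 32 * gamma0 by rewrite mulr_ge0// ltW.
  have dN : (32 * gamma0) `^ beta^-1 <= d%:R.
    by rewrite (le_trans (ltW (truncnS_gt _)))// ler_nat.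
  have h : 32 * gamma0 <= d%:R `^ beta.
    have := ge0_ler_powR (ltW beta0) (powR_ge0 _ _) (ler0n R d) dN.
    by rewrite -powRrM mulVf ?gt_eqF// powRr1.
  have p0 : 0 < d%:R `^ beta by rewrite (lt_le_trans _ h)// mulr_gt0.
  rewrite /tau powRN ler_pdivrMr//; lra.
have K0 : 0 <= K.
  by rewrite /K mulr_ge0//; case: ifP => _; rewrite ?exprn_ge0 // mulr_ge0// ltW.
(* The sum bounds the error in the finitely many dimensions below [N]. *)
exists (K + 1 + \sum_(d < N) err d * d%:R `^ alpha).
  rewrite ltr_wpDr ?ltr_wpDl//; apply: sumr_ge0 => d _.
  by rewrite mulr_ge0 ?sqrtr_ge0 ?powR_ge0.
move=> d d2 _; rewrite -/(err d).
have p0 : 0 < d%:R `^ (- alpha) :> R by rewrite powR_gt0// ltr0n (ltn_trans _ d2).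
have err0 k : 0 <= err k * k%:R `^ alpha.
  by rewrite mulr_ge0 ?sqrtr_ge0 ?powR_ge0.
have [Nd|dN] := leqP N d.
  rewrite (le_trans (large d d2 (tau_small d Nd)))// ler_wpM2r ?(ltW p0)//.
  by rewrite -addrA lerDl addr_ge0// sumr_ge0.
have -> : err d = err d * d%:R `^ alpha * d%:R `^ (- alpha).
  by rewrite powRN mulfK// gt_eqF// powR_gt0// ltr0n (ltn_trans _ d2).
rewrite ler_wpM2r ?(ltW p0)// (bigD1 (Ordinal dN))//= addrCA lerDl.
by rewrite !addr_ge0// sumr_ge0.
Qed.
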